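(* Let $k$ be an algebraically closed field of characteristic $0$ and let $R$ be a commutative complete Gorenstein local $k$-algebra with residue field $k$ which is of finite representation type. Let $M$ and $N$ be Cohen-Macaulay $R$-modules. Suppose that $\dim_k \underline{\mathrm{Hom}}_R(X,M)=\dim_k\underline{\mathrm{Hom}}_R(X,N)$ for each object $\underline{X}$ of $\underline{\mathrm{CM}}(R)$. Then $\underline{M}\oplus\underline{\Omega M}\cong\underline{N}\oplus\underline{\Omega N}$ in $\underline{\mathrm{CM}}(R)$.
   Context: Local rings are Noetherian. A finitely generated $R$-module $M$ is called Cohen-Macaulay if $\mathrm{Ext}^i_R(M,R)=0$ for all $i>0$; $\mathrm{CM}(R)$ is the category of these modules with all $R$-homomorphisms. The stable category $\underline{\mathrm{CM}}(R)$ has the same objects as $\mathrm{CM}(R)$ and morphisms $\underline{\mathrm{Hom}}_R(M,N)=\mathrm{Hom}_R(M,N)/P(M,N)$, where $P(M,N)$ is the set of homomorphisms $M\to N$ factoring through a free $R$-module. $\underline{M}$ denotes $M$ viewed as an object of $\underline{\mathrm{CM}}(R)$. For a free resolution $\cdots\to F_1\xrightarrow{d}F_0\to M\to 0$ by finitely generated free modules, $\Omega M=\mathrm{Im}(d)$ is the syzygy of $M$ (well defined up to free summands). $R$ is of finite representation type if there are only finitely many isomorphism classes of indecomposable Cohen-Macaulay $R$-modules. In this case $R$ is an isolated singularity (i.e. $R_{\mathfrak p}$ is regular for every non-maximal prime $\mathfrak p$), and each $\underline{\mathrm{Hom}}_R(M,N)$ is finite dimensional over $k$. *)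

(* Defs.v *)
From HB Require Import structures.
From mathcomp Require Import all_boot all_order all_algebra.
From mathcomp Require Import boolp classical_sets.

Set Implicit Arguments.
Unset Strict Implicit.
Unset Printing Implicit Defensive.

Import GRing.Theory.
Local Open Scope classical_set_scope.
Local Open Scope ring_scope.

Section Ideals.
Variable R : comNzRingType.
Implicit Types I J m : set R.

Definition is_ideal I : Prop :=
  [/\ I 0, forall x y, I x -> I y -> I (x + y) & forall a x, I x -> I (a * x)].

Definition noetherian_ring : Prop :=
  forall I, is_ideal I ->
  exists n (g : 'I_n -> R),
    I = [set x | exists c : 'I_n -> R, x = \sum_i c i * g i].

Definition maximal_ideal m : Prop :=
  [/\ is_ideal m, m <> setT &
      forall J, is_ideal J -> m `<=` J -> J = m \/ J = setT].

(* R is local, with maximal ideal m. *)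
Definition local_ring_at m : Prop :=
  maximal_ideal m /\ forall m', maximal_ideal m' -> m' = m.

Fixpoint ideal_pow I (n : nat) : set R :=
  if n is n'.+1 then
    [set x | exists p (a b : 'I_p -> R),
       [/\ forall i, I (a i), forall i, ideal_pow I n' (b i)
         & x = \sum_i a i * b i]]
  else setT.

(* The canonical map from R to the inverse limit of the R / I^n is bijective;
   in particular R is I-adically separated. *)
Definition adically_complete I : Prop :=
  forall u : nat -> R, (forall n, ideal_pow I n (u n.+1 - u n)) ->
  exists! x, forall n, ideal_pow I n (x - u n).

End Ideals.

(* The composite map k -> R -> R / m is bijective. *)
Definition residue_field_is_base (k : fieldType) (R : comAlgType k)
    (m : set R) : Prop :=
  forall x : R, exists! c : k, m (x - c%:A).

Section Modules.
Variable R : comNzRingType.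
Implicit Types M N X A B E F : lmodType R.

Definition mod_iso M N : Prop := exists f : {linear M -> N}, bijective f.

Definition zero_module M : Prop := forall x : M, x = 0.

Definition finitely_generated M : Prop :=
  exists n (g : 'I_n -> M), forall x, exists c : 'I_n -> R,
    x = \sum_i c i *: g i.

(* F has a basis e, possibly infinite. *)
Definition free_module F : Prop :=
  exists (I : eqType) (e : I -> F),
    (forall x, exists (s : seq I) (c : I -> R), x = \sum_(i <- s) c i *: e i) /\
    (forall (s : seq I) (c : I -> R), uniq s ->
       \sum_(i <- s) c i *: e i = 0 -> forall i, i \in s -> c i = 0).

Definition exact_at A B E (f : {linear A -> B}) (g : {linear B -> E}) : Prop :=
  [set y | g y = 0] = range f.

Definition indecomposable M : Prop :=
  ~ zero_module M /\
  forall A B, mod_iso M (A * B)%type -> zero_module A \/ zero_module B.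

Definition injective_module E : Prop :=
  forall A B (i : {linear A -> B}) (f : {linear A -> E}), injective i ->
  exists g : {linear B -> E}, forall x, g (i x) = f x.

Definition finite_injective_dimension M : Prop :=
  exists (E : nat -> lmodType R) (eps : {linear M -> E 0})
         (d : forall i, {linear E i -> E i.+1}),
    [/\ forall i, injective_module (E i),
        injective eps,
        exact_at eps (d 0),
        forall i, exact_at (d i) (d i.+1)
      & exists n, forall i, (n < i)%N -> zero_module (E i)].

Record free_resolution M := FreeResolution {
  res_obj : nat -> lmodType R;
  res_d : forall i, {linear res_obj i.+1 -> res_obj i};
  res_aug : {linear res_obj 0 -> M};
  res_free : forall i, free_module (res_obj i);
  res_fg : forall i, finitely_generated (res_obj i);
  res_surj : range res_aug = setT;
  res_exact0 : exact_at (res_d 0) res_aug;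
  res_exact : forall i, exact_at (res_d i.+1) (res_d i)
}.

Section Ext.
Variables (M N : lmodType R) (F : free_resolution M).

Definition cocycle i (phi : {linear res_obj F i -> N}) : Prop :=
  forall x, phi (res_d F i x) = 0.

Definition coboundary i : {linear res_obj F i -> N} -> Prop :=
  match i with
  | 0 => fun phi => forall x, phi x = 0
  | j.+1 => fun phi =>
      exists psi : {linear res_obj F j -> N}, forall x, phi x = psi (res_d F j x)
  end.

(* Ext^i(M, N) = 0, computed as the i-th cohomology of Hom(F, N). *)
Definition Ext_vanishes i : Prop :=
  forall phi : {linear res_obj F i -> N}, cocycle phi -> coboundary phi.

End Ext.

(* The choice of resolution is immaterial, and over a noetherian ring every
   finitely generated module has one. *)
Definition cohen_macaulay M : Prop :=
  finitely_generated M /\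
  exists F : free_resolution M, forall i, (0 < i)%N -> Ext_vanishes R^o F i.

Definition finite_representation_type : Prop :=
  exists n (L : 'I_n -> lmodType R),
    forall X, cohen_macaulay X -> indecomposable X -> exists i, mod_iso X (L i).

(* P(M, N); a map of this form is automatically linear. *)
Definition factors_free M N (h : M -> N) : Prop :=
  exists (F : lmodType R) (a : {linear M -> F}) (b : {linear F -> N}),
    free_module F /\ forall x, h x = b (a x).

(* Equality of the classes of f and g in Hom(M, N) / P(M, N). *)
Definition stable_eq M N (f g : M -> N) : Prop :=
  factors_free (fun x => f x - g x).

Definition stable_iso M N : Prop :=
  exists (f : {linear M -> N}) (g : {linear N -> M}),
    stable_eq (g \o f) id /\ stable_eq (f \o g) id.

End Modules.

Definition gorenstein (R : comNzRingType) : Prop :=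
  noetherian_ring R /\ finite_injective_dimension (R^o : lmodType R).

(* dim_k (Hom(M, N) / P(M, N)) = n: the classes of b_0, ..., b_(n-1) form a
   basis over k, with k acting on N through k -> R. *)
Definition stable_hom_dim (k : fieldType) (R : comAlgType k)
    (M N : lmodType R) (n : nat) : Prop :=
  exists b : 'I_n -> {linear M -> N}, forall f : {linear M -> N},
    exists! c : {ffun 'I_n -> k},
      stable_eq f (fun x => \sum_i (c i)%:A *: b i x).

Section LinearImage.
Variables (R : comNzRingType) (U V : lmodType R) (d : {linear U -> V}).

Definition limage_pred : {pred V} := fun y => `[< range d y >].

Fact limage_pred_closed : submod_closed limage_pred.
Proof.
split; first by apply/asboolP; exists 0; rewrite ?linear0.
move=> a x y /asboolP[u _ <-] /asboolP[v _ <-].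
by apply/asboolP; exists (a *: u + v); rewrite ?linearP.
Qed.

HB.instance Definition _ :=
  GRing.isSubmodClosed.Build R V limage_pred limage_pred_closed.

Record limage := Limage { limage_val : V; _ : limage_val \in limage_pred }.

HB.instance Definition _ := [isSub for limage_val].
HB.instance Definition _ := [Choice of limage by <:].
HB.instance Definition _ := [SubChoice_isSubLmodule of limage by <:].

End LinearImage.

Definition syzygy (R : comNzRingType) (M : lmodType R) (F : free_resolution M) :
  lmodType R := limage (res_d F 0).

(* Main.v *)
Require Import Defs.
From HB Require Import structures.
From mathcomp Require Import all_boot all_order all_algebra.
From mathcomp Require Import boolp classical_sets functions generic_quotient ring_quotient.
From mathcomp Require Import zify ring.

Set Implicit Arguments.
Unset Strict Implicit.
Unset Printing Implicit Defensive.

Import GRing.Theory.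
Local Open Scope quotient_scope.
Local Open Scope classical_set_scope.
Local Open Scope ring_scope.

(* For A indecomposable and not free, let g : A -> B be left almost split in the stable
   category. It exists because there are finitely many indecomposables: collect
   generators of the radical of Hom(A, X) for each of them. If A is the syzygy of C, the
   pushout of g along A -> P gives a Cohen-Macaulay module D and a stably exact sequence
   Hom(C, M) -> Hom(D, M) -> Hom(B, M) -> Hom(A, M). Its end terms compute the
   multiplicities of A in M and in the syzygy of M, so their sum is
   dim Hom(D, M) + dim Hom(A, M) - dim Hom(B, M), which depends only on the dimensions
   that M and N share. The Krull-Schmidt property then gives the isomorphism.

   The dimensions are finite by an argument of Huneke and Leuschke: among the extensions
   r^n alpha infinitely many have isomorphic middle terms, which forces some r^n alpha
   to split. *)

(** * Submodules and Noetherian modules *)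

(** In the stable category A -> B -> D -> C is a triangle, and Hom(C, M) is Hom(A, L) for L the
    syzygy of M. At its two ends the four-term sequence sees Hom(A, M) and Hom(A, L) modulo the maps
    that factor through g, that is, modulo the radical. It yields only the sum of these two
    multiplicities, never one of them alone, which is why the conclusion concerns M together with
    its syzygy.

    The pushout requires A to be a syzygy. Finite type provides this: among the iterated syzygies of
    A two are stably isomorphic, and the syzygy functor is fully faithful.

    Two notions of indecomposability have to be matched. Completeness lifts an idempotent of the
    stable endomorphism ring of an indecomposable non-free module to a genuine idempotent, so only 0
    and 1 occur. Finite dimension over an algebraically closed field then gives each stable
    endomorphism a single eigenvalue, and in characteristic 0 the trace detects whether it vanishes.
    Finiteness of stable Hom therefore has to be established before multiplicities can be
    defined. *)

Section Submodules.
Variable R : comNzRingType.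
Implicit Types U V W M N P K : lmodType R.

Definition is_sub U (S : set U) : Prop :=
  [/\ S 0, forall x y, S x -> S y -> S (x + y) & forall a x, S x -> S (a *: x)].

Section SubTheory.
Variables (U : lmodType R) (S : set U).
Hypothesis subS : is_sub S.

Lemma sub0 : S 0. Proof. by case: subS. Qed.
Lemma subD x y : S x -> S y -> S (x + y). Proof. by case: subS => _ + _; apply. Qed.
Lemma subZ a x : S x -> S (a *: x). Proof. by case: subS => _ _; apply. Qed.
Lemma subN x : S x -> S (- x). Proof. by rewrite -scaleN1r; apply: subZ. Qed.
Lemma subB x y : S x -> S y -> S (x - y).
Proof. by move=> Sx Sy; apply: subD => //; apply: subN. Qed.
Lemma sub_sum (I : Type) (r : seq I) (Q : pred I) (F : I -> U) :
  (forall i, Q i -> S (F i)) -> S (\sum_(i <- r | Q i) F i).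
Proof. by move=> SF; apply: big_ind => //; [exact: sub0 | exact: subD]. Qed.

End SubTheory.

Definition add_sub U (S T : set U) : set U := [set x | exists2 y, S y & T (x - y)].

Lemma is_sub_add U (S T : set U) : is_sub S -> is_sub T -> is_sub (add_sub S T).
Proof.
move=> sS sT; split.
- by exists 0; [exact: sub0 | rewrite subr0; exact: sub0].
- move=> x y [x' Sx Tx] [y' Sy Ty]; exists (x' + y'); first exact: subD.
  by rewrite opprD addrACA; apply: subD.
- move=> a x [y Sy Ty]; exists (a *: y); first exact: subZ.
  by rewrite -scalerBr; apply: subZ.
Qed.

Lemma add_subl U (S T : set U) x : is_sub T -> S x -> add_sub S T x.
Proof. by move=> sT Sx; exists x; rewrite ?subrr //; apply: sub0. Qed.

Lemma add_subr U (S T : set U) x : is_sub S -> T x -> add_sub S T x.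
Proof. by move=> sS Tx; exists 0; rewrite ?subr0 //; apply: sub0. Qed.

Lemma is_sub_ker U V (f : {linear U -> V}) (S : set V) :
  is_sub S -> is_sub [set x | S (f x)].
Proof.
move=> sS; split=> /=; first by rewrite linear0; apply: sub0.
  by move=> x y; rewrite linearD; apply: subD.
by move=> a x; rewrite linearZ; apply: subZ.
Qed.

Lemma is_sub_im U V (f : {linear U -> V}) (S : set U) :
  is_sub S -> is_sub (f @` S).
Proof.
move=> sS; split; first by exists 0; rewrite ?linear0 //; apply: sub0.
  by move=> _ _ [x Sx <-] [y Sy <-]; exists (x + y); rewrite ?linearD //; apply: subD.
by move=> a _ [x Sx <-]; exists (a *: x); rewrite ?linearZ //; apply: subZ.
Qed.

Lemma is_sub0 U : is_sub [set 0 : U].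
Proof. by split=> //= [x y -> ->|a x ->]; rewrite ?addr0 ?scaler0. Qed.

Lemma is_subT U : is_sub [set: U]. Proof. by []. Qed.

(** Recursion on the list lets inductions peel off one generator at a time, as in [noeth_fg] and
    [nakayama]. *)
Fixpoint span U (s : seq U) : set U :=
  if s is g :: s' then [set x | exists c, span s' (x - c *: g)] else [set 0].

Lemma is_sub_span U (s : seq U) : is_sub (span s).
Proof.
elim: s => [|g s IHs] /=; first exact: is_sub0.
split=> [|x y [c Sc] [d Sd]|a x [c Sc]] /=.
- by exists 0; rewrite scale0r subr0; apply: sub0.
- by exists (c + d); rewrite scalerDl opprD addrACA; apply: subD.
- by exists (a * c); rewrite -scalerA -scalerBr; apply: subZ.
Qed.
Hint Resolve is_sub_span is_sub0 is_subT : core.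

Lemma span_mem U (s : seq U) x : x \in s -> span s x.
Proof.
elim: s => //= g s IHs; rewrite inE => /orP[/eqP->|/IHs xs].
  by exists 1; rewrite scale1r subrr; apply: sub0.
by exists 0; rewrite scale0r subr0.
Qed.

Lemma span_min U (s : seq U) (S : set U) :
  is_sub S -> {in s, forall x, S x} -> span s `<=` S.
Proof.
move=> sS; elim: s => [|g s IHs] sub_s x /=; first by move->; apply: sub0.
move=> [c Sc]; rewrite -(subrK (c *: g) x); apply: subD => //.
  by apply: IHs Sc => y ys; apply: sub_s; rewrite inE ys orbT.
by apply: subZ => //; apply: sub_s; rewrite mem_head.
Qed.

Lemma span_sub U (s t : seq U) : {subset s <= t} -> span s `<=` span t.
Proof. by move=> st; apply: span_min => // x /st/span_mem. Qed.

Lemma span_map U V (f : {linear U -> V}) (s : seq U) x :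
  span s x -> span (map f s) (f x).
Proof.
move: x; apply: span_min; first exact: is_sub_ker.
by move=> x xs /=; apply: span_mem; apply: map_f.
Qed.

Lemma span_ord U n (g : 'I_n -> U) x :
  span [seq g i | i <- enum 'I_n] x <-> exists c : 'I_n -> R, x = \sum_i c i *: g i.
Proof.
split=> [|[c ->]]; last first.
  apply: sub_sum => // i _; apply: subZ => //; apply: span_mem.
  by apply: map_f; rewrite mem_enum.
move: x; apply: span_min.
  split; first by exists (fun=> 0); rewrite big1 // => i _; rewrite scale0r.
  - move=> _ _ [c ->] [d ->]; exists (fun i => c i + d i).
    by rewrite -big_split; apply: eq_bigr => i _; rewrite scalerDl.
  - move=> a _ [c ->]; exists (fun i => a * c i).
    by rewrite scaler_sumr; apply: eq_bigr => i _; rewrite scalerA.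
move=> _ /mapP[i _ ->]; exists (fun j => (j == i)%:R).
rewrite (bigD1 i) //= eqxx scale1r big1 ?addr0 // => j /negPf->.
by rewrite scale0r.
Qed.

Lemma span_tnth U (s : seq U) : [seq tnth (in_tuple s) i | i <- enum 'I_(size s)] = s.
Proof. by rewrite map_tnth_enum. Qed.

Lemma fgP M : finitely_generated M <-> exists s : seq M, forall x, span s x.
Proof.
split=> [[n [g gP]]|[s sP]].
  by exists [seq g i | i <- enum 'I_n] => x; apply/span_ord/gP.
exists (size s), (tnth (in_tuple s)) => x.
by apply/span_ord; rewrite span_tnth.
Qed.

Definition noeth U : Prop :=
  forall S : set U, is_sub S -> exists s, forall x, S x <-> span s x.

(** Without a maximal member, choice builds a strictly increasing chain; its union is finitely
    generated, hence already contained in one stage. *)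
Lemma noeth_max U (Fam : set U -> Prop) : noeth U ->
  (exists S, Fam S) -> (forall S, Fam S -> is_sub S) ->
  exists2 S, Fam S & forall T, Fam T -> S `<=` T -> T `<=` S.
Proof.
move=> nU [S0 F0] subF; apply: contrapT => nomax.
have next (S : {S | Fam S}) : exists T : {S | Fam S},
    sval S `<=` sval T /\ ~ (sval T `<=` sval S).
  apply: contrapT => no; apply: nomax; exists (sval S); first exact: (svalP S).
  move=> T FT ST; apply: contrapT => nTS; apply: no.
  by exists (exist _ T FT).
have [f fP] := choice next.
pose c n := iter n f (exist _ S0 F0).
have cS n : sval (c n) `<=` sval (c n.+1) by rewrite /c iterS; case: (fP (c n)).
have cM i j : (i <= j)%N -> sval (c i) `<=` sval (c j).
  move=> /subnK<-; elim: (j - i)%N => [|d IHd] //.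
  by apply: subset_trans IHd _; rewrite addSn; apply: cS.
have sc n : is_sub (sval (c n)) by apply: subF; apply: svalP.
have [s sP] : exists s, forall x, (exists n, sval (c n) x) <-> span s x.
  apply: nU; split.
  - by exists 0; apply: sub0.
  - move=> x y [i Si] [j Sj]; exists (maxn i j).
    by apply: subD => //; [apply: cM Si | apply: cM Sj]; rewrite ?leq_maxl ?leq_maxr.
  - by move=> a x [i Si]; exists i; apply: subZ.
have [n nP] : exists n, {in s, forall x, sval (c n) x}.
  have : {in s, forall x, exists n, sval (c n) x}.
    by move=> x xs; apply/sP/span_mem.
  elim: {sP} s => [|x s IHs] sP; first by exists 0%N.
  have [i iP] := sP x (mem_head _ _).
  have [y ys|j jP] := IHs; first by apply: sP; rewrite inE ys orbT.
  exists (maxn i j) => y; rewrite inE => /orP[/eqP->|/jP].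
    by apply: cM iP; rewrite leq_maxl.
  by apply: cM; rewrite leq_maxr.
have [_] := fP (c n); apply=> x xc.
apply: (span_min (sc n) nP); apply/sP; exists n.+1.
by rewrite /c iterS.
Qed.

Lemma noeth_inj U V (f : {linear U -> V}) : injective f -> noeth V -> noeth U.
Proof.
move=> f_inj nV S sS.
have [s sP] := nV _ (is_sub_im f sS).
have [t tE] : exists t, s = map f t /\ {in t, forall x, S x}.
  have : {in s, forall y, exists2 x, S x & f x = y}.
    by move=> y ys; apply/sP/span_mem.
  elim: {sP} s => [|y s IHs] sP; first by exists [::].
  have [x Sx fx] := sP y (mem_head _ _).
  have [z zs|t [-> tP]] := IHs; first by apply: sP; rewrite inE zs orbT.
  by exists (x :: t); rewrite -fx; split=> // z; rewrite inE => /orP[/eqP->|/tP].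
exists t => x; split=> [Sx|]; last by case: tE => _ tP; apply: span_min tP _.
have /sP : (f @` S) (f x) by exists x.
case: tE => -> _.
have : span (map f t) `<=` f @` span t.
  apply: span_min; first exact: is_sub_im.
  by move=> _ /mapP[z zt ->]; exists z => //; apply: span_mem.
by move=> H /H[z tz /f_inj<-].
Qed.

Lemma noeth_fg U : noetherian_ring R -> finitely_generated U -> noeth U.
Proof.
move=> nR /fgP[s0 s0P] S sS.
suff: forall s (T : set U), is_sub T -> T `<=` span s ->
    exists t, forall x, T x <-> span t x by move/(_ s0 S); apply=> // x _.
elim=> [|g s IHs] T sT Ts.
  by exists [::] => x; split=> [/Ts//|/= ->]; apply: sub0.
(* [J] is the ideal of coefficients of [g] in elements of [T]. Lifting generators of [J] to [T]
   reduces [T] to its part inside [span s]. *)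
pose J : set R := [set c | exists2 x, T x & span s (x - c *: g)].
have [] := nR J.
  split.
  - by exists 0; rewrite ?scale0r ?subrr //; apply: sub0.
  - move=> c d [x Tx xc] [y Ty yd]; exists (x + y); first exact: subD.
    by rewrite scalerDl opprD addrACA; apply: subD.
  - move=> a c [x Tx xc]; exists (a *: x); first exact: subZ.
    by rewrite -scalerA -scalerBr; apply: subZ.
move=> n [h hJ].
have /choice[y yP] : forall i, exists y, T y /\ span s (y - h i *: g).
  move=> i; suff [y Ty sy] : J (h i) by exists y.
  rewrite hJ; exists (fun j => (j == i)%:R).
  by rewrite (bigD1 i) //= eqxx mul1r big1 ?addr0 // => j /negPf->; rewrite mul0r.
have [] := IHs (T `&` span s); first split=> //=.
- by split; apply: sub0.
- by move=> x z [? ?] [? ?]; split; apply: subD.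
- by move=> a x [? ?]; split; apply: subZ.
- by move=> x [].
move=> t tP; exists (t ++ [seq y i | i <- enum 'I_n]) => x; split; last first.
  move: x; apply: span_min => // x; rewrite mem_cat => /orP[xt|/mapP[i _ ->]].
    by have /tP[] := span_mem xt.
  by have [] := yP i.
move=> Tx; have /= [c xc] := Ts _ Tx.
have : J c by exists x.
rewrite hJ => -[d cE].
pose z := \sum_i d i *: y i.
have sz : span [seq y i | i <- enum 'I_n] z by apply/span_ord; exists d.
have Tz : T z by apply: sub_sum => // i _; apply: subZ => //; have [] := yP i.
have /tP tz : (T `&` span s) (x - z).
  split; first exact: subB.
  have -> : x - z = (x - c *: g) - (z - c *: g) by rewrite opprB addrA subrK.
  apply: subB => //; rewrite cE scaler_suml -sumrB; apply: sub_sum => // i _.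
  by rewrite -scalerA -scalerBr; apply: subZ => //; have [] := yP i.
rewrite -(subrK z x); apply: subD => //.
  by apply: (span_sub _ tz) => u; rewrite mem_cat => ->.
by apply: (span_sub _ sz) => u; rewrite mem_cat orbC => ->.
Qed.

(** The submodule I U. The set I need not be an ideal, since multiples are absorbed by the vectors;
    [is_ideal_pow] applies it to a set of products. *)
Definition imod (I : set R) U : set U :=
  [set x | exists p (c : 'I_p -> R) (y : 'I_p -> U),
     (forall i, I (c i)) /\ x = \sum_i c i *: y i].
Arguments imod I U : clear implicits.

Lemma imod_in (I : set R) U c (x : U) : I c -> imod I U (c *: x).
Proof. by move=> Ic; exists 1%N, (fun=> c), (fun=> x); rewrite big_ord1. Qed.

Lemma is_sub_imod (I : set R) U : is_sub (imod I U).
Proof.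
split.
- by exists 0%N, (fun=> 0), (fun=> 0); split; [case | rewrite big_ord0].
- move=> _ _ [p [c [x [cI ->]]]] [q [d [y [dI ->]]]].
  exists (p + q)%N, (fun i => match fintype.split i with inl j => c j | inr j => d j end),
    (fun i => match fintype.split i with inl j => x j | inr j => y j end); split.
    by move=> i; case: fintype.split.
  rewrite big_split_ord; congr (_ + _); apply: eq_bigr => i _.
    by case: splitP => j /= /eqP; [move/eqP/val_inj<- | rewrite ltn_eqF // ltn_addr].
  case: splitP => j /= E; last by move/addnI/val_inj: E => <-.
  by have := ltn_ord j; rewrite -E ltnNge leq_addr.
- move=> a _ [p [c [x [cI ->]]]]; exists p, c, (fun i => a *: x i); split=> //.
  by rewrite scaler_sumr; apply: eq_bigr => i _; rewrite !scalerA mulrC.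
Qed.

Lemma imod_min (I : set R) U (S : set U) :
  is_sub S -> (forall c x, I c -> S (c *: x)) -> imod I U `<=` S.
Proof. by move=> sS H _ [p [c [y [cI ->]]]]; apply: sub_sum => // i _; apply: H. Qed.

(** Induction on generators of U modulo S. Modulo S and the remaining generators U is spanned by
    [g], so [g] is congruent to [c *: g] with c in m, and 1 - c is a unit. *)
Lemma nakayama (m : set R) U (S : set U) :
  is_ideal m -> (forall a, m a -> exists b, b * (1 - a) = 1) ->
  finitely_generated U -> is_sub S ->
  (forall x, add_sub S (imod m U) x) -> forall x, S x.
Proof.
move=> [m0 mD mM] mU /fgP[s sP] sS SmU.
have {sP} : forall x, add_sub S (span s) x by move=> x; apply: add_subr.
elim: s => [|g s IHs] H x; first by have [y Sy /= /subr0_eq->] := H x.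
have sS' := is_sub_add sS (is_sub_span s); set S' := add_sub _ _ in sS'.
apply: IHs => {}x; rewrite -/S'.
have HS' (z : U) : exists c, S' (z - c *: g).
  have [y Sy /= [c cP]] := H z; exists c, y => //.
  by rewrite addrAC.
have mS' : imod m U `<=` [set z | exists2 c, m c & S' (z - c *: g)].
  apply: imod_min => [|c z mc /=].
    split=> /=.
    - by exists 0; rewrite ?scale0r ?subrr //; apply: sub0.
    - move=> y z [c mc yc] [d md zd]; exists (c + d); first exact: mD.
      by rewrite scalerDl opprD addrACA; apply: subD.
    - move=> a y [c mc yc]; exists (a * c); first exact: mM.
      by rewrite -scalerA -scalerBr; apply: subZ.
  have [d dP] := HS' z; exists (c * d); first by rewrite mulrC; apply: mM.
  by rewrite -scalerA -scalerBr; apply: subZ.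
have S'g : S' g.
  have [y Sy /mS'[c mc gc]] := SmU g.
  have [b bP] := mU c mc.
  rewrite -[g]scale1r -bP -scalerA; apply: subZ => //.
  have -> : (1 - c) *: g = y + (g - y - c *: g) by rewrite scalerBl scale1r addrA subrKC.
  by apply: subD => //; apply: add_subl.
have [c xc] := HS' x; rewrite -(subrK (c *: g) x).
by apply: subD => //; apply: subZ.
Qed.

End Submodules.
#[global] Hint Resolve is_sub_span is_sub0 is_subT is_sub_imod : core.
Arguments imod {R} I U.

(** * Hom modules and constructions of linear maps *)

Definition mklin (R : nzRingType) (U V : lmodType R) (f : U -> V) (lf : linear f) :
  {linear U -> V} := HB.pack f (GRing.isLinear.Build R U V *:%R f lf).

Section Hom.
Variables (R : comNzRingType) (U V : lmodType R).

Definition hom_pred : {pred (U -> V)} := fun f => `[< linear f >].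

Fact hom_pred_closed : submod_closed hom_pred.
Proof.
split; first by apply/asboolP => a x y; change (0 = a *: 0 + 0 :> V); rewrite scaler0 addr0.
move=> a f g /asboolP lf /asboolP lg; apply/asboolP => b x y.
change (a *: f (b *: x + y) + g (b *: x + y) =
  b *: (a *: f x + g x) + (a *: f y + g y)).
rewrite lf lg !scalerDr !scalerA -!addrA; congr (_ + _).
  by rewrite mulrC.
by rewrite addrCA.
Qed.

HB.instance Definition _ :=
  GRing.isSubmodClosed.Build R (U -> V) hom_pred hom_pred_closed.

Record hom := Hom { hom_val : U -> V; _ : hom_val \in hom_pred }.

HB.instance Definition _ := [isSub for hom_val].
HB.instance Definition _ := [Choice of hom by <:].
HB.instance Definition _ := [SubChoice_isSubLmodule of hom by <:].

Fact hom_linear (f : hom) : linear (hom_val f).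
Proof. by case: f => f /= /asboolP. Qed.

Definition lin_of_hom (f : hom) : {linear U -> V} := mklin (hom_linear f).

Fact hom_of_subproof (f : {linear U -> V}) : (f : U -> V) \in hom_pred.
Proof. by apply/asboolP => a x y; rewrite linearP. Qed.

Definition hom_of (f : {linear U -> V}) : hom := Hom (hom_of_subproof f).

End Hom.

Section HomTheory.
Variable R : comNzRingType.
Implicit Types U V W : lmodType R.

Lemma hom_eqP U V (f g : hom U V) : (forall x, lin_of_hom f x = lin_of_hom g x) -> f = g.
Proof. by move=> fg; apply: val_inj; apply/funext. Qed.

Lemma lin_of_homK U V (f : {linear U -> V}) x : lin_of_hom (hom_of f) x = f x.
Proof. by []. Qed.

Lemma hom_ofK U V (f : hom U V) : hom_of (lin_of_hom f) = f.
Proof. exact: hom_eqP. Qed.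

Lemma homD U V (f g : hom U V) x : lin_of_hom (f + g) x = lin_of_hom f x + lin_of_hom g x.
Proof. by []. Qed.

Lemma homZ U V a (f : hom U V) x : lin_of_hom (a *: f) x = a *: lin_of_hom f x.
Proof. by []. Qed.

Lemma hom0 U V x : lin_of_hom (0 : hom U V) x = 0.
Proof. by []. Qed.

Lemma homB U V (f g : hom U V) x : lin_of_hom (f - g) x = lin_of_hom f x - lin_of_hom g x.
Proof. by []. Qed.

Definition hadd U V (f g : {linear U -> V}) := lin_of_hom (hom_of f + hom_of g).
Definition hsub U V (f g : {linear U -> V}) := lin_of_hom (hom_of f - hom_of g).
Definition hscale U V a (f : {linear U -> V}) := lin_of_hom (a *: hom_of f).
Definition hzero U V : {linear U -> V} := lin_of_hom 0.

Lemma haddE U V (f g : {linear U -> V}) x : hadd f g x = f x + g x. Proof. by []. Qed.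
Lemma hsubE U V (f g : {linear U -> V}) x : hsub f g x = f x - g x. Proof. by []. Qed.
Lemma hscaleE U V a (f : {linear U -> V}) x : hscale a f x = a *: f x. Proof. by []. Qed.
Lemma hzeroE U V x : hzero U V x = 0. Proof. by []. Qed.

Definition hcomp U V W (g : {linear V -> W}) (f : {linear U -> V}) : {linear U -> W} := g \o f.
Lemma hcompE U V W (g : {linear V -> W}) (f : {linear U -> V}) x : hcomp g f x = g (f x).
Proof. by []. Qed.

Definition hid U : {linear U -> U} := idfun.
Lemma hidE U x : hid U x = x. Proof. by []. Qed.

Fact pair_linear U V W (f : {linear U -> V}) (g : {linear U -> W}) :
  linear (fun x => (f x, g x) : (V * W)%type).
Proof. by move=> a x y; rewrite !linearP. Qed.
Definition hpair U V W f g : {linear U -> (V * W)%type} := mklin (@pair_linear U V W f g).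
Lemma hpairE U V W (f : {linear U -> V}) (g : {linear U -> W}) x : hpair f g x = (f x, g x).
Proof. by []. Qed.

Fact copair_linear U V W (f : {linear U -> W}) (g : {linear V -> W}) :
  linear (fun x : (U * V)%type => f x.1 + g x.2).
Proof. by move=> a x y; rewrite !linearP scalerDr addrACA. Qed.
Definition hcopair U V W f g : {linear (U * V)%type -> W} := mklin (@copair_linear U V W f g).
Lemma hcopairE U V W (f : {linear U -> W}) (g : {linear V -> W}) x :
  hcopair f g x = f x.1 + g x.2.
Proof. by []. Qed.

Fact fst_linear U V : linear (fun x : (U * V)%type => x.1). Proof. by []. Qed.
Fact snd_linear U V : linear (fun x : (U * V)%type => x.2). Proof. by []. Qed.
Fact inl_linear U V : linear (fun x : U => (x, 0) : (U * V)%type).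
Proof. by move=> a x y; congr (_, _); rewrite /= scaler0 addr0. Qed.
Fact inr_linear U V : linear (fun x : V => (0, x) : (U * V)%type).
Proof. by move=> a x y; congr (_, _); rewrite /= scaler0 addr0. Qed.
Definition hfst U V : {linear (U * V)%type -> U} := mklin (@fst_linear U V).
Definition hsnd U V : {linear (U * V)%type -> V} := mklin (@snd_linear U V).
Definition hinl U V : {linear U -> (U * V)%type} := mklin (@inl_linear U V).
Definition hinr U V : {linear V -> (U * V)%type} := mklin (@inr_linear U V).
Lemma hfstE U V x : hfst U V x = x.1. Proof. by []. Qed.
Lemma hsndE U V x : hsnd U V x = x.2. Proof. by []. Qed.
Lemma hinlE U V x : hinl U V x = (x, 0). Proof. by []. Qed.
Lemma hinrE U V x : hinr U V x = (0, x). Proof. by []. Qed.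

Definition hE := (haddE, hsubE, hscaleE, hzeroE, hcompE, hidE, hpairE, hcopairE, hfstE,
  hsndE, hinlE, hinrE).

Definition onto (A B : Type) (f : A -> B) : Prop := forall y, exists x, f x = y.

(** A total linear relation relating 0 to 0 only is single-valued, so a function chosen inside it is
    automatically linear. Maps defined by quotients, kernels or limits are all obtained this way. *)
Lemma linear_relation U V (T : U -> V -> Prop) :
  (forall x, exists y, T x y) ->
  (forall a x x' y y', T x y -> T x' y' -> T (a *: x + x') (a *: y + y')) ->
  (forall y, T 0 y -> y = 0) -> exists f : {linear U -> V}, forall x, T x (f x).
Proof.
move=> /choice[f fT] TD T0.
have lf : linear f.
  move=> a x y; apply/eqP; rewrite -subr_eq0; apply/eqP/T0.
  have := TD (-1) _ _ _ _ (TD a _ _ _ _ (fT x) (fT y)) (fT (a *: x + y)).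
  by rewrite !scaleN1r addNr [- _ + _]addrC.
by exists (mklin lf).
Qed.

Lemma descend U V W (p : {linear U -> V}) (f : {linear U -> W}) :
  onto p -> (forall x, p x = 0 -> f x = 0) ->
  exists g : {linear V -> W}, forall x, g (p x) = f x.
Proof.
move=> sp pf.
have [|||g gP] := @linear_relation V W (fun y z => exists x, p x = y /\ f x = z).
- by move=> y; have [x <-] := sp y; exists (f x), x.
- move=> a _ _ _ _ [x [<- <-]] [y [<- <-]]; exists (a *: x + y).
  by rewrite !linearP.
- by move=> y [x [px <-]]; apply: pf.
exists g => x; have [x' [px' <-]] := gP (p x).
by apply/eqP; rewrite eq_sym -subr_eq0 -linearB; apply/eqP/pf; rewrite linearB px' subrr.
Qed.

Lemma corestrict U V W (i : {linear V -> W}) (f : {linear U -> W}) :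
  injective i -> (forall x, exists y, i y = f x) ->
  exists g : {linear U -> V}, forall x, i (g x) = f x.
Proof.
move=> inj_i fi; apply: (@linear_relation U V (fun x y => i y = f x)) => //.
  by move=> a x x' y y' iy iy'; rewrite !linearP iy iy'.
by move=> y; rewrite linear0 -(linear0 i) => /inj_i.
Qed.

Lemma inj_ker U V (f : {linear U -> V}) : (forall x, f x = 0 -> x = 0) -> injective f.
Proof. by move=> f0 x y fxy; apply/subr0_eq/f0; rewrite linearB fxy subrr. Qed.

End HomTheory.

(** * Submodules and quotients as modules *)

Record submodule (R : comNzRingType) (U : lmodType R) :=
  Submodule { submodule_set :> U -> Prop; submoduleP : is_sub submodule_set }.

Section SubQuotient.
Variables (R : comNzRingType) (U : lmodType R) (S : submodule U).

Definition mem_sub : {pred U} := fun x => `[< S x >].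

Fact mem_sub_closed : submod_closed mem_sub.
Proof.
have sS := submoduleP S; split; first by apply/asboolP; apply: (sub0 sS).
move=> a x y /asboolP Sx /asboolP Sy; apply/asboolP.
by apply: (subD sS) => //; apply: (subZ sS).
Qed.

HB.instance Definition _ := GRing.isSubmodClosed.Build R U mem_sub mem_sub_closed.

Record sub_type := SubType { sub_val : U; _ : sub_val \in mem_sub }.
HB.instance Definition _ := [isSub for sub_val].
HB.instance Definition _ := [Choice of sub_type by <:].
HB.instance Definition _ := [SubChoice_isSubLmodule of sub_type by <:].

Let Q := Quotient.quot mem_sub.

Definition quot_scale (a : R) (x : Q) : Q := \pi_Q (a *: repr x).

Lemma pi_quot_scale a x : quot_scale a (\pi_Q x) = \pi_Q (a *: x).
Proof.
apply/eqP; rewrite /quot_scale -Quotient.idealrBE -scalerBr.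
by rewrite rpredZ // Quotient.idealrBE reprK.
Qed.

Fact quot_scaleA a b x : quot_scale a (quot_scale b x) = quot_scale (a * b) x.
Proof. by elim/quotW: x => x; rewrite (pi_quot_scale b) !pi_quot_scale scalerA. Qed.

Fact quot_scale1 x : quot_scale 1 x = x.
Proof. by elim/quotW: x => x; rewrite !pi_quot_scale scale1r. Qed.

Fact quot_scaleDr a x y : quot_scale a (x + y) = quot_scale a x + quot_scale a y.
Proof.
elim/quotW: x => x; elim/quotW: y => y.
by rewrite -raddfD (pi_quot_scale a x) (pi_quot_scale a y) pi_quot_scale scalerDr raddfD.
Qed.

Fact quot_scaleDl x a b : quot_scale (a + b) x = quot_scale a x + quot_scale b x.
Proof. by elim/quotW: x => x; rewrite (pi_quot_scale a) (pi_quot_scale b) pi_quot_scale scalerDl raddfD. Qed.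

Definition quot_type := Q.
HB.instance Definition _ := GRing.Zmodule.on quot_type.
HB.instance Definition _ := GRing.Zmodule_isLmodule.Build R quot_type
  quot_scaleA quot_scale1 (fun a => quot_scaleDr a) quot_scaleDl.

Fact quot_pi_linear : linear (fun x => \pi_Q x : quot_type).
Proof. by move=> a x y; rewrite raddfD; congr (_ + _); apply: esym (pi_quot_scale a x). Qed.

Definition quot_map : {linear U -> quot_type} := mklin quot_pi_linear.

Lemma quot_map_onto : onto quot_map.
Proof. by elim/quotW=> x; exists x. Qed.

Lemma quot_map_eq0 x : quot_map x = 0 <-> S x.
Proof.
rewrite -(linear0 quot_map); split => [/eqP|Sx]; last apply/eqP.
  by rewrite -Quotient.idealrBE subr0 => /asboolP.
by rewrite -Quotient.idealrBE subr0; apply/asboolP.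
Qed.

Definition sub_map : {linear sub_type -> U} := val.

Lemma sub_mapP x : S x <-> exists y, sub_map y = x.
Proof.
split=> [Sx|[[y Sy] <-]]; last exact/asboolP.
by exists (SubType (introT (asboolP _) Sx)).
Qed.
End SubQuotient.

(** * Dimensions of quotients *)

Section QuotientDimension.
Variables (k : fieldType) (R : comAlgType k).
Implicit Types U V W : lmodType R.

Definition kscale U (a : k) (x : U) : U := (a%:A : R) *: x.

Lemma kscaleDl U a b (x : U) : kscale (a + b) x = kscale a x + kscale b x.
Proof. by rewrite /kscale !scalerDl. Qed.
Lemma kscaleA U a b (x : U) : kscale a (kscale b x) = kscale (a * b) x.
Proof. by rewrite /kscale scalerA mulr_algl scalerA. Qed.
Lemma kscale1 U (x : U) : kscale 1 x = x.
Proof. by rewrite /kscale !scale1r. Qed.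
Lemma kscale0 U (x : U) : kscale 0 x = 0.
Proof. by rewrite /kscale !scale0r. Qed.
Lemma kscaleN1 U (x : U) : kscale (-1) x = - x.
Proof. by rewrite /kscale scaleN1r scaleN1r. Qed.
Lemma sub_kscale U (S : set U) a x : is_sub S -> S x -> S (kscale a x).
Proof. by move=> sS; apply: subZ. Qed.

Definition klinear U V (f : U -> V) : Prop :=
  forall a x y, f (kscale a x + y) = kscale a (f x) + f y.

Definition kform U n (f : U -> 'rV[k]_n) : Prop :=
  forall a x y, f (kscale a x + y) = a *: f x + f y.

Lemma linear_klinear U V (f : {linear U -> V}) : klinear f.
Proof. by move=> a x y; rewrite linearP. Qed.

Section Kform.
Variables (U : lmodType R) (n : nat) (f : U -> 'rV[k]_n) (fl : kform f).
Lemma kformD x y : f (x + y) = f x + f y.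
Proof. by rewrite -{1}(kscale1 x) fl scale1r. Qed.
Lemma kform0 : f 0 = 0.
Proof. by apply: (addrI (f 0)); rewrite -kformD !addr0. Qed.
Lemma kformZ a x : f (kscale a x) = a *: f x.
Proof. by rewrite -[kscale a x]addr0 fl kform0 addr0. Qed.
Lemma kformB x y : f (x - y) = f x - f y.
Proof. by rewrite -[- y]kscaleN1 addrC fl scaleN1r addrC. Qed.
Lemma kform_sum (I : Type) (r : seq I) (F : I -> U) :
  f (\sum_(i <- r) F i) = \sum_(i <- r) f (F i).
Proof. exact: (big_morph f kformD kform0). Qed.
End Kform.

(* [qdim S n] says that U / S has dimension n over k. *)
Definition qdim U (S : set U) (n : nat) : Prop :=
  exists f : U -> 'rV[k]_n, [/\ kform f, onto f & forall x, f x = 0 <-> S x].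

Definition kcomb U n (b : 'I_n -> U) (c : 'I_n -> k) : U := \sum_i kscale (c i) (b i).

Lemma kform_comb U n p (f : U -> 'rV[k]_p) (b : 'I_n -> U) c :
  kform f -> f (kcomb b c) = \sum_i c i *: f (b i).
Proof. by move=> fl; rewrite kform_sum //; apply: eq_bigr => i _; rewrite kformZ. Qed.

Lemma kcombB U n (b : 'I_n -> U) c d : kcomb b c - kcomb b d = kcomb b (fun i => c i - d i).
Proof.
rewrite -sumrB; apply: eq_bigr => i _.
by rewrite kscaleDl /kscale scaleNr scaleNr.
Qed.

Lemma kcombZ U n a (b : 'I_n -> U) c : kscale a (kcomb b c) = kcomb b (fun i => a * c i).
Proof. by rewrite /kcomb {1}/kscale scaler_sumr; apply: eq_bigr => i _; rewrite -kscaleA. Qed.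

(** Passes from the coordinate map of [qdim] to bases modulo S, the form in which [stable_hom_dim]
    is stated. *)
Lemma qdim_basis U (S : set U) n : is_sub S ->
  qdim S n <->
  exists b : 'I_n -> U, forall x, exists! c : {ffun 'I_n -> k}, S (x - kcomb b c).
Proof.
move=> sS; split=> [[f [fl fs fS]]|[b bP]].
  have [b bP] := choice (fun i : 'I_n => fs (delta_mx 0 i)).
  have fb (c : 'I_n -> k) : f (kcomb b c) = \row_i c i.
    rewrite kform_comb // [RHS]row_sum_delta; apply: eq_bigr => i _.
    by rewrite bP mxE.
  exists b => x; exists [ffun i => f x 0 i]; split.
    by apply/fS; rewrite kformB // fb; apply/rowP => i; rewrite !mxE ffunE subrr.
  move=> c /fS; rewrite kformB // fb => /subr0_eq->; apply/ffunP => i.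
  by rewrite ffunE mxE.
have [c cP] := choice bP.
have cS x : S (x - kcomb b (c x)) by case: (cP x).
have cU x (d : {ffun 'I_n -> k}) : S (x - kcomb b d) -> c x = d by case: (cP x) => _; apply.
exists (fun x => \row_i c x i); split.
- move=> a x y; pose d := [ffun i => a * c x i + c y i].
  have -> : c (kscale a x + y) = d.
    apply: cU.
    have -> : kscale a x + y - kcomb b d =
        kscale a (x - kcomb b (c x)) + (y - kcomb b (c y)).
      have -> : kcomb b d = kscale a (kcomb b (c x)) + kcomb b (c y).
        rewrite /kcomb /kscale scaler_sumr -big_split; apply: eq_bigr => i _ /=.
        by rewrite !ffunE -!/(kscale _ _) kscaleDl kscaleA.
      by rewrite /kscale scalerBr opprD addrACA.
    by apply: (subD sS) => //; apply: (sub_kscale _ sS).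
  by apply/rowP => i; rewrite !mxE ffunE.
- move=> v; exists (kcomb b (fun i => v 0 i)); apply/rowP => i; rewrite mxE.
  have -> : c (kcomb b (fun i => v 0 i)) = [ffun i => v 0 i] by
    apply: cU; rewrite kcombB (_ : kcomb _ _ = 0); [exact: sub0|
    apply: big1 => j _; rewrite ffunE subrr kscale0].
  by rewrite ffunE.
- move=> x.
  have -> : (\row_i c x i = 0) <-> c x = [ffun=> 0].
    split=> [/rowP c0|->]; last by apply/rowP => i; rewrite !mxE ffunE.
    by apply/ffunP => i; have := c0 i; rewrite !mxE ffunE.
  have k0 : kcomb b [ffun=> 0] = 0 by apply: big1 => i _; rewrite ffunE kscale0.
  split=> [cx0|Sx]; last by apply: cU; rewrite k0 subr0.
  by have := cS x; rewrite cx0 k0 subr0.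
Qed.

(** A spanning family of minimal size is a basis modulo S: a relation [e] with [e j] nonzero would
    allow [b j] to be dropped. *)
Lemma qdim_span U (S : set U) n (b : 'I_n -> U) : is_sub S ->
  (forall x, exists c, S (x - kcomb b c)) -> exists p, qdim S p.
Proof.
move=> sS bP.
pose gen p := `[< exists b : 'I_p -> U, forall x, exists c, S (x - kcomb b c) >].
have exg : exists p, gen p by exists n; apply/asboolP; exists b.
case: (ex_minnP exg) => p /asboolP[{bP}{}b bP] pmin; exists p.
apply/qdim_basis => //; exists b => x; have [c cP] := bP x.
have cE : kcomb b [ffun i => c i] = kcomb b c by apply: eq_bigr => i _; rewrite ffunE.
exists [ffun i => c i]; split; first by rewrite cE.
move=> d dP; apply/ffunP => j; rewrite ffunE; apply: contrapT => /eqP ncd.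
have [e [ej Se]] : exists e, e j != 0 /\ S (kcomb b e).
  exists (fun i => c i - d i); rewrite subr_eq0; split=> //.
  rewrite -kcombB; have -> : kcomb b c - kcomb b d = (x - kcomb b d) - (x - kcomb b c).
    by rewrite opprB [RHS]addrC addrA subrK.
  exact: subB.
case: p pmin b bP {x c cP cE d dP ncd} j e ej Se => [|p] pmin b bP; first by case.
move=> j e ej Se; have : gen p.
  apply/asboolP; exists (fun i => b (lift j i)) => x.
  have [c cP] := bP x; exists (fun i => c (lift j i) - c j / e j * e (lift j i)).
  have -> : x - kcomb (fun i => b (lift j i)) (fun i => c (lift j i) - c j / e j * e (lift j i))
    = (x - kcomb b c) + kscale (c j / e j) (kcomb b e).
    have -> : kcomb (fun i => b (lift j i)) (fun i => c (lift j i) - c j / e j * e (lift j i))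
        = kcomb b c - kscale (c j / e j) (kcomb b e).
      by rewrite kcombZ kcombB /kcomb [RHS](bigD1_ord j) //= divfK // subrr kscale0 add0r.
    by rewrite opprB addrCA addrC.
  by apply: subD => //; apply: sub_kscale.
by move/pmin; rewrite ltnn.
Qed.

Lemma qdim_sub U (S T : set U) n : is_sub S -> is_sub T -> S `<=` T ->
  qdim S n -> exists p, qdim T p.
Proof.
move=> sS sT ST /(qdim_basis n sS)[b bP]; apply: (@qdim_span _ _ n b) => // x.
by have [c [cP _]] := bP x; exists c; apply: ST.
Qed.

Lemma kform_mx U n V p (f : U -> 'rV[k]_n) (g : V -> 'rV[k]_p) (h : U -> V) :
  kform f -> onto f -> kform g -> klinear h -> (forall x, f x = 0 -> g (h x) = 0) ->
  exists A : 'M_(n, p), forall x, g (h x) = f x *m A.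
Proof.
move=> fl fs gl hl fgh.
have ghl : kform (g \o h) by move=> a x y /=; rewrite hl gl.
have [b bP] := choice (fun i : 'I_n => fs (delta_mx 0 i)).
exists (\matrix_i g (h (b i))) => x.
have : g (h (x - kcomb b (f x 0))) = 0.
  apply: fgh; rewrite kformB // kform_comb // [X in X - _]row_sum_delta.
  by rewrite (eq_bigr _ (fun i _ => congr1 _ (bP i))) subrr.
rewrite -[g (h _)]/((g \o h) _) (kformB ghl) (kform_comb _ _ ghl) => /subr0_eq /= ->.
rewrite mulmx_sum_row; apply: eq_bigr => i _; congr (_ *: _).
by apply/rowP => j; rewrite !mxE.
Qed.

(** The isomorphism U / S -> V / T is given by a relation, because correspondences such as the
    syzygy of a map become single-valued only on the quotients. *)
Lemma qdim_transfer U V (S : set U) (T : set V) (rel : U -> V -> Prop) n :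
  is_sub S -> is_sub T ->
  (forall x, exists y, rel x y) -> (forall y, exists x, rel x y) ->
  (forall a x x' y y', rel x y -> rel x' y' -> rel (kscale a x + x') (kscale a y + y')) ->
  (forall x y, rel x y -> S x <-> T y) ->
  qdim S n -> qdim T n.
Proof.
move=> sS sT totl totr rlin relST [f [fl fs fS]].
have [g gP] := choice totr.
have fE x y : rel x y -> f (g y) = f x.
  move=> xy; apply: subr0_eq; rewrite -kformB //; apply/fS/(relST _ 0); last exact: sub0.
  have := rlin (-1) _ _ _ _ xy (gP y); rewrite !kscaleN1 addNr.
  by rewrite [- x + _]addrC.
exists (f \o g); split.
- by move=> a x y /=; rewrite -fl; apply: fE; apply: rlin.
- by move=> v; have [x <-] := fs v; have [y xy] := totl x; exists y; apply: fE.
- by move=> y; split=> [/fS/(relST _ _ (gP y))|/(relST _ _ (gP y))/fS].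
Qed.

Lemma qdim_unique U (S : set U) n p : qdim S n -> qdim S p -> n = p.
Proof.
suff le n' p' : qdim S n' -> qdim S p' -> (p' <= n')%N.
  by move=> Sn Sp; apply/eqP; rewrite eqn_leq !le.
move=> [f [fl fs fS]] [g [gl gs gS]].
have [|A AP] := @kform_mx U n' U p' f g idfun fl fs gl (fun _ _ _ => erefl).
  by move=> x /fS/gS.
rewrite -(mxrank1 k p') (leq_trans _ (rank_leq_row A)) // mxrankS //.
apply/row_subP => i; have [x xi] := gs (row i 1%:M).
by rewrite -xi AP submxMl.
Qed.

Lemma qdim_prod U V (S : set U) (T : set V) n p : qdim S n -> qdim T p ->
  qdim (U := (U * V)%type) [set x | S x.1 /\ T x.2] (n + p).
Proof.
move=> [f [fl fs fS]] [g [gl gs gT]].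
exists (fun x => row_mx (f x.1) (g x.2)); split.
- by move=> a x y /=; rewrite scale_row_mx add_row_mx fl gl.
- move=> v; have [x xv] := fs (lsubmx v); have [y yv] := gs (rsubmx v).
  by exists (x, y); rewrite /= xv yv hsubmxK.
- move=> [x y] /=; rewrite -(@row_mx0 k 1 n p); split=> [/eq_row_mx[/fS ? /gT ?]//|].
  by move=> [/fS-> /gT->].
Qed.

Section Rank.
Variables (U V : lmodType R) (S : set U) (T : set V) (n p : nat).
Variables (f : U -> 'rV[k]_n) (g : V -> 'rV[k]_p) (h : U -> V) (A : 'M[k]_(n, p)).
Hypotheses (fl : kform f) (fs : onto f) (fS : forall x, f x = 0 <-> S x).
Hypotheses (gl : kform g) (gs : onto g) (gT : forall x, g x = 0 <-> T x).
Hypotheses (AP : forall x, g (h x) = f x *m A).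

Lemma qdim_kernel : qdim [set x | T (h x)] (\rank A).
Proof.
exists (fun x => f x *m col_base A); split.
- by move=> a x y; rewrite fl mulmxDl scalemxAl.
- move=> v; have /row_fullP[B BP] : row_full (col_base A) by apply: col_base_full.
  by have [x xP] := fs (v *m B); exists x; rewrite xP -mulmxA BP mulmx1.
- move=> x; rewrite -[[set _ | _] x]/(T (h x)) -gT AP.
  have -> : f x *m A = f x *m col_base A *m row_base A by rewrite -mulmxA mulmx_base.
  split=> [->|/eqP]; first by rewrite mul0mx.
  by rewrite mulmx_free_eq0 ?row_base_free // => /eqP.
Qed.

Lemma qdim_image : qdim [set y | exists x, T (y - h x)] (p - \rank A).
Proof.
rewrite -mxrank_coker; set C := cokermx A.
exists (fun y => g y *m col_base C); split.
- by move=> a x y; rewrite gl mulmxDl scalemxAl.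
- move=> v; have /row_fullP[B BP] : row_full (col_base C) by apply: col_base_full.
  by have [x xP] := gs (v *m B); exists x; rewrite xP -mulmxA BP mulmx1.
- move=> y; have -> : (g y *m col_base C = 0) <-> (g y <= A)%MS.
    have E : g y *m C = g y *m col_base C *m row_base C by rewrite -mulmxA mulmx_base.
    rewrite submxE -/C E mulmx_free_eq0 ?row_base_free //; exact: (rwP eqP).
  split=> [/submxP[D DP]|[x]] /=.
    by have [x xD] := fs D; exists x; apply/gT; rewrite kformB // AP xD DP subrr.
  by move=> /gT; rewrite kformB // AP => /subr0_eq->; rewrite submxMl.
Qed.
End Rank.

Lemma exact_rank U V W (T : set V) n p q
    (f : U -> 'rV[k]_n) (g : V -> 'rV[k]_p) (e : W -> 'rV[k]_q)
    (h : U -> V) (l : V -> W) A B :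
  onto f -> kform g -> onto g -> (forall x, g x = 0 <-> T x) ->
  (forall x, g (h x) = f x *m A) -> (forall x, e (l x) = g x *m B) ->
  (forall y, e (l y) = 0 <-> exists x, T (y - h x)) -> (\rank A + \rank B)%N = p.
Proof.
move=> fs gl gs gT AP BP ex.
have rB : (A == kermx B)%MS.
  apply/andP; split.
    apply/row_subP => i; have [x xi] := fs (delta_mx 0 i).
    rewrite rowE -xi -AP; apply/sub_kermxP; rewrite -BP; apply/ex; exists x.
    by apply/gT; rewrite kformB // subrr.
  apply/row_subP => i; have [y yi] := gs (row i (kermx B)).
  have /ex[x] : e (l y) = 0.
    by rewrite BP yi -row_mul mulmx_ker linear0.
  by move=> /gT; rewrite kformB // AP yi => /subr0_eq->; rewrite submxMl.
by rewrite (eqmx_rank rB) mxrank_ker subnK // rank_leq_row.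
Qed.

(** For the ranks r1, r2, r3 of the induced maps, exactness gives r1 + r2 = n2 and r2 + r3 = n3.
    Here a = r1 and b = n4 - r3, so n1 does not enter the formula. *)
Lemma qdim_exact4 U1 U2 U3 U4 (S1 : set U1) (S2 : set U2) (S3 : set U3) (S4 : set U4)
    (h1 : U1 -> U2) (h2 : U2 -> U3) (h3 : U3 -> U4) n1 n2 n3 n4 :
  klinear h1 -> klinear h2 -> klinear h3 ->
  qdim S1 n1 -> qdim S2 n2 -> qdim S3 n3 -> qdim S4 n4 ->
  (forall x, S1 x -> S2 (h1 x)) -> (forall x, S2 x -> S3 (h2 x)) ->
  (forall x, S3 x -> S4 (h3 x)) ->
  (forall y, S3 (h2 y) <-> exists x, S2 (y - h1 x)) ->
  (forall y, S4 (h3 y) <-> exists x, S3 (y - h2 x)) ->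
  exists a b, [/\ qdim [set x | S2 (h1 x)] a, qdim [set y | exists x, S4 (y - h3 x)] b
    & (a + b + n3 = n2 + n4)%N].
Proof.
move=> l1 l2 l3 [f1 [fl1 fs1 k1]] [f2 [fl2 fs2 k2]] [f3 [fl3 fs3 k3]] [f4 [fl4 fs4 k4]].
move=> p1 p2 p3 e2 e3.
have [x /k1/p1/k2//|A AP] := kform_mx fl1 fs1 fl2 l1.
have [x /k2/p2/k3//|B BP] := kform_mx fl2 fs2 fl3 l2.
have [x /k3/p3/k4//|C CP] := kform_mx fl3 fs3 fl4 l3.
have rAB : (\rank A + \rank B)%N = n2.
  by apply: (exact_rank fs1 fl2 fs2 k2 AP BP) => y; rewrite k3.
have rBC : (\rank B + \rank C)%N = n3.
  by apply: (exact_rank fs2 fl3 fs3 k3 BP CP) => y; rewrite k4.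
exists (\rank A), (n4 - \rank C)%N; split.
- exact: qdim_kernel AP.
- exact: qdim_image fl4 fs4 k4 CP.
- have := rank_leq_col C; lia.
Qed.

(** In a left exact sequence, surjectivity of the last map is read off from dimensions alone. It can
    therefore be carried over to another sequence whose terms are merely isomorphic, without
    compatible maps. *)
Lemma qdim_onto U1 U2 U3 (h1 : U1 -> U2) (h2 : U2 -> U3) n1 n2 n3 :
  klinear h1 -> klinear h2 ->
  qdim [set 0 : U1] n1 -> qdim [set 0 : U2] n2 -> qdim [set 0 : U3] n3 ->
  (forall x, h1 x = 0 -> x = 0) ->
  (forall y, h2 y = 0 <-> exists x, y = h1 x) ->
  onto h2 <-> n2 = (n1 + n3)%N.
Proof.
move=> l1 l2 [f1 [fl1 fs1 k1]] [f2 [fl2 fs2 k2]] [f3 [fl3 fs3 k3]] i1 e2.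
have z1 : h1 0 = 0.
  by apply: (addrI (h1 0)); have := l1 1 0 0; rewrite !kscale1 !addr0 => <-.
have z2 : h2 0 = 0.
  by apply: (addrI (h2 0)); have := l2 1 0 0; rewrite !kscale1 !addr0 => <-.
have [x /k1/=->|A AP] := kform_mx fl1 fs1 fl2 l1; first by rewrite z1; apply/k2.
have [x /k2/=->|B BP] := kform_mx fl2 fs2 fl3 l2; first by rewrite z2; apply/k3.
have rAB : (\rank A + \rank B)%N = n2.
  apply: (exact_rank fs1 fl2 fs2 k2 AP BP) => y; split.
    by move=> /k3/= /e2[x ->]; exists x; rewrite /= subrr.
  by move=> [x /= /subr0_eq->]; apply/k3/e2; exists x.
have rA : \rank A = n1.
  have : qdim [set x | h1 x = 0] (\rank A) := qdim_kernel fl1 fs1 k2 AP.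
  have -> : [set x | h1 x = 0] = [set 0].
    by apply/seteqP; split=> x /=; [exact: i1 | move=> ->].
  by move/qdim_unique; apply; exists f1.
rewrite -{1}rAB rA; split=> [h2s|/addnI rB].
  congr (_ + _)%N; apply/eqP; rewrite -[_ == _]/(row_full B) -sub1mx.
  apply/row_subP => i; have [z zi] := fs3 (row i 1%:M); have [y yz] := h2s z.
  by rewrite -zi -yz BP submxMl.
move=> z; have : (f3 z <= B)%MS by apply: submx_full; rewrite /row_full rB.
case/submxP=> D DP; have [y yD] := fs2 D; exists y.
by apply: subr0_eq; apply/k3; rewrite kformB // BP yD DP subrr.
Qed.

End QuotientDimension.
Arguments kcomb {k R U n}.
Arguments qdim {k R U}.

(** * Local Noetherian rings *)

Section LocalRing.
Variables (R : comNzRingType) (m : set R).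
Hypotheses (nR : noetherian_ring R) (lR : local_ring_at m).
Implicit Types U V : lmodType R.

Lemma max_ideal : is_ideal m. Proof. by case: lR => -[]. Qed.

Lemma max_ideal_N1 : ~ m 1.
Proof.
case: lR => -[[_ _ mM] + _] _ m1; apply; apply/seteqP; split=> // x _.
by rewrite -[x]mulr1; apply: mM.
Qed.

Lemma noeth_regular : noeth (R^o : lmodType R).
Proof.
apply: noeth_fg => //; apply/fgP; exists [:: 1] => x /=.
by exists x; rewrite -[_ *: _]/(x * 1) mulr1 subrr.
Qed.

(** For a non-unit x, a maximal member among the proper ideals containing x exists because R is
    Noetherian, and it must be m. *)
Lemma unit_notin x : ~ m x -> exists y, y * x = 1.
Proof.
move=> mx; apply: contrapT => nu.
pose Fam (J : set R) := [/\ is_ideal J, J x & ~ J 1].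
have [||J [iJ Jx J1] Jmax] := @noeth_max _ (R^o : lmodType R) Fam noeth_regular.
- exists [set y | exists a, y = a * x]; split.
  + split; first by exists 0; rewrite mul0r.
    * by move=> _ _ [a ->] [b ->]; exists (a + b); rewrite mulrDl.
    * by move=> a _ [b ->]; exists (a * b); rewrite mulrA.
  + by exists 1; rewrite mul1r.
  + by case=> y y1; apply: nu; exists y.
- by move=> J [[]].
case: lR => _ mU; apply: mx; rewrite -(mU J) //; split=> //.
  by move=> JT; apply: J1; rewrite JT.
move=> I iI JI; have [I1|I1] := pselect (I 1).
  right; apply/seteqP; split=> // y _; rewrite -[y]mulr1.
  by case: iI => _ _; apply.
left; apply/seteqP; split=> //; apply: Jmax => //.
by split=> //; apply: JI.
Qed.

Lemma unit_sub1 a : m a -> exists b, b * (1 - a) = 1.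
Proof.
move=> ma; apply: unit_notin => m1a; apply: max_ideal_N1.
by rewrite -(subrK a 1); case: max_ideal => _ mD _; apply: mD.
Qed.

Lemma nakayama_local U (S : set U) : finitely_generated U -> is_sub S ->
  (forall x, add_sub S (imod m U) x) -> forall x, S x.
Proof. exact: nakayama max_ideal unit_sub1. Qed.

(** For Noetherian U this means that U / S has finite length. It is stated for one r at a time
    because [power_extends] delivers a power of a single ring element. *)
Definition loc_nil U (S : set U) : Prop :=
  forall r, m r -> forall x, exists n, S (r ^+ n *: x).

Lemma loc_nil_uniform U (S : set U) r : is_sub S -> finitely_generated U -> loc_nil S ->
  m r -> exists n, forall x, S (r ^+ n *: x).
Proof.
move=> sS /fgP[s sP] lS mr.
have mono n p x : (n <= p)%N -> S (r ^+ n *: x) -> S (r ^+ p *: x).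
  by move=> /subnK<-; rewrite exprD -scalerA; apply: subZ.
suff [n nP] : exists n, {in s, forall x, S (r ^+ n *: x)}.
  exists n => x; have : span s `<=` [set x | S (r ^+ n *: x)].
    by apply: span_min => //; apply: (is_sub_ker (hscale (r ^+ n) (hid U)) sS).
  by apply.
elim: {sP} s => [|x s [p pP]]; first by exists 0%N.
have [n nP] := lS r mr x; exists (maxn n p) => y; rewrite inE => /orP[/eqP->|/pP].
  by apply: mono nP; rewrite leq_maxl.
by apply: mono; rewrite leq_maxr.
Qed.

(** Climbs from S to U by cyclic steps killed by m. If a maximal T with the property is not U, then
    an element [z] outside T with maximal annihilator modulo T is killed by m modulo T, and T + Rz
    contradicts maximality. *)
Lemma devissage U (S : set U) (Pi : set U -> Prop) :
  noeth U -> is_sub S -> loc_nil S -> Pi S ->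
  (forall T z, is_sub T -> S `<=` T -> Pi T -> (forall r, m r -> T (r *: z)) ->
     Pi [set x | exists a, T (x - a *: z)]) ->
  Pi setT.
Proof.
move=> nU sS lS PS step.
pose Fam (T : set U) := [/\ is_sub T, S `<=` T & Pi T].
have [||T [sT ST PT] Tmax] := noeth_max (Fam := Fam) nU.
- by exists S; split.
- by move=> T [].
suff TT : T = setT by rewrite -TT.
apply/seteqP; split=> // y _; apply: contrapT => Ty.
pose ann z : set R := [set r | T (r *: z)].
pose FamI (J : set R) := exists2 z, ~ T z & J = ann z.
have [||_ [z Tz ->] zmax] := @noeth_max _ (R^o : lmodType R) FamI noeth_regular.
- by exists (ann y), y.
- move=> _ [z _ ->]; split=> /=; first by rewrite /ann /= scale0r; apply: sub0.
    by move=> a b; rewrite /ann /= scalerDl; apply: subD.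
  by move=> a b; rewrite /ann /= -[a *: b]/(a * b) -scalerA; apply: subZ.
(* If [r *: z] were outside T, its annihilator modulo T would equal that of [z], so the exponent in
   [T (r ^+ n.+1 *: z)] could be lowered down to 1. *)
have mz r : m r -> T (r *: z).
  move=> mr; apply: contrapT => Trz.
  have sub : ann (r *: z) `<=` ann z.
    apply: zmax; first by exists (r *: z).
    by move=> a; rewrite /ann /= scalerA mulrC -scalerA; apply: subZ.
  have [n] := lS r mr z; move/ST; case: n => [|n]; first by rewrite scale1r.
  elim: n => [|n IHn]; first by rewrite expr1.
  by rewrite exprSr -scalerA => /sub.
have [] := Tz; apply: (Tmax [set x | exists a, T (x - a *: z)]).
- split; last exact: step.
  + split=> /=; first by exists 0; rewrite scale0r subr0; apply: sub0.
    * move=> u v [a ua] [b vb]; exists (a + b).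
      by rewrite scalerDl opprD addrACA; apply: subD.
    * by move=> c u [a ua]; exists (c * a); rewrite -scalerA -scalerBr; apply: subZ.
  + by move=> u /ST Tu /=; exists 0; rewrite scale0r subr0.
- by move=> u Tu /=; exists 0; rewrite scale0r subr0.
- by exists 1; rewrite scale1r subrr; apply: sub0.
Qed.

(** A form of Krull's intersection theorem: S is an intersection of submodules of finite colength.
    Any E maximal among the submodules that contain S and avoid x has the required property. *)
Lemma krull_separation U (S : set U) x : noeth U -> is_sub S -> ~ S x ->
  exists E : set U, [/\ is_sub E, S `<=` E, ~ E x & loc_nil E].
Proof.
move=> nU sS Sx.
pose Fam (T : set U) := [/\ is_sub T, S `<=` T & ~ T x].
have [||E [sE SE Ex] Emax] := noeth_max (Fam := Fam) nU.
- by exists S; split.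
- by move=> T [].
exists E; split=> // r mr y.
have max T : is_sub T -> E `<=` T -> ~ T x -> T `<=` E.
  by move=> sT ET Tx; apply: Emax => //; split=> // u /SE/ET.
pose K n : set U := [set y | E (r ^+ n *: y)].
have sK n : is_sub (K n) by apply: (is_sub_ker (hscale (r ^+ n) (hid U)) sE).
have KS n p : (n <= p)%N -> K n `<=` K p.
  by move=> /subnK<- u; rewrite /K /= exprD -scalerA; apply: subZ.
have [||_ [n ->] Kmax] := noeth_max (Fam := fun T => exists n, T = K n) nU.
- by exists (K 0%N), 0%N.
- by move=> _ [n ->].
have EK p : E `<=` K p by move=> u Eu; apply: subZ.
(* The chain [K] is stationary from n on. If [r ^+ n *: x] is outside E, then [K n] lies in E, and x
   is a multiple of [r *: x] modulo E, which is impossible as r is in m. Otherwise E + r^n U avoids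
   x, so it lies in E. *)
have [Kx|nKx] := pselect (K n x); last first.
  have KE : K n `<=` E by apply: max.
  have rx : ~ E (r *: x).
    move=> Erx; apply: Ex; apply: KE; apply: (Kmax (K n.+1)).
    + by exists n.+1.
    + exact: KS.
    + by rewrite /K /= exprSr -scalerA; apply: subZ.
  have sT : is_sub [set u | exists a, E (u - a *: (r *: x))].
    split=> /=; first by exists 0; rewrite scale0r subr0; apply: sub0.
    + move=> u v [a ua] [b vb]; exists (a + b).
      by rewrite scalerDl opprD addrACA; apply: subD.
    + by move=> c u [a ua]; exists (c * a); rewrite -scalerA -scalerBr; apply: subZ.
  have [[a ax]|nx] := pselect (exists a, E (x - a *: (r *: x))); last first.
    case: rx; apply: (max _ sT) => //.
      by move=> u Eu /=; exists 0; rewrite scale0r subr0.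
    by exists 1; rewrite scale1r subrr; apply: sub0.
  have [|b bP] := @unit_sub1 (a * r); first by case: max_ideal => _ _; apply.
  case: Ex; rewrite -[x]scale1r -bP -scalerA; apply: subZ => //.
  by rewrite scalerBl scale1r -scalerA.
exists n.
have sT := is_sub_add sE (is_sub_im (hscale (r ^+ n) (hid U)) (@is_subT _ U)).
have [[e Ee [z _ zx]]|nx] := pselect (add_sub E (hscale (r ^+ n) (hid U) @` setT) x).
  case: Ex; rewrite -(subrK e x) -zx hscaleE; apply: subD => //.
  apply: (Kmax (K (n + n)%N)); rewrite /=; [by exists (n + n)%N|by apply: KS; rewrite leq_addr|].
  rewrite /K /= exprD -scalerA; have <- : x - e = r ^+ n *: z by rewrite -zx.
  by rewrite scalerBr; apply: subB => //; apply: subZ.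
apply: (max _ sT) => // [u Eu|]; first by apply: add_subl => //; apply: is_sub_im.
by apply: add_subr => //; exists y.
Qed.

End LocalRing.

Section LocalAlgebra.
Variables (k : fieldType) (R : comAlgType k) (m : set R).
Hypotheses (nR : noetherian_ring R) (lR : local_ring_at m).
Hypothesis (res : residue_field_is_base m).

(** Each step T + Rz of the filtration with mz inside T equals T + kz, since R = k + m, so it adds
    at most one basis vector. *)
Lemma loc_nil_qdim (U : lmodType R) (S : set U) :
  noeth U -> is_sub S -> loc_nil m S -> exists n, qdim S n.
Proof.
move=> nU sS lS.
pose Pi (T : set U) := exists n (b : 'I_n -> U), forall x, T x -> exists c, S (x - kcomb b c).
suff [n [b bP]] : Pi setT.
  by apply: (@qdim_span _ _ _ _ n b) => // x; apply: bP.
apply: (devissage nR nU sS lS).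
  exists 0%N, (fun=> 0) => x Sx; exists (fun=> 0).
  by rewrite /kcomb big_ord0 subr0.
move=> T z sT ST [n [b bP]] mz.
exists n.+1, (fun i => if unlift ord0 i is Some j then b j else z) => x [a Ta].
have [c [ac _]] := res a.
have Tx : T (x - kscale c z).
  have -> : x - kscale c z = (x - a *: z) + (a - c%:A) *: z.
    by rewrite scalerBl addrA subrK.
  by apply: subD => //; apply: mz.
have [d dP] := bP _ Tx.
exists (fun i => if unlift ord0 i is Some j then d j else c).
rewrite /kcomb big_ord_recl /= unlift_none opprD addrA.
by under eq_bigr do rewrite liftK.
Qed.

End LocalAlgebra.

(** * Projective presentations and Cohen-Macaulay modules *)

Section Projective.
Variable R : comNzRingType.
Implicit Types A B E K M N P Q U V W Y Z : lmodType R.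

Definition projective P : Prop :=
  forall A B (p : {linear A -> B}) (f : {linear P -> B}), onto p ->
  exists g : {linear P -> A}, forall x, p (g x) = f x.

(** Projectives take the place of finite free modules: no bases have to be carried along, and by
    [factors_pfg] the stable category is the same. *)
Definition pfg P : Prop := projective P /\ finitely_generated P.

Definition short_exact K P M (i : {linear K -> P}) (p : {linear P -> M}) : Prop :=
  [/\ injective i, onto p & forall y, p y = 0 <-> exists x, i x = y].

Lemma mod_isoP M N : mod_iso M N <->
  exists (f : {linear M -> N}) (g : {linear N -> M}),
    (forall x, g (f x) = x) /\ (forall y, f (g y) = y).
Proof.
split=> [[f [g fK gK]]|[f [g [fK gK]]]]; last by exists f, g.
have lg : linear g.
  by move=> a x y; apply: (can_inj fK); rewrite linearP !gK.
by exists f, (mklin lg).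
Qed.

Lemma mod_iso_bij M N (f : {linear M -> N}) : (forall x, f x = 0 -> x = 0) -> onto f ->
  mod_iso M N.
Proof.
move=> /inj_ker inj_f /choice[g gP]; exists f, g => // x.
by apply: inj_f; rewrite gP.
Qed.

Lemma mod_iso_refl M : mod_iso M M.
Proof. by apply/mod_isoP; exists (hid M), (hid M). Qed.

Lemma mod_iso_sym M N : mod_iso M N -> mod_iso N M.
Proof. by move=> /mod_isoP[f [g [fK gK]]]; apply/mod_isoP; exists g, f. Qed.

Lemma mod_iso_trans M N P : mod_iso M N -> mod_iso N P -> mod_iso M P.
Proof.
move=> /mod_isoP[f [g [fK gK]]] /mod_isoP[f' [g' [fK' gK']]]; apply/mod_isoP.
by exists (hcomp f' f), (hcomp g g'); split=> x; rewrite !hE ?fK' ?fK ?gK ?gK'.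
Qed.

Lemma mod_iso_prod M M' N N' : mod_iso M M' -> mod_iso N N' ->
  mod_iso (M * N)%type (M' * N')%type.
Proof.
move=> /mod_isoP[f [g [fK gK]]] /mod_isoP[f' [g' [fK' gK']]]; apply/mod_isoP.
exists (hpair (hcomp f (hfst _ _)) (hcomp f' (hsnd _ _))),
       (hpair (hcomp g (hfst _ _)) (hcomp g' (hsnd _ _))).
by split=> -[x y]; rewrite !hE /= ?fK ?fK' ?gK ?gK'.
Qed.

Lemma mod_iso_prodA M N P : mod_iso (M * N * P)%type (M * (N * P))%type.
Proof.
apply/mod_isoP.
exists (hpair (hcomp (hfst _ _) (hfst _ _)) (hpair (hcomp (hsnd _ _) (hfst _ _)) (hsnd _ _))).
exists (hpair (hpair (hfst _ _) (hcomp (hfst _ _) (hsnd _ _))) (hcomp (hsnd _ _) (hsnd _ _))).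
by split=> [[[x y] z]|[x [y z]]]; rewrite !hE.
Qed.

Lemma mod_iso_prodC M N : mod_iso (M * N)%type (N * M)%type.
Proof.
apply/mod_isoP; exists (hpair (hsnd _ _) (hfst _ _)), (hpair (hsnd _ _) (hfst _ _)).
by split=> -[x y]; rewrite !hE.
Qed.

Lemma mod_iso_prod0 M N : zero_module N -> mod_iso (M * N)%type M.
Proof.
move=> N0; apply/mod_isoP; exists (hfst _ _), (hinl _ _).
by split=> [[x y]|x]; rewrite !hE //= (N0 y).
Qed.

Lemma fg_onto M N (f : {linear M -> N}) : onto f ->
  finitely_generated M -> finitely_generated N.
Proof.
move=> f_onto /fgP[s sP]; apply/fgP; exists (map f s) => y.
by have [x <-] := f_onto y; apply: span_map.
Qed.

Lemma fg_ext A E B (a : {linear A -> E}) (b : {linear E -> B}) : short_exact a b ->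
  finitely_generated A -> finitely_generated B -> finitely_generated E.
Proof.
move=> [_ b_onto ab] /fgP[s sP] /fgP[t tP]; apply/fgP.
have [c cP] := choice b_onto.
exists (map a s ++ map c t) => x.
have [y [sy xy]] : exists y, span (map c t) y /\ b y = b x.
  have : span t `<=` [set z | exists y, span (map c t) y /\ b y = z].
    apply: span_min => [|z zt /=]; last first.
      by exists (c z); split; [apply: span_mem; apply: map_f | apply: cP].
    split=> /=.
    - by exists 0; split; [apply: sub0 | rewrite linear0].
    - move=> _ _ [y [sy <-]] [z [sz <-]]; exists (y + z).
      by rewrite linearD; split=> //; apply: subD.
    - move=> d _ [y [sy <-]]; exists (d *: y).
      by rewrite linearZ; split=> //; apply: subZ.
  by apply; apply: tP.
have /ab[z zP] : b (x - y) = 0 by rewrite linearB xy subrr.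
rewrite -(subrK y x) -zP; apply: subD => //.
  by apply: span_sub (span_map a (sP z)) => u; rewrite mem_cat => ->.
by apply: span_sub sy => u; rewrite mem_cat orbC => ->.
Qed.

Lemma short_exact_prod A B : short_exact (hinl A B) (hsnd A B).
Proof.
split; first by move=> x y [].
  by move=> y; exists (0, y); rewrite hE.
move=> [x y]; rewrite !hE /=; split=> [->|[z] /= [_ <-] //]; by exists x.
Qed.

Lemma fg_prod A B : finitely_generated A -> finitely_generated B ->
  finitely_generated (A * B)%type.
Proof. exact: fg_ext (short_exact_prod A B). Qed.

Lemma pfg_prod P Q : pfg P -> pfg Q -> pfg (P * Q)%type.
Proof.
move=> [pP fP] [pQ fQ]; split; last exact: fg_prod.
move=> A B p f p_onto.
have [g gP] := pP _ _ p (hcomp f (hinl _ _)) p_onto.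
have [h hP] := pQ _ _ p (hcomp f (hinr _ _)) p_onto.
exists (hcopair g h) => -[x y]; rewrite hE linearD gP hP !hE -linearD /=.
by congr (f (_, _)); rewrite ?addr0 ?add0r.
Qed.

Section FreeProjective.
Variables (F A : lmodType R) (I : eqType) (e : I -> F) (a : I -> A).

Let lin_comb (V : lmodType R) (v : I -> V) (s : seq I) (c : I -> R) :=
  \sum_(i <- s) c i *: v i.

Lemma lin_comb_extend (V : lmodType R) (v : I -> V) s t (c : I -> R) :
  uniq s -> uniq t -> {subset s <= t} -> (forall i, i \notin s -> c i = 0) ->
  lin_comb v t c = lin_comb v s c.
Proof.
move=> us ut st c0; rewrite /lin_comb (bigID (mem s)) /= [X in _ + X]big1 ?addr0.
  rewrite -big_filter; apply: perm_big; apply: uniq_perm; rewrite ?filter_uniq //.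
  by move=> i; rewrite mem_filter; apply: andb_idr => /st.
by move=> i /c0->; rewrite scale0r.
Qed.

Lemma free_linear_extension :
  (forall x, exists (s : seq I) (c : I -> R), x = \sum_(i <- s) c i *: e i) ->
  (forall (s : seq I) (c : I -> R), uniq s ->
     \sum_(i <- s) c i *: e i = 0 -> forall i, i \in s -> c i = 0) ->
  exists g : {linear F -> A}, forall i, g (e i) = a i.
Proof.
move=> gen indep.
pose rel x y := exists s c, [/\ uniq s, forall i, i \notin s -> c i = 0,
  x = lin_comb e s c & y = lin_comb a s c].
have [|||g gP] := @linear_relation _ F A rel.
- move=> x; have [s [c xP]] := gen x.
  (* The list [s] may repeat an index, so on [undup s] each coefficient is multiplied by its number
     of occurrences. *)
  pose c' i := (count_mem i s)%:R * c i.
  exists (lin_comb a (undup s) c'), (undup s), c'; split=> //; first exact: undup_uniq.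
    by move=> i; rewrite mem_undup /c' => /count_memPn->; rewrite mul0r.
  rewrite xP -(big_undup_iterop_count _ s xpredT); apply: eq_bigr => i _.
  by rewrite Monoid.iteropE /= /c' mulr_natl -scalerMnl -iter_addr_0.
- move=> b x x' y y' [s [c [us cs -> ->]]] [t [d [ut dt -> ->]]].
  pose u := undup (s ++ t); have uu : uniq u by apply: undup_uniq.
  have su : {subset s <= u} by move=> i; rewrite mem_undup mem_cat => ->.
  have tu : {subset t <= u} by move=> i; rewrite mem_undup mem_cat orbC => ->.
  exists u, (fun i => b * c i + d i).
  rewrite -!(lin_comb_extend _ us uu su cs) -!(lin_comb_extend _ ut uu tu dt).
  split=> // [i iu||].
  + by rewrite cs ?dt ?mulr0 ?addr0 //; apply: contraNN iu; first [exact: su | exact: tu].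
  + rewrite /lin_comb scaler_sumr -big_split; apply: eq_bigr => i _.
    by rewrite scalerDl scalerA.
  + rewrite /lin_comb scaler_sumr -big_split; apply: eq_bigr => i _.
    by rewrite scalerDl scalerA.
- move=> y [s [c [us _ /esym/(indep _ _ us) c0 ->]]].
  by rewrite /lin_comb big_seq big1 // => i /c0->; rewrite scale0r.
exists g => i; have [s [c [us cs ei ->]]] := gP (e i).
pose u := undup (i :: s); have uu : uniq u by apply: undup_uniq.
have su : {subset s <= u} by move=> j js; rewrite mem_undup inE js orbT.
have iu : {subset [:: i] <= u} by move=> j; rewrite mem_undup !inE => ->.
pose d j : R := (j == i)%:R.
have d0 j : j \notin [:: i] -> d j = 0 by rewrite inE /d => /negPf->.
have dE (V : lmodType R) (v : I -> V) : lin_comb v [:: i] d = v i.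
  by rewrite /lin_comb big_seq1 /d eqxx scale1r.
rewrite -[RHS]dE -(lin_comb_extend _ us uu su cs) -(lin_comb_extend _ _ uu iu d0) //.
(* Both [c] and the indicator [d] of [i] express [e i] over the common list [u], so independence
   makes them agree there. *)
have cd : forall j, j \in u -> c j - d j = 0.
  apply: indep => //; rewrite -[RHS](subrr (e i)) {1}ei -(dE _ e).
  rewrite -(lin_comb_extend _ us uu su cs) -(lin_comb_extend _ _ uu iu d0) //.
  by rewrite -sumrB; apply: eq_bigr => j _; rewrite scalerBl.
by rewrite /lin_comb !big_seq; apply: eq_bigr => j /cd/subr0_eq->.
Qed.
End FreeProjective.

Lemma free_projective F : free_module F -> projective F.
Proof.
move=> [I [e [gen indep]]] A B p f p_onto.
have [a aP] := choice (fun i => p_onto (f (e i))).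
have [g gP] := free_linear_extension a gen indep; exists g => x.
have [s [c ->]] := gen x; rewrite !linear_sum; apply: eq_bigr => i _.
by rewrite !linearZ gP aP.
Qed.

Lemma row_free_module n : free_module 'rV[R]_n.
Proof.
exists 'I_n, (fun i => delta_mx 0 i); split=> [x|s c us c0 i si].
  by exists (index_enum 'I_n), (x 0); rewrite -row_sum_delta.
have /rowP/(_ i) := c0; rewrite summxE mxE (bigD1_seq i) //= !mxE !eqxx mulr1 big1 ?addr0 //.
by move=> j /negPf ji; rewrite !mxE eqxx eq_sym ji mulr0.
Qed.

Lemma row_fg n : finitely_generated 'rV[R]_n.
Proof.
exists n, (fun i => delta_mx 0 i) => x; exists (x 0); exact: row_sum_delta.
Qed.

Lemma row_pfg n : pfg 'rV[R]_n.
Proof. by split; [apply/free_projective/row_free_module | apply: row_fg]. Qed.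

Lemma fg_row M : finitely_generated M -> exists n (p : {linear 'rV[R]_n -> M}), onto p.
Proof.
move=> [n [g gP]].
have lp : linear (fun v : 'rV[R]_n => \sum_i v 0 i *: g i).
  move=> a u v; rewrite scaler_sumr -big_split; apply: eq_bigr => i _.
  by rewrite !mxE scalerDl scalerA.
exists n, (mklin lp) => x; have [c ->] := gP x; exists (\row_i c i).
by apply: eq_bigr => i _; rewrite mxE.
Qed.

Lemma ker_exists P M (p : {linear P -> M}) : onto p ->
  exists K (i : {linear K -> P}), short_exact i p.
Proof.
move=> p_onto; pose S := Submodule (is_sub_ker p (@is_sub0 _ M)).
exists (sub_type S), (sub_map S); split=> // y; exact: (sub_mapP S y).
Qed.

(** For a presentation K -> P -> M with P projective, this is the vanishing of Ext^1(M, R). *)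
Definition ext1 K P (i : {linear K -> P}) : Prop :=
  forall f : {linear K -> R^o}, exists g : {linear P -> R^o}, forall x, g (i x) = f x.

Lemma ext1_pfg K P Q (i : {linear K -> P}) (f : {linear K -> Q}) : ext1 i -> pfg Q ->
  exists g : {linear P -> Q}, forall x, g (i x) = f x.
Proof.
move=> ei [pQ /fg_row[n [q q_onto]]].
have [s sP] := pQ _ _ q (hid Q) q_onto.
have fj (j : 'I_n) : exists g : {linear P -> R^o}, forall x, g (i x) = s (f x) 0 j.
  have lf : linear (fun x : K => s (f x) 0 j : R^o) by move=> a x y; rewrite !linearP !mxE.
  by have [g gP] := ei (mklin lf); exists g.
have [g gP] := choice fj.
have lg : linear (fun x : P => \row_j g j x).
  by move=> a x y; apply/rowP => j; rewrite !mxE linearP.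
exists (hcomp q (mklin lg)) => x; rewrite hE -[RHS]sP; congr (q _).
by apply/rowP => j; rewrite mxE gP.
Qed.

Lemma ext1_indep M K P K' P' (i : {linear K -> P}) (p : {linear P -> M})
    (i' : {linear K' -> P'}) (p' : {linear P' -> M}) :
  short_exact i p -> short_exact i' p' -> projective P -> projective P' ->
  ext1 i -> ext1 i'.
Proof.
move=> [ii po ip] [ii' po' ip'] pP pP' ei f.
have [a aP] := pP' _ _ p p' po; have [b bP] := pP _ _ p' p po'.
have [|bi biP] := corestrict (f := hcomp b i) ii'.
  by move=> x; apply/ip'; rewrite hE bP; apply/ip; exists x.
(* The composite [b a] of the comparison maps differs from the identity of P' by a map [c] into K';
   it supplies the correction term of the extension. *)
have [|c cP] := corestrict (f := hsub (hid P') (hcomp b a)) ii'.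
  by move=> x; apply/ip'; rewrite !hE linearB bP aP subrr.
have [g gP] := ei (hcomp f bi).
have [|ai aiP] := corestrict (f := hcomp a i') ii.
  by move=> x; apply/ip; rewrite hE aP; apply/ip'; exists x.
exists (hadd (hcomp g a) (hcomp f c)) => x; rewrite !hE.
rewrite -[a _]/(hcomp a i' x) -aiP gP hE -linearD; congr (f _); apply: ii'.
by rewrite linearD biP cP !hE aiP hE addrC subrK.
Qed.

Lemma schanuel M K P K' P' (i : {linear K -> P}) (p : {linear P -> M})
    (i' : {linear K' -> P'}) (p' : {linear P' -> M}) :
  short_exact i p -> short_exact i' p' -> projective P -> projective P' ->
  mod_iso (K * P')%type (K' * P)%type.
Proof.
move=> [ii po ip] [ii' po' ip'] pP pP'.
have [b bP] := pP' _ _ p p' po; have [a aP] := pP _ _ p' p po'.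
pose u := hcopair i b.
have pu x : p (u x) = p' x.2.
  have E : p (i x.1) = 0 by apply/ip; exists x.1.
  by rewrite hE linearD bP E add0r.
have [|v vP] := corestrict (f := hsub (hsnd K P') (hcomp a u)) ii'.
  by move=> x; apply/ip'; rewrite hsubE hsndE hcompE linearB aP pu subrr.
apply: (@mod_iso_bij _ _ (hpair v u)) => [[x y]|[x' z]].
  rewrite hpairE => -[v0]; rewrite -[X in X = _]/(u (x, y)) => u0.
  have := vP (x, y); rewrite v0 hsubE hsndE hcompE u0 !linear0 addr0 => /= y0.
  move: u0; rewrite hE /= -y0 linear0 addr0 => /eqP; rewrite -(linear0 i) => /eqP/ii->.
  by [].
pose y := i' x' + a z.
have /ip[x xP] : p (z - b y) = 0.
  have E : p' (i' x') = 0 by apply/ip'; exists x'.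
  by rewrite linearB bP linearD aP E add0r subrr.
exists (x, y); rewrite hpairE.
have -> : u (x, y) = z by rewrite hE /= xP subrK.
congr (_, _); apply: ii'; rewrite vP hsubE hsndE hcompE.
have -> : u (x, y) = z by rewrite hE /= xP subrK.
by rewrite addrK.
Qed.

Definition syzygy_closed (X : lmodType R -> Prop) : Prop :=
  forall A, X A -> finitely_generated A /\
    exists K P (i : {linear K -> P}) (p : {linear P -> A}),
      [/\ pfg P, short_exact i p, ext1 i & X K].

(* The largest class of finitely generated modules closed under a syzygy with
   Ext^1(-, R) = 0: a form of Cohen-Macaulayness that names no resolution. *)
Definition CM M : Prop := exists X, syzygy_closed X /\ X M.

Lemma CM_fg M : CM M -> finitely_generated M.
Proof. by move=> [X [Xc /Xc[]]]. Qed.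

Lemma CM_closed : syzygy_closed CM.
Proof.
move=> A [X [Xc XA]]; have [fA [K [P [i [p [pP s e XK]]]]]] := Xc A XA.
by split=> //; exists K, P, i, p; split=> //; exists X.
Qed.

Lemma CM_pfg P : pfg P -> CM P.
Proof.
move=> pP; exists pfg; split=> // A [pA fA]; split=> //.
exists 'rV[R]_0, A, (hzero _ _), (hid A); split=> //; last exact: row_pfg.
- split; first by move=> x y _; rewrite !thinmx0.
    by move=> y; exists y.
  by move=> y; rewrite hE; split=> [->|[x <-]//]; exists 0.
- by move=> f; exists (hzero _ _) => x; rewrite (thinmx0 x) !linear0.
Qed.

(** By the horseshoe construction, the class of extensions of CM modules by CM modules is itself
    closed under a syzygy, so it is contained in the largest such class. *)
Lemma CM_ext A E B (a : {linear A -> E}) (b : {linear E -> B}) :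
  short_exact a b -> CM A -> CM B -> CM E.
Proof.
move=> sab cA cB.
exists (fun E => exists A B (a : {linear A -> E}) (b : {linear E -> B}),
  [/\ short_exact a b, CM A & CM B]); split; last by exists A, B, a, b.
move=> {sab cA cB a b}{}E [{}A [{}B [a [b [sab cA cB]]]]].
have [fA [KA [PA [iA [pA [qA sA eA cKA]]]]]] := CM_closed cA.
have [fB [KB [PB [iB [pB [qB sB eB cKB]]]]]] := CM_closed cB.
split; first exact: fg_ext sab fA fB.
have [ia bo ab] := sab; have [iiA pAo AP] := sA; have [iiB pBo BP] := sB.
have [q qP] := qB.1 _ _ b pB bo.
pose pi := hcopair (hcomp a pA) q.
have bpi x : b (pi x) = pB x.2.
  have ba0 : b (a (pA x.1)) = 0 by apply/ab; exists (pA x.1).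
  by rewrite !hE linearD qP ba0 add0r.
have pio : onto pi.
  move=> x; have [y yP] := pBo (b x).
  have /ab[z zP] : b (x - q y) = 0 by rewrite linearB qP yP subrr.
  have [w wP] := pAo z; exists (w, y).
  by rewrite !hE /= wP zP subrK.
have [E' [j sj]] := ker_exists pio; have [ij _ jP] := sj.
exists E', (PA * PB)%type, j, pi.
have [|l lP] := corestrict (f := hpair iA (hzero KA PB)) ij.
  move=> x; apply/jP; rewrite !hE /= linear0 addr0.
  have -> : pA (iA x) = 0 by apply/AP; exists x.
  exact: linear0.
have [|r rP] := corestrict (f := hcomp (hsnd PA PB) j) iiB.
  move=> x; apply/BP; rewrite hcompE hsndE -bpi.
  have -> : pi (j x) = 0 by apply/jP; exists x.
  exact: linear0.
have slr : short_exact l r.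
  split.
  - apply: inj_ker => x lx; have := lP x; rewrite lx linear0 hpairE => -[/esym/eqP].
    by rewrite -(linear0 iA) => /eqP/iiA.
  - move=> z; have /ab[w wP] : b (q (iB z)) = 0 by rewrite qP; apply/BP; exists z.
    have [x xP] := pAo w.
    have /jP[y yP] : pi (- x, iB z) = 0 by rewrite !hE /= linearN linearN xP wP addNr.
    by exists y; apply: iiB; rewrite rP !hE yP.
  - move=> y; split=> [ry|[x <-]].
      have y2 : (j y).2 = 0 by have := rP y; rewrite ry linear0 !hE.
      have /jP : exists z, j z = j y by exists y.
      rewrite !hE y2 linear0 addr0 -(linear0 a) => /ia/AP[x xP].
      exists x; apply: ij; rewrite lP !hE xP -y2; by case: (j y).
    by apply: iiB; rewrite rP !hE lP linear0.
split; [exact: pfg_prod | exact: sj | | by exists KA, KB, l, r].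
(* First extend the restriction of [f] to KA over PA. The rest [f'] vanishes on KA, descends to KB
   and extends over PB. *)
move=> f; have [g gP] := eA (hcomp f l).
pose f' := hsub f (hcomp g (hcomp (hfst PA PB) j)).
have [_ r_onto lr] := slr.
have [|h hP] := descend (f := f') r_onto.
  by move=> x /lr[y <-]; rewrite !hE lP hpairE /= gP hE subrr.
have [g' g'P] := eB h.
exists (hcopair g g') => x; rewrite hE.
have -> : (j x).2 = iB (r x) by rewrite rP !hE.
by rewrite g'P hP !hE addrC subrK.
Qed.

Lemma CM_prod A B : CM A -> CM B -> CM (A * B)%type.
Proof. exact: CM_ext (short_exact_prod A B). Qed.

(** The class of summands of CM modules is closed under a syzygy. A cover P -> Z with kernel K
    projects to covers of Y and Y' with kernels W and W'; Schanuel's lemma gives W + W' + P = K + P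
    + P up to isomorphism, so W is again a summand of a CM module. *)
Lemma CM_summand Y Y' Z : CM Z -> mod_iso (Y * Y')%type Z -> CM Y.
Proof.
move=> cZ yZ; exists (fun Y => exists Y' Z, CM Z /\ mod_iso (Y * Y')%type Z).
split; last by exists Y', Z.
move=> {Y' Z cZ yZ}{}Y [Y' [Z [cZ /mod_isoP[f [g [fK gK]]]]]].
have [fZ [K [P [i [p [qP sp ep cK]]]]]] := CM_closed cZ.
have [ii po ip] := sp.
pose y := hcomp (hfst Y Y') (hcomp g p); pose y' := hcomp (hsnd Y Y') (hcomp g p).
have yo : onto y.
  by move=> u; have [x xP] := po (f (u, 0)); exists x; rewrite !hE xP fK.
have yo' : onto y'.
  by move=> u; have [x xP] := po (f (0, u)); exists x; rewrite !hE xP fK.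
split; first exact: fg_onto yo qP.2.
have [W [w sw]] := ker_exists yo; have [W' [w' sw']] := ker_exists yo'.
have [iw _ wP] := sw; have [iw' _ wP'] := sw'.
exists W, P, w, y.
pose pp := hcomp f (hpair (hcomp y (hfst P P)) (hcomp y' (hsnd P P))).
have spp : short_exact (hpair (hcomp w (hfst W W')) (hcomp w' (hsnd W W'))) pp.
  split.
  - by move=> [u v] [u' v']; rewrite !hE /= => -[/iw-> /iw'->].
  - move=> z; have [u uP] := yo (g z).1; have [v vP] := yo' (g z).2.
    exists (u, v); rewrite hcompE hpairE !hcompE hfstE hsndE /=.
    by move: uP vP => /= -> ->; rewrite -surjective_pairing gK.
  - move=> [u v]; rewrite hcompE hpairE [hcomp y _ _]hcompE [hcomp y' _ _]hcompE hfstE hsndE /=.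
    split=> [fu|[[a b]]].
      have : (y u, y' v) = 0 by rewrite -[LHS]fK fu linear0.
      by move=> [/wP[a <-] /wP'[b <-]]; exists (a, b); rewrite !hE.
    move=> /= [<- <-]; rewrite -[(g (p (w a))).1]/(y (w a)) -[(g (p (w' b))).2]/(y' (w' b)).
    have -> : y (w a) = 0 by apply/wP; exists a.
    have -> : y' (w' b) = 0 by apply/wP'; exists b.
    exact: linear0.
have qPP := pfg_prod qP qP.
split=> //.
  move=> e; have epp := ext1_indep sp spp qP.1 qPP.1 ep.
  have [h hP] := epp (hcomp e (hfst W W')).
  exists (hcomp h (hinl P P)) => x; have := hP (x, 0).
  by rewrite !hE /= linear0.
exists (W' * P)%type, (K * (P * P))%type; split.
  by apply: CM_prod => //; apply: CM_pfg.
apply: mod_iso_trans (mod_iso_sym (mod_iso_prodA _ _ _)) _.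
exact: schanuel spp sp qPP.1 qP.1.
Qed.

Lemma CM_iso M N : mod_iso M N -> CM M -> CM N.
Proof.
move=> /mod_iso_sym iMN cM; apply: (@CM_summand _ 'rV[R]_0 _ cM).
apply: mod_iso_trans (mod_iso_prod0 _ _) iMN => x; exact: thinmx0.
Qed.

Lemma CM_syzygy M K P (i : {linear K -> P}) (p : {linear P -> M}) :
  short_exact i p -> pfg P -> CM M -> CM K /\ ext1 i.
Proof.
move=> sp qP cM; have [fM [K' [P' [i' [p' [qP' sp' ep' cK']]]]]] := CM_closed cM.
split; last exact: ext1_indep sp' sp qP'.1 qP.1 ep'.
apply: (@CM_summand _ P' (K' * P)%type); first by apply: CM_prod => //; apply: CM_pfg.
exact: schanuel sp sp' qP.1 qP'.1.
Qed.

End Projective.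

(** * Agreement of [CM] with the definition by resolutions *)

Section CohenMacaulay.
Variable R : comNzRingType.
Implicit Types A B C K M N P Q : lmodType R.

Definition limage_map A B (d : {linear A -> B}) : {linear limage d -> B} := val.

Lemma limage_pres A B C (d : {linear A -> B}) (e : {linear B -> C}) :
  range e = setT -> exact_at d e ->
  short_exact (limage_map (d)) e.
Proof.
move=> re ex; split; first exact: val_inj.
  by move=> y; have : setT y by []; rewrite -re => -[x _ <-]; exists x.
move=> y; have -> : (e y = 0) <-> range d y by rewrite -ex.
split=> [dy|[[x dx] <-]]; last exact/asboolP.
by exists (Limage (introT (asboolP _) dy)).
Qed.

Lemma limage_onto A B (d : {linear A -> B}) :
  exists e : {linear A -> limage d}, [/\ forall x, val (e x) = d x & range e = setT].
Proof.
have [||e eP] := corestrict (f := d) (i := limage_map (d)).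
- exact: val_inj.
- move=> x; have dx : d x \in limage_pred d by apply/asboolP; exists x.
  by exists (Limage dx).
exists e; split=> //; apply/seteqP; split=> // -[y ry] _.
have [x _ xy] := asboolP _ ry; exists x => //.
by apply: val_inj; rewrite [LHS]eP.
Qed.

Section Resolution.
Variables (M : lmodType R) (F : free_resolution M).

Lemma res_pfg i : pfg (res_obj F i).
Proof. by split; [apply/free_projective/res_free | apply: res_fg]. Qed.

Lemma syzygy_short_exact :
  short_exact (limage_map (res_d F 0)) (res_aug F).
Proof. by apply: limage_pres; [exact: res_surj | exact: res_exact0]. Qed.

Lemma res_d0 i x : res_d F i (res_d F i.+1 x) = 0.
Proof.
have := res_exact F i; rewrite /exact_at => /seteqP[_ /(_ (res_d F i.+1 x))].
by apply; exists x.
Qed.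

Lemma Ext_vanishes_ext1 i : Ext_vanishes R^o F i.+1 ->
  ext1 (limage_map (res_d F i)).
Proof.
move=> van f; have [e [eP _]] := limage_onto (res_d F i).
have [|g gP] := van (hcomp f e).
  move=> x; rewrite hcompE (_ : e _ = 0) ?linear0 //.
  by apply: val_inj; rewrite [LHS]eP res_d0 linear0.
exists g => -[y ry]; have [x _ xy] := asboolP _ ry.
have -> : Limage ry = e x by apply: val_inj; rewrite [RHS]eP.
by have := gP x; rewrite hcompE => ->; congr (g _); exact: eP.
Qed.

Lemma limage_exact_at A B C (d : {linear A -> B}) (d' : {linear B -> C})
    (e : {linear B -> limage d'}) :
  exact_at d d' -> (forall x, val (e x) = d' x) -> exact_at d e.
Proof.
move=> ex eP; rewrite /exact_at -ex; apply/seteqP; split=> y /= y0.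
  by rewrite -eP y0 linear0.
by apply: val_inj; rewrite [LHS]eP y0 linear0.
Qed.
End Resolution.

Lemma cohen_macaulay_CM M : cohen_macaulay M -> CM M.
Proof.
move=> [fM [F van]].
exists (fun A => A = M \/ exists j, A = limage (res_d F j)); split; last by left.
have fg_lim j : finitely_generated (limage (res_d F j)).
  have [e [_ re]] := limage_onto (res_d F j).
  apply: (@fg_onto _ _ _ e) (res_fg F j.+1) => y.
  by have : setT y by []; rewrite -re => -[x _ <-]; exists x.
move=> _ [->|[j ->]]; split=> //.
- exists (syzygy F), (res_obj F 0), (limage_map (res_d F 0)), (res_aug F).
  split; [exact: res_pfg | exact: syzygy_short_exact | | by right; exists 0%N].
  by apply: Ext_vanishes_ext1; apply: van.
- have [e [eP re]] := limage_onto (res_d F j).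
  exists (limage (res_d F j.+1)), (res_obj F j.+1), (limage_map (res_d F j.+1)), e.
  split; [exact: res_pfg | | | by right; exists j.+1].
    apply: limage_pres => //; apply: limage_exact_at eP; exact: res_exact.
  by apply: Ext_vanishes_ext1; apply: van.
Qed.

(** One syzygy with a free cover, bundled so that it can be chosen and iterated: spliced together
    the steps form a resolution, and their kernels form the chain used in [stable_local_syzygy]. *)
Record syzygy_step M := SyzygyStep {
  step_rank : nat;
  step_ker : lmodType R;
  step_inj : {linear step_ker -> 'rV[R]_step_rank};
  step_proj : {linear 'rV[R]_step_rank -> M};
  step_exact : short_exact step_inj step_proj;
  step_ext1 : ext1 step_inj;
  step_CM : CM step_ker }.

Lemma syzygy_step_exists M : CM M -> exists s : syzygy_step M, True.
Proof.
move=> cM; have [n [p po]] := fg_row (CM_fg cM); have [K [i s]] := ker_exists po.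
have [cK ei] := CM_syzygy s (row_pfg R n) cM.
by exists (SyzygyStep s ei cK).
Qed.

Lemma CM_cohen_macaulay M : CM M -> cohen_macaulay M.
Proof.
move=> cM; split; first exact: CM_fg.
pose step (K : {K : lmodType R | CM K}) := sval (cid (syzygy_step_exists (svalP K))).
pose next (K : {K : lmodType R | CM K}) : {K : lmodType R | CM K} :=
  exist _ _ (step_CM (step K)).
pose K j := iter j next (exist _ M cM).
pose F j : lmodType R := 'rV[R]_(step_rank (step (K j))).
pose p j : {linear F j -> sval (K j)} := step_proj (step (K j)).
pose i j : {linear sval (K j.+1) -> F j} := step_inj (step (K j)).
have se j : short_exact (i j) (p j) by apply: step_exact.
pose d j : {linear F j.+1 -> F j} := hcomp (i j) (p j.+1).
have rp j : range (p j) = setT.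
  by apply/seteqP; split=> // y _; have [_ po _] := se j; have [x <-] := po y; exists x.
have rd j : range (d j) = range (i j).
  apply/seteqP; split=> _ [x _ <-]; first by exists (p j.+1 x).
  by have [_ po _] := se j.+1; have [y <-] := po x; exists y.
have kp j : [set y | p j y = 0] = range (d j).
  rewrite rd; apply/seteqP; split=> y /=; have [_ _ ->] := se j.
    by case=> x <-; exists x.
  by case=> x _ <-; exists x.
have ex j : exact_at (d j.+1) (d j).
  rewrite /exact_at -kp; apply/seteqP; split=> y /=; have [ii _ _] := se j.
    by move=> dy; apply: ii; rewrite linear0 -[RHS]dy.
  by move=> py; rewrite /d /= py linear0.
exists (@FreeResolution R M F d (p 0%N) (fun j => row_free_module _ _)
  (fun j => row_fg _ _) (rp 0%N) (kp 0%N) ex).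
case=> // j _ phi /= phi0.
have [_ po kpj] := se j.+1.
have [|f fP] := descend (f := phi) po.
  move=> x px; have : [set y | p j.+1 y = 0] x by [].
  by rewrite kp => -[y _ <-]; apply: phi0.
have [g gP] := step_ext1 (s := step (K j)) f.
by exists g => x; rewrite -fP -gP.
Qed.

End CohenMacaulay.

(** * The stable category *)

Section Stable.
Variable R : comNzRingType.
Implicit Types A B K L M N P Q X Y : lmodType R.

Lemma factors_pfg M P N (a : {linear M -> P}) (b : {linear P -> N}) (f : M -> N) :
  pfg P -> (forall x, f x = b (a x)) -> factors_free f.
Proof.
move=> [pP /fg_row[n [q qo]]] fE; have [s sP] := pP _ _ q (hid P) qo.
exists 'rV[R]_n, (hcomp s a), (hcomp b q); split=> [|x]; first exact: row_free_module.
by rewrite fE !hE sP.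
Qed.

Lemma factors_lift M A N (p : {linear A -> N}) (f : M -> N) : factors_free f -> onto p ->
  exists h : {linear M -> A}, forall x, f x = p (h x).
Proof.
move=> [F [a [b [fF fE]]]] po; have [c cP] := free_projective fF b po.
by exists (hcomp c a) => x; rewrite fE !hE cP.
Qed.

(** A single free cover of N detects all of P(M, N), because free modules are projective. Sums and
    multiples of such maps are then formed on their lifts. *)
Lemma factorsP M N : finitely_generated N ->
  exists n (p : {linear 'rV[R]_n -> N}), onto p /\
  forall f : M -> N, factors_free f <-> exists h : {linear M -> 'rV[R]_n}, forall x, f x = p (h x).
Proof.
move=> /fg_row[n [p po]]; exists n, p; split=> // f; split=> [/factors_lift|[h hP]]; first exact.
exact: factors_pfg (row_pfg R n) hP.
Qed.

Lemma factors_eq M N (f g : M -> N) : f =1 g -> factors_free f -> factors_free g.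
Proof. by move=> fg [F [a [b [fF fE]]]]; exists F, a, b; split=> // x; rewrite -fg. Qed.

Lemma factors_compl M N Q (f : M -> N) (g : {linear N -> Q}) :
  factors_free f -> factors_free (fun x => g (f x)).
Proof.
move=> [F [a [b [fF fE]]]]; exists F, a, (hcomp g b); split=> // x.
by rewrite fE.
Qed.

Lemma factors_compr M N Q (f : M -> N) (g : {linear Q -> M}) :
  factors_free f -> factors_free (fun x => f (g x)).
Proof. by move=> [F [a [b [fF fE]]]]; exists F, (hcomp a g), b. Qed.

Lemma factors_lin M N c (f g : M -> N) : finitely_generated N ->
  factors_free f -> factors_free g -> factors_free (fun x => c *: f x + g x).
Proof.
move=> /(factorsP M)[n [p [_ pP]]] /pP[h hP] /pP[l lP]; apply/pP.
by exists (hadd (hscale c h) l) => x; rewrite hP lP !hE linearP.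
Qed.

Lemma factors0 M N : finitely_generated N -> factors_free (fun _ : M => 0 : N).
Proof.
move=> /(factorsP M)[n [p [_ pP]]]; apply/pP; exists (hzero _ _) => x.
by rewrite hE linear0.
Qed.

Lemma factorsD M N (f g : M -> N) : finitely_generated N ->
  factors_free f -> factors_free g -> factors_free (fun x => f x + g x).
Proof.
move=> fN ff fg; apply: factors_eq (factors_lin 1 fN ff fg) => x.
by rewrite scale1r.
Qed.

Lemma factorsZ M N c (f : M -> N) : finitely_generated N ->
  factors_free f -> factors_free (fun x => c *: f x).
Proof.
move=> fN ff; apply: factors_eq (factors_lin c fN ff (factors0 M fN)) => x.
by rewrite addr0.
Qed.

Lemma factorsN M N (f : M -> N) : finitely_generated N ->
  factors_free f -> factors_free (fun x => - f x).
Proof.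
by move=> fN ff; apply: factors_eq (factorsZ (-1) fN ff) => x; rewrite scaleN1r.
Qed.

Lemma factors_to M P (f : {linear M -> P}) : pfg P -> factors_free f.
Proof. by move=> qP; apply: (factors_pfg (a := f) (b := hid P) qP). Qed.

(* [P(M, N)] as a submodule of [Hom(M, N)]. *)
Definition free_hom M N : set (hom M N) := [set f | factors_free (lin_of_hom f)].
Arguments free_hom : clear implicits.

Lemma is_sub_free_hom M N : finitely_generated N -> is_sub (free_hom M N).
Proof.
move=> fN; split; first exact: (factors0 M fN).
  by move=> f g; apply: factorsD.
by move=> a f; apply: factorsZ.
Qed.

Lemma stable_iso_sym M N : stable_iso M N -> stable_iso N M.
Proof. by move=> [f [g [gf fg]]]; exists g, f. Qed.

Lemma stable_eq_trans M N (f g h : M -> N) : finitely_generated N ->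
  stable_eq f g -> stable_eq g h -> stable_eq f h.
Proof.
move=> fN fg gh; apply: factors_eq (factorsD fN fg gh) => x.
by rewrite addrA subrK.
Qed.

Lemma stable_eq_sym M N (f g : M -> N) : finitely_generated N ->
  stable_eq f g -> stable_eq g f.
Proof. by move=> fN fg; apply: factors_eq (factorsN fN fg) => x; rewrite opprB. Qed.

Lemma stable_eq_refl M N (f : M -> N) : finitely_generated N -> stable_eq f f.
Proof. by move=> fN; apply: factors_eq (factors0 M fN) => x; rewrite subrr. Qed.

Lemma stable_iso_trans M N Q : finitely_generated M -> finitely_generated Q ->
  stable_iso M N -> stable_iso N Q -> stable_iso M Q.
Proof.
move=> fM fQ [f [g [gf fg]]] [f' [g' [gf' fg']]].
exists (hcomp f' f), (hcomp g g'); split.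
- apply: stable_eq_trans gf => //.
  apply: factors_eq (factors_compl g (factors_compr f gf')) => x.
  by rewrite /= linearB.
- apply: stable_eq_trans fg' => //.
  apply: factors_eq (factors_compl f' (factors_compr g' fg)) => x.
  by rewrite /= linearB.
Qed.

Lemma mod_iso_stable M N : finitely_generated M -> finitely_generated N ->
  mod_iso M N -> stable_iso M N.
Proof.
move=> fM fN /mod_isoP[f [g [fK gK]]]; exists f, g; split.
  by apply: factors_eq (factors0 M fM) => x /=; rewrite fK subrr.
by apply: factors_eq (factors0 N fN) => x /=; rewrite gK subrr.
Qed.

Lemma stable_iso_prod M M' N N' : finitely_generated M -> finitely_generated M' ->
  finitely_generated N -> finitely_generated N' ->
  stable_iso M M' -> stable_iso N N' -> stable_iso (M * N)%type (M' * N')%type.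
Proof.
move=> fM fM' fN fN' [f [g [gf fg]]] [f' [g' [gf' fg']]].
exists (hpair (hcomp f (hfst _ _)) (hcomp f' (hsnd _ _))),
       (hpair (hcomp g (hfst _ _)) (hcomp g' (hsnd _ _))); split.
- apply: factors_eq (factorsD (fg_prod fM fN)
    (factors_compl (hinl M N) (factors_compr (hfst M N) gf))
    (factors_compl (hinr M N) (factors_compr (hsnd M N) gf'))) => -[x y].
  by congr (_, _); [exact: addr0 | exact: add0r].
- apply: factors_eq (factorsD (fg_prod fM' fN')
    (factors_compl (hinl M' N') (factors_compr (hfst M' N') fg))
    (factors_compl (hinr M' N') (factors_compr (hsnd M' N') fg'))) => -[x y].
  by congr (_, _); [exact: addr0 | exact: add0r].
Qed.

Lemma stable_iso_pfg M P : finitely_generated M -> pfg P -> stable_iso (M * P)%type M.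
Proof.
move=> fM qP; exists (hfst M P), (hinl M P); split.
  have fl : factors_free (hcomp (hinr M P) (hsnd M P)) by apply: factors_pfg qP _.
  apply: factors_eq (factorsN (fg_prod fM qP.2) fl) => -[x y].
  by congr (_, _); rewrite /= ?subrr ?oppr0 ?sub0r.
by apply: factors_eq (factors0 M fM) => x /=; rewrite subrr.
Qed.

(** Lift [f] to a free cover of L, then extend the lift over P by the vanishing of Ext^1. *)
Lemma ext1_factors K P L (i : {linear K -> P}) (f : K -> L) :
  ext1 i -> finitely_generated L -> factors_free f ->
  exists g : {linear P -> L}, forall x, g (i x) = f x.
Proof.
move=> ei fL f0; have [n [e eo]] := fg_row fL; have [h hP] := factors_lift f0 eo.
have [g gP] := ext1_pfg h ei (row_pfg R n).
by exists (hcomp e g) => x; rewrite hE gP hP.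
Qed.

Section Omega.
Variables (M N K L P Q : lmodType R).
Variables (i : {linear K -> P}) (p : {linear P -> M}).
Variables (j : {linear L -> Q}) (q : {linear Q -> N}).
Hypotheses (sp : short_exact i p) (sq : short_exact j q).
Hypotheses (qP : pfg P) (qQ : pfg Q) (ei : ext1 i) (fL : finitely_generated L).

(* [f'] represents the image of [f] under the syzygy functor. *)
Definition omega (f : M -> N) (f' : K -> L) : Prop :=
  exists2 h : {linear P -> Q}, forall x, q (h x) = f (p x) & forall x, j (f' x) = h (i x).

Lemma omega_lin a f f' g g' : omega f f' -> omega g g' ->
  omega (fun x => a *: f x + g x) (fun x => a *: f' x + g' x).
Proof.
move=> [h hf hf'] [l lf lf']; exists (hadd (hscale a h) l) => x; rewrite !hE linearP.
  by rewrite hf lf.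
by rewrite hf' lf'.
Qed.

Lemma omegaZ a f f' : omega f f' -> omega (fun x => a *: f x) (fun x => a *: f' x).
Proof.
move=> [h hf hf']; exists (hscale a h) => x; rewrite !hE linearZ; first by rewrite hf.
by rewrite hf'.
Qed.

Lemma omegaB f f' g g' : omega f f' -> omega g g' ->
  omega (fun x => f x - g x) (fun x => f' x - g' x).
Proof.
move=> [h hf hf'] [l lf lf']; exists (hsub h l) => x; rewrite !hE linearB.
  by rewrite hf lf.
by rewrite hf' lf'.
Qed.

Lemma omega_total (f : {linear M -> N}) : exists f' : {linear K -> L}, omega f f'.
Proof.
have [ii po ip] := sp; have [ij qo jq] := sq.
have [h hP] := qP.1 _ _ q (hcomp f p) qo.
have [|f' f'P] := corestrict (f := hcomp h i) ij.
  move=> x; apply/jq; rewrite hE hP hE.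
  have -> : p (i x) = 0 by apply/ip; exists x.
  exact: linear0.
by exists f', h.
Qed.

(** Fullness of the syzygy functor: [j f'] extends to P -> Q since Ext^1(M, Q) = 0, and this
    extension induces a map on the cokernels. *)
Lemma omega_onto (f' : {linear K -> L}) : exists f : {linear M -> N}, omega f f'.
Proof.
have [ii po ip] := sp; have [ij qo jq] := sq.
have [h hP] := ext1_pfg (hcomp j f') ei qQ.
have [|f fP] := descend (f := hcomp q h) po.
  move=> x /ip[y <-]; rewrite hE hP; apply/jq; rewrite hE.
  by exists (f' y).
by exists f, h.
Qed.

(** Well-definedness and faithfulness on the stable category. If [l] lifts f to Q, then [h - l p]
    lands in L and restricts to f' on K. Conversely, if [g] extends f' over P, then [h - j g]
    vanishes on K and induces a lift of f. *)
Lemma omega_free f f' : omega f f' -> factors_free f <-> factors_free f'.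
Proof.
have [ii po ip] := sp; have [ij qo jq] := sq.
move=> [h hf hf']; split.
  move=> /factors_lift/(_ qo)[l lP].
  have [|u uP] := corestrict (f := hsub h (hcomp l p)) ij.
    by move=> x; apply/jq; rewrite !hE linearB hf lP subrr.
  apply: (factors_pfg (a := i) (b := u)) qP _ => x; apply: ij.
  have E : p (i x) = 0 by apply/ip; exists x.
  by rewrite uP hf' !hE E linear0 subr0.
move=> f'0; have [g gP] := ext1_factors ei fL f'0.
have [|u uP] := descend (f := hsub h (hcomp j g)) po.
  by move=> _ /ip[y <-]; rewrite !hE gP hf' subrr.
apply: (factors_pfg (a := u) (b := q)) qQ _ => x; have [y <-] := po x.
have E : q (j (g y)) = 0 by apply/jq; exists (g y).
by rewrite uP !hE linearB hf E subr0.
Qed.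
End Omega.

Lemma omega_id M K P (i : {linear K -> P}) (p : {linear P -> M}) : omega i p i p id id.
Proof. by exists (hid P). Qed.

Lemma omega_comp M1 K1 P1 (i1 : {linear K1 -> P1}) (p1 : {linear P1 -> M1})
    M2 K2 P2 (i2 : {linear K2 -> P2}) (p2 : {linear P2 -> M2})
    M3 K3 P3 (i3 : {linear K3 -> P3}) (p3 : {linear P3 -> M3})
    (f : M1 -> M2) (f' : K1 -> K2) (g : M2 -> M3) (g' : K2 -> K3) :
  omega i1 p1 i2 p2 f f' -> omega i2 p2 i3 p3 g g' ->
  omega i1 p1 i3 p3 (g \o f) (g' \o f').
Proof.
move=> [h hf hf'] [l lf lf']; exists (hcomp l h) => x; rewrite !hE /=.
  by rewrite lf hf.
by rewrite lf' hf'.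
Qed.
End Stable.
Arguments free_hom {R} M N.

(** * Finiteness of stable Hom *)

Section Generators.
Variables (R : comNzRingType) (m : set R).
Hypotheses (nR : noetherian_ring R) (lR : local_ring_at m).
Implicit Types A B M N X Y Z : lmodType R.

Definition gen_by n X : Prop :=
  exists g : 'I_n -> X, forall x, exists c : 'I_n -> R, x = \sum_i c i *: g i.

Lemma gen_by_onto n M N (f : {linear M -> N}) : onto f -> gen_by n M -> gen_by n N.
Proof.
move=> fo [g gP]; exists (f \o g) => y; have [x <-] := fo y; have [c ->] := gP x.
by exists c; rewrite linear_sum; apply: eq_bigr => i _; rewrite linearZ.
Qed.

Lemma gen_by_iso n M N : mod_iso M N -> gen_by n M -> gen_by n N.
Proof. by move=> /mod_isoP[f [g [_ gK]]]; apply: (@gen_by_onto n _ _ f) => y; exists (g y). Qed.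

Lemma gen_by_zero X : gen_by 0 X -> zero_module X.
Proof. by move=> [g gP] x; have [c ->] := gP x; rewrite big_ord0. Qed.

(** Write (0, y) in terms of the generators. A unit coefficient would make one generator redundant
    in A. If A really needs n + 1 generators, all coefficients therefore lie in m, so B = mB and B =
    0. *)
Lemma gen_by_summand n A B : gen_by n.+1 (A * B)%type -> ~ zero_module B -> gen_by n A.
Proof.
move=> [g gP] B0; apply: contrapT => nA; apply: B0.
have fB : finitely_generated B.
  have : gen_by n.+1 B by apply: (@gen_by_onto _ _ _ (hsnd A B)) => [y|]; [exists (0, y) | exists g].
  by exists n.+1.
apply: (nakayama_local nR lR fB (@is_sub0 _ B)) => y; apply: add_subr => //.
have [c cP] := gP (0, y).
have [c1 c2] : 0 = \sum_i c i *: (g i).1 /\ y = \sum_i c i *: (g i).2.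
  split; first by rewrite -[LHS](hfstE (0 : A, y)) cP linear_sum; apply: eq_bigr => i _; rewrite linearZ.
  by rewrite -[LHS](hsndE (0 : A, y)) cP linear_sum; apply: eq_bigr => i _; rewrite linearZ.
have [[i mi]|mc] := pselect (exists i, ~ m (c i)); last first.
  exists n.+1, c, (fun i => (g i).2); split=> // i.
  by apply: contrapT => mi; apply: mc; exists i.
have [b bP] := unit_notin nR lR mi.
have gi : (g i).1 = \sum_j (- b * c (lift i j)) *: (g (lift i j)).1.
  have : c i *: (g i).1 = - \sum_j c (lift i j) *: (g (lift i j)).1.
    by apply/eqP; have := c1; rewrite (bigD1_ord i) //= => /esym/eqP; rewrite addr_eq0.
  move/(congr1 (fun z => b *: z)); rewrite scalerA bP scale1r => ->.
  rewrite -sumrN scaler_sumr; apply: eq_bigr => j _.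
  by rewrite scalerN scalerA mulNr scaleNr.
case: nA; exists (fun j => (g (lift i j)).1) => x.
have [d /(congr1 (hfst A B))] := gP (x, 0); rewrite linear_sum hfstE /= => ->.
rewrite (bigD1_ord i) //=; exists (fun j => d i * (- b * c (lift i j)) + d (lift i j)).
rewrite hfstE /= gi scaler_sumr -big_split; apply: eq_bigr => j _.
by rewrite scalerDl scalerA.
Qed.

Lemma zero_iso X Y : zero_module X -> zero_module Y -> mod_iso X Y.
Proof.
move=> X0 Y0; apply/mod_isoP; exists (hzero X Y), (hzero Y X).
by split=> x; [rewrite (X0 x) | rewrite (Y0 x)].
Qed.

Lemma row0_zero : zero_module 'rV[R]_0.
Proof. exact: thinmx0. Qed.

Lemma fg_gen_by X : finitely_generated X -> exists n, gen_by n X.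
Proof. by []. Qed.

Lemma indecomposable_summand n X : gen_by n X -> ~ zero_module X ->
  exists A X', indecomposable A /\ mod_iso X (A * X')%type.
Proof.
elim: n X => [|n IHn] X gX X0; first by have := gen_by_zero gX.
have [iX|dX] := pselect (indecomposable X).
  exists X, 'rV[R]_0; split=> //; apply: mod_iso_sym.
  exact: mod_iso_prod0 row0_zero.
have [Y [Z [XYZ Y0 Z0]]] : exists Y Z,
    [/\ mod_iso X (Y * Z)%type, ~ zero_module Y & ~ zero_module Z].
  apply: contrapT => no; apply: dX; split=> // Y Z XYZ.
  apply: contrapT => /not_orP[Y0 Z0]; apply: no; by exists Y, Z.
have [|A [Y' [iA YA]]] := IHn Y _ Y0.
  by apply: gen_by_summand Z0; apply: gen_by_iso XYZ gX.
exists A, (Y' * Z)%type; split=> //.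
apply: mod_iso_trans XYZ _.
apply: mod_iso_trans (mod_iso_prod YA (mod_iso_refl Z)) _.
exact: mod_iso_prodA.
Qed.

Lemma CM_ind (T : lmodType R -> Prop) :
  (forall X Y, CM X -> CM Y -> mod_iso X Y -> T Y -> T X) ->
  (forall X, zero_module X -> T X) ->
  (forall A X, CM A -> indecomposable A -> CM X -> T X -> T (A * X)%type) ->
  forall X, CM X -> T X.
Proof.
move=> Tiso T0 Tcons X cX; have [n gX] := fg_gen_by (CM_fg cX).
elim: n X gX cX => [|n IHn] X gX cX; first by apply/T0/gen_by_zero.
have [X0|X0] := pselect (zero_module X); first exact: T0.
have [A [X' [iA XA]]] := indecomposable_summand gX X0.
have cA : CM A by apply: CM_summand cX (mod_iso_sym XA).
have XA' := mod_iso_trans XA (mod_iso_prodC A X').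
have cX' : CM X' by apply: CM_summand cX (mod_iso_sym XA').
apply: Tiso XA _ => //; first exact: CM_prod.
apply: Tcons => //; apply: IHn => //; apply: gen_by_summand iA.1.
exact: gen_by_iso XA' gX.
Qed.

(** Splitting off a nonzero summand lowers the number of generators, so n bounds the number of
    indecomposable summands. *)
Lemma finitely_many_bounded n : finite_representation_type R ->
  exists (T : finType) (L : T -> lmodType R),
    forall X, CM X -> gen_by n X -> exists t, mod_iso X (L t).
Proof.
move=> [p [L LP]]; elim: n => [|n [T [L' LP']]].
  exists unit, (fun=> 'rV[R]_0) => X cX /gen_by_zero X0; exists tt.
  exact: zero_iso row0_zero.
exists (option ('I_p + T * T)%type), (fun t => match t with
  | None => 'rV[R]_0 | Some (inl i) => L i
  | Some (inr (t1, t2)) => (L' t1 * L' t2)%type end) => X cX gX.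
have [X0|X0] := pselect (zero_module X).
  by exists None; apply: zero_iso row0_zero.
have [iX|dX] := pselect (indecomposable X).
  have [|i iP] := LP X _ iX; first exact: CM_cohen_macaulay.
  by exists (Some (inl i)).
have [Y [Z [XYZ Y0 Z0]]] : exists Y Z,
    [/\ mod_iso X (Y * Z)%type, ~ zero_module Y & ~ zero_module Z].
  apply: contrapT => no; apply: dX; split=> // Y Z XYZ.
  apply: contrapT => /not_orP[Y0 Z0]; apply: no; by exists Y, Z.
have XZY := mod_iso_trans XYZ (mod_iso_prodC Y Z).
have [||t1 YT] := LP' Y.
- exact: CM_summand cX (mod_iso_sym XYZ).
- by apply: gen_by_summand Z0; apply: gen_by_iso XYZ gX.
have [||t2 ZT] := LP' Z.
- exact: CM_summand cX (mod_iso_sym XZY).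
- by apply: gen_by_summand Y0; apply: gen_by_iso XZY gX.
exists (Some (inr (t1, t2))); apply: mod_iso_trans XYZ _.
exact: mod_iso_prod.
Qed.

End Generators.

(** * Pushouts of extensions *)

Section Pushout.
Variables (R : comNzRingType) (A P B : lmodType R).
Variables (i : {linear A -> P}) (g : {linear A -> B}).

Lemma pushout_exists : exists (D : lmodType R) (u : {linear B -> D}) (v : {linear P -> D}),
  [/\ forall x, u (g x) = v (i x),
      forall d, exists y z, d = u y + v z,
      forall y z, u y + v z = 0 -> exists x, y = g x /\ z = - i x &
      forall (X : lmodType R) (f : {linear B -> X}) (h : {linear P -> X}),
        (forall x, f (g x) = h (i x)) -> exists d : {linear D -> X},
        (forall y, d (u y) = f y) /\ (forall z, d (v z) = h z)].
Proof.
pose S := Submodule (is_sub_im (hpair g (hscale (-1) i)) (@is_subT R A)).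
pose pi := quot_map S.
have pi0 x : pi x = 0 <-> exists a, x = (g a, - i a).
  split=> [/quot_map_eq0[a _ <-]|[a ->]]; first by exists a; rewrite !hE scaleN1r.
  by apply/quot_map_eq0; exists a; rewrite // !hE scaleN1r.
have pio : onto pi by apply: quot_map_onto.
have piE y z : pi (y, z) = pi (y, 0) + pi (0, z).
  by rewrite -linearD; congr (pi (_, _)); rewrite /= ?addr0 ?add0r.
exists (quot_type S), (hcomp pi (hinl B P)), (hcomp pi (hinr B P)); split.
- move=> x; apply/subr0_eq; rewrite !hE -linearB; apply/pi0; exists x.
  by congr (_, _); rewrite /= ?subr0 ?sub0r.
- by move=> d; have [[y z] <-] := pio d; exists y, z; rewrite !hE piE.
- by move=> y z; rewrite !hE -piE => /pi0[a [-> ->]]; exists a.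
- move=> X f h fh; have [|d dP] := descend (f := hcopair f h) pio.
    by move=> x /pi0[a ->]; rewrite hE /= fh linearN subrr.
  exists d; split=> x; rewrite hcompE dP hE !hE /= linear0 ?addr0 ?add0r //.
Qed.
End Pushout.

Lemma pushout_short_exact (R : comNzRingType) (A P C B D : lmodType R)
    (i : {linear A -> P}) (p : {linear P -> C}) (g : {linear A -> B})
    (u : {linear B -> D}) (v : {linear P -> D}) :
  short_exact i p -> (forall x, u (g x) = v (i x)) ->
  (forall d, exists y z, d = u y + v z) ->
  (forall y z, u y + v z = 0 -> exists x, y = g x /\ z = - i x) ->
  (forall (X : lmodType R) (f : {linear B -> X}) (h : {linear P -> X}),
        (forall x, f (g x) = h (i x)) -> exists d : {linear D -> X},
        (forall y, d (u y) = f y) /\ (forall z, d (v z) = h z)) ->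
  exists q : {linear D -> C}, [/\ short_exact u q & forall z, q (v z) = p z].
Proof.
move=> [ii po ip] ugi gen rel ump.
have [|q [qu qv]] := ump _ (hzero B C) p.
  by move=> x; rewrite hE; apply/esym/ip; exists x.
exists q; split=> //; split.
- apply: inj_ker => y uy; have [|x [-> /esym/eqP]] := rel y 0.
    by rewrite uy linear0 addr0.
  by rewrite oppr_eq0 -(linear0 i) => /eqP/ii->; rewrite linear0.
- by move=> c; have [z <-] := po c; exists (v z).
- move=> d; split=> [|[y <-]]; last exact: qu.
  have [y [z ->]] := gen d; rewrite linearD qu qv hE add0r => /ip[x <-].
  by exists (y + g x); rewrite linearD ugi.
Qed.

Section HomNoeth.
Variable R : comNzRingType.
Hypothesis nR : noetherian_ring R.
Implicit Types A B : lmodType R.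

Fact ffun_delta_linear B n (j : 'I_n) :
  linear (fun y : B => [ffun l => if l == j then y else 0] : {ffun 'I_n -> B}).
Proof.
move=> a x y; apply/ffunP => l; rewrite !ffunE.
by case: eqP => // _; rewrite scaler0 addr0.
Qed.
Definition ffun_delta B n j := mklin (@ffun_delta_linear B n j).

Lemma ffun_sum_delta B n (x : {ffun 'I_n -> B}) : x = \sum_j ffun_delta B j (x j).
Proof.
apply/ffunP => l; rewrite sum_ffunE (bigD1 l) //= ffunE eqxx big1 ?addr0 // => j jl.
by rewrite ffunE eq_sym (negPf jl).
Qed.

Lemma fg_ffun B n : finitely_generated B -> finitely_generated {ffun 'I_n -> B}.
Proof.
move=> /fgP[s sP]; apply/fgP.
exists (flatten [seq map (ffun_delta B j) s | j : 'I_n]) => x.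
rewrite (ffun_sum_delta x); apply: sub_sum => // j _.
apply: span_sub (span_map (ffun_delta B j) (sP (x j))) => y ys.
by apply/flatten_mapP; exists j => //; rewrite mem_enum.
Qed.

Lemma fg_eq A B n (g : 'I_n -> A) (f h : {linear A -> B}) :
  (forall x, exists c : 'I_n -> R, x = \sum_i c i *: g i) ->
  (forall j, f (g j) = h (g j)) -> f =1 h.
Proof.
move=> gP fh x; have [c ->] := gP x; rewrite !linear_sum.
by apply: eq_bigr => j _; rewrite !linearZ fh.
Qed.

Fact eval_gens_linear A B n (g : 'I_n -> A) :
  linear (fun f : hom A B => [ffun j => lin_of_hom f (g j)] : {ffun 'I_n -> B}).
Proof. by move=> a f h; apply/ffunP => j; rewrite !ffunE. Qed.
Definition eval_gens A B n g := mklin (@eval_gens_linear A B n g).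

Lemma hom_noeth A B : finitely_generated A -> finitely_generated B -> noeth (hom A B).
Proof.
move=> [n [g gP]] fB; apply: (@noeth_inj _ _ _ (eval_gens B g)).
  move=> f h /ffunP fh; apply: hom_eqP; apply: fg_eq gP _ => j.
  by have := fh j; rewrite !ffunE.
by apply: noeth_fg => //; apply: fg_ffun.
Qed.
End HomNoeth.

Section HomFinite.
Variables (k : fieldType) (R : comAlgType k) (m : set R).
Hypotheses (nR : noetherian_ring R) (lR : local_ring_at m).
Hypotheses (res : residue_field_is_base m) (fR : finite_representation_type R).
Implicit Types A B C D P X Y Z : lmodType R.

Lemma hom_finite_length X Z : finitely_generated X -> finitely_generated Z ->
  loc_nil m [set 0 : Z] -> exists n, qdim [set 0 : hom X Z] n.
Proof.
move=> fX fZ nZ; apply: (loc_nil_qdim nR res) => //; first exact: hom_noeth.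
move=> r mr f; have [n nP] := loc_nil_uniform (@is_sub0 _ Z) fZ nZ mr.
by exists n; apply: hom_eqP => x; rewrite homZ; apply: nP.
Qed.

Fact precomp_linear X Y Z (f : {linear X -> Y}) :
  linear (fun h : hom Y Z => hom_of (hcomp (lin_of_hom h) f)).
Proof. by move=> a h h'; apply: hom_eqP. Qed.
Definition precomp X Y Z f := mklin (@precomp_linear X Y Z f).

Lemma precompE X Y Z (f : {linear X -> Y}) (h : hom Y Z) x :
  lin_of_hom (precomp Z f h) x = lin_of_hom h (f x).
Proof. by []. Qed.

Section Extension.
Variables (A P C B : lmodType R) (i : {linear A -> P}) (p : {linear P -> C}).
Hypotheses (sp : short_exact i p) (qP : pfg P) (fA : finitely_generated A).
Hypotheses (cC : CM C) (cB : CM B).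

(* The pushouts of [i] along the maps [r^n phi] are extensions of [C] by [B] with
   boundedly many generators, so infinitely many of them are isomorphic to one of
   them, D. If Z is a finite length quotient of B, then for large n every map B -> Z
   extends to the n-th pushout; comparing dimensions of Hom(-, Z), the same holds for
   D, so that [r^a phi] extends to P modulo every submodule of finite colength. *)
Lemma power_extends (phi : {linear A -> B}) r : m r ->
  exists a (psi : {linear P -> B}), forall x, psi (i x) = r ^+ a *: phi x.
Proof.
move=> mr; have fC := CM_fg cC; have fB := CM_fg cB.
pose push (n : nat) D (u : {linear B -> D}) (v : {linear P -> D}) :=
  [/\ forall x, u (hscale (r ^+ n) phi x) = v (i x),
      forall d, exists y z, d = u y + v z,
      forall y z, u y + v z = 0 -> exists x, y = hscale (r ^+ n) phi x /\ z = - i x &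
      forall X (f : {linear B -> X}) (h : {linear P -> X}),
        (forall x, f (hscale (r ^+ n) phi x) = h (i x)) -> exists d : {linear D -> X},
        (forall y, d (u y) = f y) /\ (forall z, d (v z) = h z)].
(* Every pushout is a quotient of B + P, which bounds the number of generators independently of the
   exponent. *)
have [g gBP] : exists g, gen_by g (B * P)%type by apply: fg_prod => //; case: qP.
have [T [L LP]] := finitely_many_bounded nR lR g fR.
have pushP n : exists t D u v, @push n D u v /\ mod_iso D (L t).
  have [D [u [v puv]]] := pushout_exists i (hscale (r ^+ n) phi).
  have [ugi gen rel ump] := puv.
  have [q [suq _]] := pushout_short_exact sp ugi gen rel ump.
  have [||t tP] := LP D; [exact: CM_ext suq cB cC| |by exists t, D, u, v].
  apply: (gen_by_onto (f := hcopair u v)) gBP => d.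
  by have [y [z ->]] := gen d; exists (y, z); rewrite hE.
have [c cP] := choice pushP.
have [t tP] : exists t, forall N, exists2 n, (N <= n)%N & c n = t.
  apply: contrapT => no.
  have /choice[N NP] : forall t, exists N, forall n, (N <= n)%N -> c n <> t.
    move=> t; apply: contrapT => no'; apply: no; exists t => N.
    apply: contrapT => no''; apply: no'; exists N => n Nn cn.
    by apply: no''; exists n.
  by apply: (NP (c (\max_t N t)) (\max_t N t)) => //; apply: leq_bigmax.
have [a _ ca] := tP 0%N.
exists a; have [D [u [v [puv DL]]]] := cP a; have [ugi gen rel ump] := puv.
have ext_mod (E : submodule B) : loc_nil m E ->
    exists psi : {linear P -> B}, forall x, E (r ^+ a *: phi x - psi (i x)).
  move=> lE; pose Z := quot_type E; pose pi : {linear B -> Z} := quot_map E.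
  have pi0 y : pi y = 0 <-> E y by apply: quot_map_eq0.
  have pio : onto pi by apply: quot_map_onto.
  have fZ : finitely_generated Z by apply: fg_onto pio fB.
  have lZ : loc_nil m [set 0 : Z].
    move=> s ms z; have [y <-] := pio z; have [n nE] := lE s ms y; exists n.
    by have := (pi0 _).2 nE; rewrite linearZ.
  have onto_count n D' (u' : {linear B -> D'}) v' : @push n D' u' v' ->
      exists dC dB, [/\ qdim [set 0 : hom C Z] dC, qdim [set 0 : hom B Z] dB &
      forall d, qdim [set 0 : hom D' Z] d -> onto (precomp Z u') <-> d = (dC + dB)%N].
    move=> [ugi' gen' rel' ump'].
    have [q [suq _]] := pushout_short_exact sp ugi' gen' rel' ump'.
    have [dC dCP] := hom_finite_length fC fZ lZ.
    have [dB dBP] := hom_finite_length fB fZ lZ.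
    exists dC, dB; split=> // d dP; have [_ qo uq] := suq.
    apply: (qdim_onto (linear_klinear (precomp Z q)) (linear_klinear (precomp Z u'))
      dCP dP dBP).
      move=> f f0; apply: hom_eqP => x; have [y <-] := qo x.
      by rewrite -precompE f0.
    move=> f; split=> [f0|[h ->]]; last first.
      apply: hom_eqP => y; rewrite !precompE.
      have -> : q (u' y) = 0 by apply/uq; exists y.
      by rewrite linear0.
    have [|h hP] := descend (f := lin_of_hom f) qo.
      by move=> x /uq[y <-]; rewrite -precompE f0.
    by exists (hom_of h); apply: hom_eqP => x; rewrite precompE -hP.
  have [dC [dB [dCP dBP DP]]] := onto_count _ _ _ _ puv.
  (* [r ^+ N] kills Z, so for b at least N any map B -> Z vanishes on [r ^+ b *: phi] and extends to
     the b-th pushout by 0 on P. *)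
  have [N NP] := loc_nil_uniform (@is_sub0 _ Z) fZ lZ mr.
  have [b Nb cb] := tP N.
  have [D' [u' [v' [puv' DL']]]] := cP b.
  have [dC' [dB' [dCP' dBP' DP']]] := onto_count _ _ _ _ puv'.
  have [ugi' gen' rel' ump'] := puv'.
  have fgD D0 (u0 : {linear B -> D0}) (v0 : {linear P -> D0}) :
      (forall d, exists y z, d = u0 y + v0 z) -> finitely_generated D0.
    move=> gen0; apply: (fg_onto (f := hcopair u0 v0)) (fg_prod fB qP.2) => d.
    by have [y [z ->]] := gen0 d; exists (y, z); rewrite hE.
  have [d dP] := hom_finite_length (fgD _ _ _ gen') fZ lZ.
  have onto' : onto (precomp Z u').
    move=> w; have [|e [eu _]] := ump' _ (lin_of_hom w) (hzero P Z).
      move=> x; rewrite !hE linearZ; have := NP (lin_of_hom w (phi x)) => /= rN0.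
      by rewrite -(subnK Nb) exprD -scalerA rN0 scaler0.
    by exists (hom_of e); apply: hom_eqP => y; rewrite precompE -eu.
  have /(DP' _ dP) dE := onto'.
  have DD : mod_iso D' D by apply: mod_iso_trans DL' (mod_iso_sym _); rewrite cb -ca.
  have dPD : qdim [set 0 : hom D Z] d.
    have /mod_isoP[f [f' [fK f'K]]] := DD.
    apply: (qdim_transfer (rel := fun x y => y = precomp Z f' x)) dP => //.
    - by move=> x; exists (precomp Z f' x).
    - move=> y; exists (precomp Z f y); apply: hom_eqP => x.
      by rewrite !precompE f'K.
    - by move=> e x x' y y' -> ->; rewrite linear_klinear.
    - move=> x y ->; split=> [->|x0]; first exact: (linear0 (precomp Z f')).
      by apply: hom_eqP => z; rewrite -[z in LHS]fK -(precompE f' x) [precomp _ _ _]x0.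
  have /(DP _ dPD) ontoD : d = (dC + dB)%N.
    by rewrite dE (qdim_unique dCP' dCP) (qdim_unique dBP' dBP).
  (* Extend the projection B -> Z to D, restrict it to P and lift the result to B by
     projectivity. *)
  have [w wP] := ontoD (hom_of pi).
  have [psi psiP] := qP.1 _ _ pi (hcomp (lin_of_hom w) v) pio.
  exists psi => x; apply/pi0; rewrite linearB psiP hcompE -ugi -precompE wP hscaleE.
  exact: subrr.
have [n [x xP]] := fA.
(* Evaluation at generators turns the maps that extend to P into a submodule of B^n. If
   [r ^+ a *: phi] were outside it, [krull_separation] would keep it outside some larger submodule
   of finite colength, against [ext_mod]. *)
pose S := eval_gens B x @` [set f | exists psi : {linear P -> B}, forall z, lin_of_hom f z = psi (i z)].
have sS : is_sub S.
  apply: is_sub_im; split.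
  - by exists (hzero _ _).
  - by move=> f h [f' fP] [h' hP]; exists (hadd f' h') => z; rewrite homD fP hP.
  - by move=> s f [f' fP]; exists (hscale s f') => z; rewrite homZ fP.
pose y := eval_gens B x (r ^+ a *: hom_of phi).
have [[f [psi psiP] /ffunP fy]|Sy] := pselect (S y).
  exists psi => z; rewrite -psiP.
  have : lin_of_hom f =1 hscale (r ^+ a) phi.
    by apply: (fg_eq xP) => j; have := fy j; rewrite !ffunE => ->.
  exact.
have nU : noeth {ffun 'I_n -> B} by apply: noeth_fg => //; apply: fg_ffun.
have [E [sE SE Ey lE]] := krull_separation nR lR nU sS Sy.
(* The elements of B whose copies in every coordinate lie in E; this submodule of B inherits finite
   colength from E. *)
have sE0 : is_sub [set z | forall j, E (ffun_delta B j z)].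
  split=> [j|z w Ez Ew j|s z Ez j]; rewrite ?linear0 ?linearD ?linearZ.
  - exact: sub0.
  - by apply: (subD sE).
  - by apply: subZ sE _ _ _; exact: Ez.
have [|psi psiP] := ext_mod (Submodule sE0).
  move=> s ms z; have [N NP] := loc_nil_uniform sE (fg_ffun n fB) lE ms.
  by exists N => j; have := NP (ffun_delta B j z); rewrite -linearZ.
case: Ey; rewrite -(subrK (eval_gens B x (hom_of (hcomp psi i))) y).
apply: subD => //; last first.
  by apply: SE; exists (hom_of (hcomp psi i)) => //=; exists psi.
rewrite -linearB (ffun_sum_delta (eval_gens _ _ _)); apply: sub_sum => // j _.
by rewrite ffunE homB homZ; apply: psiP.
Qed.
End Extension.

(** A power of r times the syzygy of f extends over P, hence is stably zero; by faithfulness the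
    same power kills f stably. So stable Hom has finite length. *)
Lemma stable_hom_finite X Y : CM X -> CM Y -> exists n, qdim (free_hom X Y) n.
Proof.
move=> cX cY; have fX := CM_fg cX; have fY := CM_fg cY.
apply: (loc_nil_qdim nR res); [exact: hom_noeth | exact: is_sub_free_hom |].
move=> r mr f.
have [_ [K [P [i [p [qP sp ei cK]]]]]] := CM_closed cX.
have [_ [L [Q [j [q [qQ sq ej cL]]]]]] := CM_closed cY.
have [f' ff'] := omega_total sp sq qP (lin_of_hom f).
have [a [psi psiP]] := power_extends sp qP (CM_fg cK) cX cL f' mr.
exists a; apply/(omega_free sp sq qP qQ ei (CM_fg cL) (f' := fun x => r ^+ a *: f' x)).
  exact: omegaZ ff'.
by apply: (factors_pfg (a := i) (b := psi)) qP _ => x; rewrite psiP.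
Qed.
End HomFinite.

(** * Idempotents over a complete local ring *)

Section Complete.
Variables (R : comNzRingType) (m : set R).
Hypotheses (nR : noetherian_ring R) (lR : local_ring_at m) (cR : adically_complete m).
Implicit Types A U V : lmodType R.

Local Notation I := (ideal_pow m).

Lemma is_ideal_pow n : is_ideal (I n).
Proof.
case: n => [|n] //; have [_ _ mM] := max_ideal lR.
(* The sums of products that define the power form the submodule of R generated by the products. *)
pose Q : set R := [set z | exists a b, [/\ m a, I n b & z = a * b]].
have -> : I n.+1 = imod Q (R^o : lmodType R); last by case: (is_sub_imod Q (R^o : lmodType R)).
apply/seteqP; split=> x [p [c [d]]].
  move=> [mc Id ->]; exists p, (fun i => c i * d i), (fun=> 1); split.
    by move=> i; exists (c i), (d i); split=> //; exact: Id.
  by apply: eq_bigr => i _; rewrite -[_ *: _]/(_ * 1) mulr1.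
move=> [/choice[a /choice[b abP]] ->]; exists p, (fun i => d i * a i), b; split=> [i|i|].
- by apply: mM; have [] := abP i.
- by have [] := abP i.
- by apply: eq_bigr => i _; have [_ _ ->] := abP i; rewrite -[_ *: _]/(_ * _) mulrC mulrA.
Qed.

Lemma ideal_powS n a b : m a -> I n b -> I n.+1 (a * b).
Proof.
move=> ma Ib; exists 1%N, (fun=> a), (fun=> b); split=> //.
by rewrite big_ord1.
Qed.

Lemma ideal_pow_sub n : I n.+1 `<=` I n.
Proof.
move=> x [p [a [b [ma Ib ->]]]]; have [I0 ID IM] := is_ideal_pow n.
by apply: (big_ind (I n)) => // i _; apply: IM; exact: Ib.
Qed.

Lemma imod_map (J : set R) U V (f : {linear U -> V}) x : imod J U x -> imod J V (f x).
Proof.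
move: x; apply: imod_min; first exact: is_sub_ker.
by move=> c x Jc /=; rewrite linearZ; apply: imod_in.
Qed.

Lemma imod_subset (J K : set R) U : J `<=` K -> imod J U `<=` imod K U.
Proof. by move=> JK; apply: imod_min => // c x /JK; apply: imod_in. Qed.

Lemma imod_pow1 U : imod (I 1) U `<=` imod m U.
Proof.
apply: imod_subset => _ [p [a [b [ma _ ->]]]].
have [I0 ID IM] := max_ideal lR.
by apply: (big_ind m) => // i _; rewrite mulrC; apply: IM.
Qed.

Lemma imod_powS n U (h : {linear U -> U}) x : (forall x, imod m U (h x)) ->
  imod (I n) U x -> imod (I n.+1) U (h x).
Proof.
move=> hm; move: x; apply: imod_min; first exact: is_sub_ker.
move=> c x Ic /=; rewrite linearZ.
have : imod m U `<=` [set y | imod (I n.+1) U (c *: y)].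
  apply: imod_min; first exact: (is_sub_ker (hscale c (hid U))).
  move=> a y ma /=; rewrite scalerA mulrC; apply: imod_in; exact: ideal_powS.
by apply; apply: hm.
Qed.

Lemma imod_gens n (J : set R) U (g : 'I_n -> U) x : is_ideal J ->
  (forall x, exists c : 'I_n -> R, x = \sum_i c i *: g i) ->
  imod J U x -> exists c : 'I_n -> R, (forall i, J (c i)) /\ x = \sum_i c i *: g i.
Proof.
move=> [J0 JD JM] gP; move: x; apply: imod_min.
  split; first by exists (fun=> 0); split=> //; rewrite big1 // => i _; rewrite scale0r.
  - move=> _ _ [c [cJ ->]] [d [dJ ->]]; exists (fun i => c i + d i); split.
      by move=> i; apply: JD.
    by rewrite -big_split; apply: eq_bigr => i _; rewrite scalerDl.
  - move=> a _ [c [cJ ->]]; exists (fun i => a * c i); split; first by move=> i; apply: JM.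
    by rewrite scaler_sumr; apply: eq_bigr => i _; rewrite scalerA.
move=> a x Ja; have [c ->] := gP x; exists (fun i => a * c i); split.
  by move=> i; rewrite mulrC; apply: JM.
by rewrite scaler_sumr; apply: eq_bigr => i _; rewrite scalerA.
Qed.

(** A nonzero x avoids some E of finite colength, and dévissage along A / E shows that E contains
    m^n A for some n. *)
Lemma adic_separated A x : finitely_generated A -> (forall n, imod (I n) A x) -> x = 0.
Proof.
move=> fA xI; apply: contrapT => x0.
have nA := noeth_fg nR fA.
have [E [sE _ Ex lE]] := krull_separation nR lR nA (@is_sub0 _ A) x0.
pose Pi (T : set A) := exists n, forall a y, I n a -> T y -> E (a *: y).
have [n nP] : Pi setT.
  apply: (devissage nR nA sE lE).
    by exists 0%N => a y _; apply: subZ.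
  move=> T z sT ET [n nP] mz; exists n.+1 => _ y [p [a [b [ma Ib ->]]]] [c yc].
  rewrite scaler_suml; apply: sub_sum => // i _.
  rewrite mulrC -scalerA; apply: nP; first exact: Ib.
  rewrite -(subrK (c *: z) y) scalerDr; apply: subD => //; first exact: subZ.
  by rewrite scalerA mulrC -scalerA; apply: subZ => //; apply: mz.
apply: Ex; move: (xI n); apply: imod_min => // c y Ic; exact: nP.
Qed.

(** Write the increments in terms of generators with coefficients in m^n and sum them coordinatewise
    in the complete ring. *)
Lemma adic_limit A (u : nat -> A) : finitely_generated A ->
  (forall n, imod (I n) A (u n.+1 - u n)) -> exists x, forall n, imod (I n) A (x - u n).
Proof.
move=> [q [g gP]] uI.
have /choice[d dP] n := imod_gens (is_ideal_pow n) gP (uI n).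
have [c cP] := gP (u 0%N).
pose s n j := c j + \sum_(l < n) d l j.
have us n : u n = \sum_j s n j *: g j.
  elim: n => [|n IHn].
    by rewrite cP; apply: eq_bigr => j _; rewrite /s big_ord0 addr0.
  rewrite -(subrK (u n) (u n.+1)); have [_ ->] := dP n; rewrite IHn -big_split.
  apply: eq_bigr => j _; rewrite /= -scalerDl; congr (_ *: _).
  by rewrite /s big_ord_recr /= [LHS]addrC -addrA.
have lim j : exists x, forall n, I n (x - s n j).
  have [|x [xP _]] := cR (u := fun n => s n j).
    by move=> n; rewrite /s big_ord_recr /= addrA [_ + d n j]addrC addrK; have [] := dP n.
  by exists x.
have [x xP] := choice lim; exists (\sum_j x j *: g j) => n.
rewrite us -sumrB; apply: sub_sum => // j _; rewrite -scalerBl.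
by apply: imod_in.
Qed.

Section Evaluation.
Variables (A : lmodType R) (a : {linear A -> A}).

(** Newton's iteration is run in the commutative ring R[X], where its identities are ring
    identities, and then evaluated at the endomorphism. *)
Definition poly_act (p : {poly R}) (x : A) : A := \sum_(i < size p) p`_i *: iter i a x.

Lemma poly_act_widen (p : {poly R}) x n : (size p <= n)%N ->
  poly_act p x = \sum_(i < n) p`_i *: iter i a x.
Proof.
move=> pn; rewrite /poly_act (big_ord_widen _ (fun i => p`_i *: iter i a x) pn) big_mkcond.
apply: eq_bigr => i _; case: ltnP => // ip.
by rewrite nth_default // scale0r.
Qed.

Lemma poly_actD p q x : poly_act (p + q) x = poly_act p x + poly_act q x.
Proof.
pose n := maxn (size p) (size q).
rewrite !(@poly_act_widen _ x n) ?leq_maxl ?leq_maxr ?size_polyD // -big_split.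
by apply: eq_bigr => i _; rewrite coefD scalerDl.
Qed.

Lemma poly_actZ c p x : poly_act (c *: p) x = c *: poly_act p x.
Proof.
rewrite (@poly_act_widen _ x (size p)) ?size_scale_leq // scaler_sumr.
by apply: eq_bigr => i _; rewrite coefZ scalerA.
Qed.

Lemma poly_actC c x : poly_act c%:P x = c *: x.
Proof. by rewrite (@poly_act_widen _ x 1) ?size_polyC_leq1 // big_ord1 coefC. Qed.

Lemma poly_actMX p x : poly_act (p * 'X) x = a (poly_act p x).
Proof.
rewrite (@poly_act_widen _ x (size p).+1).
  rewrite big_ord_recl coefMX /= scale0r add0r linear_sum.
  by apply: eq_bigr => i _; rewrite coefMX /= linearZ.
by have [->|p0] := eqVneq p 0; rewrite ?mul0r ?size_poly0 // size_mulX.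
Qed.

Lemma poly_act_linear p : linear (poly_act p).
Proof.
move=> c x y; rewrite scaler_sumr -big_split; apply: eq_bigr => i _ /=.
have -> : iter i a (c *: x + y) = c *: iter i a x + iter i a y.
  by elim: (nat_of_ord i) => //= n ->; rewrite linearP.
by rewrite scalerDr !scalerA mulrC.
Qed.
Definition poly_lin p : {linear A -> A} := mklin (poly_act_linear p).

Lemma poly_actM p q x : poly_act (p * q) x = poly_act p (poly_act q x).
Proof.
elim/poly_ind: p => [|p c IHp].
  by rewrite mul0r /poly_act size_poly0 !big_ord0.
rewrite mulrDl mul_polyC !poly_actD poly_actZ poly_actC mulrAC !poly_actMX IHp.
by [].
Qed.
End Evaluation.

(* Newton's iteration [p |-> 3 p^2 - 2 p^3] squares the defect [p^2 - p] up to a factor. *)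
Lemma lift_idempotent A (e0 : {linear A -> A}) : finitely_generated A ->
  (forall x, imod m A (e0 (e0 x) - e0 x)) ->
  exists e : {linear A -> A}, (forall x, e (e x) = e x) /\ forall x, imod m A (e x - e0 x).
Proof.
move=> fA e0P.
pose newton (p : {poly R}) := p ^+ 2 *+ 3 - p ^+ 3 *+ 2.
pose p n := iter n newton 'X; pose h n := p n ^+ 2 - p n.
pose ev := poly_act e0.
have pS n : p n.+1 = p n + h n * (1 - p n *+ 2) by rewrite /p iterS -/(p n) /newton /h; ring.
have hS n : h n.+1 = h n * (h n * (h n *+ 4 - 3%:R)).
  by rewrite /h /p iterS -/(p n) /newton; ring.
have evX x : ev 'X x = e0 x.
  by rewrite /ev -[X in poly_act _ X]mul1r poly_actMX -[1]polyC1 poly_actC scale1r.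
have evB q r x : ev (q - r) x = ev q x - ev r x.
  have -> : q - r = q + (-1 : R) *: r by rewrite scaleN1r.
  by rewrite /ev poly_actD poly_actZ scaleN1r.
have h0 x : imod m A (ev (h 0%N) x).
  by rewrite /h evB expr2 /ev poly_actM -!/(ev _ _) !evX.
have hm n x : imod m A (ev (h n) x).
  elim: n x => // n IHn x; rewrite hS /ev poly_actM; exact: IHn.
(* The quadratic factor gives far more, but one additional power of m per iteration suffices for
   convergence. *)
have hI n x : imod (I n.+1) A (ev (h n) x).
  elim: n x => [|n IHn] x.
    apply: imod_subset (h0 x) => c mc; rewrite -[c]mulr1; exact: ideal_powS.
  rewrite hS /ev poly_actM poly_actM.
  by apply: (imod_powS (h := poly_lin e0 (h n))) => //; apply: hm.
have pI n x : imod (I n.+1) A (ev (p n.+1) x - ev (p n) x).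
  rewrite -evB pS addrC addKr /ev poly_actM; exact: hI.
have pI' n x : imod (I n) A (ev (p n.+1) x - ev (p n) x).
  by apply: imod_subset (pI n x); apply: ideal_pow_sub.
have [||y yP|e eP] := @linear_relation _ A A (fun x y => forall n, imod (I n) A (y - ev (p n) x)).
- by move=> x; apply: (adic_limit (u := fun n => ev (p n) x)).
- move=> c x x' y y' xy xy' n; rewrite /ev poly_act_linear opprD addrACA -scalerBr.
  by apply: subD => //; apply: subZ.
- apply: adic_separated => // n; have := yP n.
  by rewrite -[ev _ _]/(poly_lin e0 (p n) 0) linear0 subr0.
exists e; split=> x; last first.
  apply: imod_pow1.
  have -> : e x - e0 x = (e x - ev (p 1%N) x) + (ev (p 1%N) x - ev (p 0%N) x).
    by rewrite addrA subrK /p /= evX.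
  by apply: subD.
apply/eqP; rewrite -subr_eq0; apply/eqP; apply: adic_separated => // n.
(* Replace [e] by its n-th approximation twice; the remaining error is the defect [h n]. Every term
   lies in m^n A. *)
have -> : e (e x) - e x = (e (e x) - ev (p n) (e x)) + ev (p n) (e x - ev (p n) x)
    + (ev (h n) x - (e x - ev (p n) x)).
  have -> : ev (h n) x = ev (p n) (ev (p n) x) - ev (p n) x.
    by rewrite /h evB expr2 {1}/ev poly_actM.
  have -> : ev (p n) (e x - ev (p n) x) = ev (p n) (e x) - ev (p n) (ev (p n) x).
    exact: (linearB (poly_lin e0 (p n))).
  by rewrite opprB !addrA !subrK.
apply: subD => //; first apply: subD => //.
  by apply: (imod_map (poly_lin e0 (p n))).
by apply: subB => //; apply: imod_subset (hI n x); apply: ideal_pow_sub.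
Qed.

Lemma idempotent_indecomposable A (e : {linear A -> A}) : indecomposable A ->
  (forall x, e (e x) = e x) -> (forall x, e x = 0) \/ (forall x, e x = x).
Proof.
move=> [_ iA] eP; pose f := hsub (hid A) e.
have [r [rP _]] := limage_onto e; have [s [sP _]] := limage_onto f.
have [|z|z] := iA (limage e) (limage f).
- apply: (@mod_iso_bij _ _ _ (hpair r s)) => [x|[[y ry] [z rz]]].
    rewrite hE => -[/(congr1 val) rx /(congr1 val)].
    by rewrite sP !hE -rP rx /= subr0.
  have [y' _ yE] := asboolP _ ry; have [z' _ zE] := asboolP _ rz.
  exists (y + z); rewrite hE; congr (_, _); apply: val_inj.
    by rewrite rP -[RHS]/y -yE -zE !hE linearD linearB !eP subrr addr0.
  by rewrite sP -[RHS]/z -yE -zE !hE linearD linearB !eP subrr addr0 addrAC subrr add0r.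
- by left=> x; rewrite -rP (z (r x)).
- by right=> x; apply/esym/subr0_eq; have := sP x; rewrite (z (s x)) !hE => <-.
Qed.

(** The kernels of the iterates become stationary at some n. An x in the kernel of f is the n-th
    image of some y, and y lies in the kernel of iterate n + 1, hence of iterate n. *)
Lemma noeth_endo_inj A (f : {linear A -> A}) : noeth A -> onto f -> injective f.
Proof.
move=> nA fo; apply: inj_ker => x fx.
have iter_lin n : exists g : {linear A -> A}, forall x, g x = iter n f x.
  elim: n => [|n [g gP]]; first by exists (hid A).
  by exists (hcomp f g) => y; rewrite hE gP.
have [||_ [n ->] nmax] := @noeth_max _ A (fun T => exists n, T = [set y | iter n f y = 0]) nA.
- by exists [set y | iter 0 f y = 0], 0%N.
- move=> _ [n ->]; have [g gP] := iter_lin n.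
  have -> : [set y | iter n f y = 0] = [set y | [set 0] (g y)].
    by apply/seteqP; split=> y /=; rewrite gP.
  exact: is_sub_ker.
have [y yx] : exists y, iter n f y = x.
  elim: {nmax} n x {fx} => [|n IHn] x; first by exists x.
  by have [y <-] := fo x; have [z <-] := IHn y; exists z.
rewrite -yx; apply: (nmax [set y | iter n.+1 f y = 0]) => /=.
- by exists n.+1.
- by move=> z /= ->; rewrite linear0.
- by rewrite yx.
Qed.

Lemma regular_pfg : pfg (R^o : lmodType R).
Proof.
split.
  move=> U V p f po; have [u uP] := po (f 1).
  have lg : linear (fun r : R^o => (r : R) *: u).
    by move=> c x y; rewrite scalerDl scalerA.
  exists (mklin lg) => x; rewrite -[mklin lg x]/((x : R) *: u) linearZ uP -linearZ.
  by congr (f _); apply: mulr1.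
apply/fgP; exists [:: 1] => x /=; exists x.
by rewrite -[_ *: _]/(x * 1) mulr1 subrr.
Qed.

(** The stable endomorphism ring is nonzero and has no idempotents besides 0 and 1; once it is
    finite dimensional over k, this says that it is local. *)
Definition stable_local A : Prop :=
  ~ factors_free (id : A -> A) /\
  forall e : {linear A -> A}, stable_eq (e \o e) e -> factors_free e \/ stable_eq e id.

Lemma factors_id_pfg A : finitely_generated A -> factors_free (id : A -> A) -> pfg A.
Proof.
move=> fA id0; split=> // U V p f po.
have [n [q qo]] := fg_row fA; have [h hP] := factors_lift id0 qo.
have [g gP] := (row_pfg R n).1 _ _ p (hcomp f q) po.
by exists (hcomp g h) => x; rewrite hE gP hE -hP.
Qed.

(** Lift f to a free cover. A unit among the coordinates of [h x] would give [phi : A -> R] and [s]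
    with [phi s = 1], splitting R off A, so A would be R. *)
Lemma indecomposable_free_in_max A (f : A -> A) : finitely_generated A -> indecomposable A ->
  ~ pfg A -> factors_free f -> forall x, imod m A (f x).
Proof.
move=> fA iA nA ff x; have [n [q qo]] := fg_row fA; have [h ->] := factors_lift ff qo.
rewrite (row_sum_delta (h x)) linear_sum; apply: sub_sum => // j _.
rewrite linearZ; apply: imod_in; apply: contrapT => mh; apply: nA.
have [b bP] := unit_notin nR lR mh.
have lphi : linear (fun y : A => h y 0 j : R^o) by move=> c y z; rewrite linearP !mxE.
pose phi : {linear A -> R^o} := mklin lphi; pose s := b *: x.
have phis : phi s = 1 by rewrite /s linearZ; exact: bP.
have le : linear (fun y => (phi y : R) *: s).
  move=> c y z; have -> : phi (c *: y + z) = c * phi y + phi z by apply: linearP.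
  by rewrite scalerDl -scalerA.
have [y|e0|e1] := idempotent_indecomposable (e := mklin le) iA.
- have mE z : mklin le z = (phi z : R) *: s by [].
  have -> : mklin le (mklin le y) = (phi y * phi s) *: s.
    rewrite !mE; congr (_ *: s).
    have -> : phi (phi y *: s) = phi y *: phi s by rewrite linearZ.
    by [].
  by rewrite phis mulr1.
- have := e0 s; rewrite -[mklin le s]/((phi s : R) *: s) phis scale1r => s0.
  by move: phis; rewrite s0 linear0 => /eqP; rewrite eq_sym oner_eq0.
- apply: factors_id_pfg => //.
  have lb : linear (fun r : R^o => (r : R) *: s) by move=> c y z; rewrite scalerDl scalerA.
  by apply: (factors_pfg (a := phi) (b := mklin lb)) regular_pfg _ => y; rewrite -[LHS]e1.
Qed.

(** By Nakayama 1 - f is onto, hence bijective. As f (1 - f) is stably zero, so is f. *)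
Lemma small_idempotent A (f : {linear A -> A}) : finitely_generated A ->
  (forall x, imod m A (f x)) -> stable_eq (f \o f) f -> factors_free f.
Proof.
move=> fA fm ff; pose g := hsub (hid A) f.
have go : onto g.
  move=> y; have := @nakayama_local _ _ nR lR A (range g) fA (is_sub_im g (@is_subT _ A)).
  case/(_ _ y)=> [x|x _ <-]; last by exists x.
  by exists (g x); [exists x | rewrite !hE opprB addrC subrK].
have gi := noeth_endo_inj (noeth_fg nR fA) go.
have [g' g'P] : exists g' : {linear A -> A}, forall x, g (g' x) = x.
  have [|g' g'P] := corestrict (f := hid A) gi; last by exists g'.
  by move=> x; have [y yx] := go x; exists y.
have := factorsN fA (factors_compl g' ff); apply: factors_eq => x.
by apply: gi; rewrite linearN g'P !hE opprB.
Qed.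

(** The defect of a stable idempotent [e0] factors through a free module, so its image lies in mA
    and [e0] lifts to a true idempotent, 0 or 1. Then [e0] or [1 - e0] is a small stable
    idempotent. *)
Lemma indecomposable_stable_local A : finitely_generated A -> indecomposable A -> ~ pfg A ->
  stable_local A.
Proof.
move=> fA iA nA; split=> [id0|e0 e0P]; first by apply: nA; apply: factors_id_pfg.
have [|e [eP ee0]] := lift_idempotent (e0 := e0) fA.
  by move=> x; apply: (indecomposable_free_in_max fA iA nA e0P).
have [e00|e1] := idempotent_indecomposable iA eP.
  left; apply: small_idempotent => // x.
  by have := ee0 x; rewrite e00 sub0r => /(subN (is_sub_imod m A)); rewrite opprK.
right; pose f := hsub (hid A) e0.
have f0 : factors_free f.
  apply: small_idempotent => // [x|].
    by rewrite !hE -[X in X - _]e1.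
  apply: factors_eq e0P => x; have fE y : f y = y - e0 y by [].
  rewrite -[(f \o f) x]/(f (f x)) -[(e0 \o e0) x]/(e0 (e0 x)) !fE linearB.
  by rewrite [RHS]addrAC subrr sub0r opprB.
by apply: factors_eq (factorsN fA f0) => x; rewrite !hE opprB.
Qed.

End Complete.

(** * Stably local modules *)

Section Fitting.
Variables (k : closedFieldType) (n : nat).
Implicit Types M S : 'M[k]_n.+1.

Lemma eigen_pow M (v : 'rV[k]_n.+1) a j : v *m M = a *: v -> v *m (M ^+ j) = a ^+ j *: v.
Proof.
move=> vM; elim: j => [|j IHj]; first by rewrite expr0 scale1r mulmx1.
by rewrite exprSr mulmxA IHj -scalemxAl vM scalerA -exprSr.
Qed.

Lemma nilpotent_trace S j : S ^+ j = 0 -> \tr S = 0.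
Proof.
move=> S0; have [r rE] := closed_field_poly_normal (char_poly S).
rewrite (monicP (char_poly_monic S)) scale1r in rE.
have r0 z : z \in r -> z = 0.
  move=> zr; have : eigenvalue S z by rewrite eigenvalue_root_char rE root_prod_XsubC.
  case/eigenvalueP => v vS v0; have := eigen_pow j vS.
  rewrite S0 mulmx0 => /esym/eqP; rewrite scaler_eq0 (negPf v0) orbF expf_eq0.
  by case/andP=> _ /eqP.
have cE : char_poly S = 'X^(size r).
  rewrite rE big_seq (eq_bigr (fun=> 'X)) => [|z /r0->]; last by rewrite subr0.
  by rewrite -big_seq big_const_seq count_predT iter_mulr_1.
have sr : size r = n.+1 by apply: succn_inj; rewrite -(size_char_poly S) cE size_polyXn.
have := @char_poly_trace _ _ S (ltn0Sn n); rewrite cE sr coefXn /= ltn_eqF //.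
by move/esym/eqP; rewrite oppr_eq0 => /eqP.
Qed.

(** [horner_mx M q] is the projection onto the generalised eigenspace of an eigenvalue a. Being a
    polynomial in M, it can be realised by an endomorphism when M is. *)
Lemma fitting M : exists a (q : {poly k}) j,
  [/\ horner_mx M q * horner_mx M q = horner_mx M q, horner_mx M q != 0
    & horner_mx M q = 1 -> (M - a%:M) ^+ j = 0].
Proof.
have [a ra] : exists a, root (char_poly M) a.
  by apply/closed_rootP; rewrite size_char_poly.
have c0 : char_poly M != 0 by apply/monic_neq0/char_poly_monic.
have [j [q]] := multiplicity_XsubC (char_poly M) a.
rewrite c0 /= => rq cE.
have j0 : (0 < j)%N.
  by case: j cE => // cE; move: ra; rewrite cE expr0 mulr1 (negPf rq).
have cop : coprimep q (('X - a%:P) ^+ j).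
  by rewrite coprimep_expr // coprimep_XsubC.
have /Bezout_eq1_coprimepP[[u v] /= uvE] := cop.
have ch : horner_mx M (q * ('X - a%:P) ^+ j) = 0 by rewrite -cE Cayley_Hamilton.
have hXa : horner_mx M (('X - a%:P) ^+ j) = (M - a%:M) ^+ j.
  by rewrite rmorphXn rmorphB /= horner_mx_X horner_mx_C.
have uq : u * q = 1 - v * ('X - a%:P) ^+ j by rewrite -uvE addrK.
exists a, (u * q), j; split.
- rewrite -rmorphM {2}uq mulrBr mulr1 rmorphB /=.
  have -> : u * q * (v * ('X - a%:P) ^+ j) = u * v * (q * ('X - a%:P) ^+ j) by ring.
  by rewrite [horner_mx M (u * v * _)]rmorphM /= ch mulr0 subr0.
- apply/eqP => e0.
  have vX : horner_mx M v * (M - a%:M) ^+ j = 1.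
    by rewrite -hXa -rmorphM -[v * _](subKr 1) -uq rmorphB /= e0 subr0 rmorph1.
  have := ra; rewrite -eigenvalue_root_char => /eigenvalueP[w wM /eqP[]].
  have wX : w *m (M - a%:M) ^+ j = 0.
    rewrite (@eigen_pow _ _ 0) ?expr0n ?gtn_eqF ?scale0r //.
    by rewrite mulmxBr wM mul_mx_scalar subrr.
  have vX' : (M - a%:M) ^+ j * horner_mx M v = 1 by apply: mulmx1C.
  by rewrite -[w]mulmx1 -[1%:M]vX' mulmxA wX mul0mx.
- move=> e1; rewrite -hXa -[RHS](mulr0 (horner_mx M u)) -ch.
  by rewrite -rmorphM /= mulrA rmorphM /= e1 mul1r.
Qed.
End Fitting.

Section Character.
Variables (k : closedFieldType) (char_k : [pchar k] =i pred0).
Variables (R : comAlgType k).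
Implicit Types A M N X : lmodType R.

(* [tau] stands in for the residue map of the local ring of stable endomorphisms of A.
   A trace is linear without knowing that this ring is local, and characteristic 0 makes
   it nonzero on units. *)
Definition trace_form A (tau : {linear A -> A} -> k) : Prop :=
  [/\ forall c (a b d : {linear A -> A}), (forall x, d x = kscale c (a x) + b x) -> tau d = c * tau a + tau b,
      forall a : {linear A -> A}, factors_free a -> tau a = 0,
      tau (hid A) != 0 &
      forall a, tau a != 0 -> exists b, stable_eq (hcomp b a) (hid A)].

Lemma trace_form_exists A n : finitely_generated A -> stable_local A -> qdim (free_hom A A) n ->
  exists tau, @trace_form A tau.
Proof.
move=> fA [id0 idem] [f [fl fo fF]].
have fF' (a : {linear A -> A}) : f (hom_of a) = 0 <-> factors_free a by apply: fF.
have postl (a : {linear A -> A}) :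
    linear (fun h : hom A A => hom_of (hcomp a (lin_of_hom h))).
  by move=> c g h; apply: hom_eqP => x; rewrite lin_of_homK !hE linearP.
(* [T a] is the matrix of left multiplication by a on the stable endomorphism ring; row vectors make
   T reverse products. *)
have /choice[T TP] (a : {linear A -> A}) : exists T : 'M_n, forall h : {linear A -> A},
    f (hom_of (hcomp a h)) = f (hom_of h) *m T.
  have [h /fF h0|T TP] := kform_mx fl fo fl (linear_klinear (mklin (postl a))).
    by apply/fF; apply: factors_eq (factors_compl a h0).
  by exists T => h; rewrite -TP; congr f; apply: hom_eqP.
have T_unique (a : {linear A -> A}) (B : 'M_n) :
    (forall h : {linear A -> A}, f (hom_of (hcomp a h)) = f (hom_of h) *m B) -> T a = B.
  move=> aB; apply/row_matrixP => i; rewrite !rowE; have [h <-] := fo (delta_mx 0 i).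
  by rewrite -[h]hom_ofK -TP aB.
have T_lin c (a b d : {linear A -> A}) : (forall x, d x = kscale c (a x) + b x) -> T d = c *: T a + T b.
  move=> dE; apply: T_unique => h; rewrite mulmxDr -scalemxAr -!TP -fl.
  by congr f; apply: hom_eqP => x; rewrite homD homZ !lin_of_homK !hE dE.
have T_comp (a b : {linear A -> A}) : T (hcomp a b) = T b *m T a.
  apply: T_unique => h; rewrite mulmxA -!TP; congr f; exact: hom_eqP.
have T_id : T (hid A) = 1%:M.
  by apply: T_unique => h; rewrite mulmx1; congr f; apply: hom_eqP.
have T_free (a : {linear A -> A}) : T a = 0 <-> factors_free a.
  split=> [Ta|a0]; last first.
    apply: T_unique => h; rewrite mulmx0; apply/fF'.
    by apply: factors_eq (factors_compr h a0).
  apply/fF'; have -> : f (hom_of a) = f (hom_of (hcomp a (hid A))) by congr f; apply: hom_eqP.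
  by rewrite TP Ta mulmx0.
have T_eq (a b : {linear A -> A}) : stable_eq a b <-> T a = T b.
  have TB : T (hsub a b) = T a - T b.
    rewrite (T_lin (-1) b a) ?scaleN1r 1?addrC // => x.
    by rewrite hE kscaleN1 addrC.
  split=> [ab|ab]; first by apply/subr0_eq; rewrite -TB; apply/T_free.
  by apply/(T_free (hsub a b)); rewrite TB ab subrr.
(* In dimension 0 the identity would be stably zero; the other case has the positive matrix size
   that [fitting] uses. *)
case: n f fl fo fF fF' T TP T_unique T_lin T_comp T_id T_free T_eq {postl}
  => [|n] f fl fo fF fF' T TP T_unique T_lin T_comp T_id T_free T_eq.
  by case: id0; apply/(T_free (hid A)); apply/matrixP => -[].
have T_poly a q : exists b, T b = horner_mx (T a) q.
  elim/poly_ind: q => [|q c [b bE]].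
    exists (hzero A A); rewrite rmorph0; apply/T_free; exact: factors0.
  exists (hadd (hscale (c%:A : R) (hid A)) (hcomp a b)).
  rewrite (T_lin c (hid A) (hcomp a b)) // T_comp bE T_id rmorphD rmorphM /=.
  by rewrite horner_mx_X horner_mx_C addrC scalemx1.
(* The Fitting projection comes from a stably idempotent endomorphism, which is not stably zero,
   hence stably the identity: [T a] has a single eigenvalue. *)
have split_T a : exists c j, (T a - c%:M) ^+ j = 0.
  have [c [q [j [ee e0 e1]]]] := fitting (T a); have [b bE] := T_poly a q.
  exists c, j; apply: e1; rewrite -bE.
  have [|/T_free b0|/(T_eq b (hid A))->] := idem b; last exact: T_id.
    by apply/(T_eq (hcomp b b) b); rewrite T_comp bE.
  by case/eqP: e0; rewrite -bE.
have n0 : n.+1%:R != 0 :> k by have /pcharf0P-> := char_k.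
have trT a c j : (T a - c%:M) ^+ j = 0 -> \tr (T a) = c * n.+1%:R.
  move/nilpotent_trace; rewrite linearB /= mxtrace_scalar => /subr0_eq->.
  by rewrite mulr_natr.
exists (fun a => \tr (T a)); split.
- by move=> c a b d dE; rewrite (T_lin c a b d dE) linearP.
- by move=> a /T_free->; rewrite linear0.
- by rewrite T_id mxtrace1.
- move=> a; have [c [j cj]] := split_T a; rewrite (trT _ _ _ cj) mulf_eq0 negb_or.
  case/andP=> c0 _.
  have uT : T a \in unitmx.
    rewrite -row_free_unit -kermx_eq0; apply/eqP/row_matrixP => i; rewrite row0.
    set v := row i _; have vT : v *m T a = 0 by rewrite -row_mul mulmx_ker row0.
    have /(eigen_pow j) : v *m (T a - c%:M) = (- c) *: v.
      by rewrite mulmxBr vT mul_mx_scalar sub0r scaleNr.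
    rewrite cj mulmx0 => /esym/eqP; rewrite scaler_eq0 expf_eq0 oppr_eq0 (negPf c0) andbF.
    by move/eqP.
  (* Invertibility of [T a] solves a h = 1 stably; for square matrices the one-sided inverse is
     two-sided. *)
  have [h hE'] := fo (f (hom_of (hid A)) *m invmx (T a)).
  have ah : T (hcomp a (lin_of_hom h)) = 1%:M.
    rewrite -T_id; apply/T_eq; apply/(fF (hom_of (hsub (hcomp a (lin_of_hom h)) (hid A)))).
    have -> : hom_of (hsub (hcomp a (lin_of_hom h)) (hid A)) =
      hom_of (hcomp a (lin_of_hom h)) - hom_of (hid A) by apply: hom_eqP.
    by rewrite kformB // TP hom_ofK hE' mulmxKV // subrr.
  exists (lin_of_hom h); apply/T_eq; rewrite T_id T_comp.
  by apply: mulmx1C; rewrite -T_comp.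
Qed.
End Character.

Section StableLocal.
Variable R : comNzRingType.
Implicit Types A K L M N P Q : lmodType R.

Lemma stable_local_iso A A' : finitely_generated A -> finitely_generated A' ->
  stable_iso A A' -> stable_local A -> stable_local A'.
Proof.
move=> fA fA' [u [v [vu uv]]] [id0 idem]; split=> [id0'|e ee].
  apply: id0; apply: factors_eq (factorsD fA (factorsN fA vu)
    (factors_compl v (factors_compr u id0'))) => x.
  by rewrite /= opprB subrK.
have uev (d : {linear A -> A}) : stable_eq (hcomp v (hcomp e u)) d ->
    stable_eq e (hcomp u (hcomp d v)).
  move=> ed; have E1 : stable_eq e (hcomp u (hcomp (hcomp v (hcomp e u)) v)).
    have E2 := factors_compl e uv; have E3 := factors_compr (hcomp e (hcomp u v)) uv.
    apply: factors_eq (factorsN fA' (factorsD fA' E2 E3)) => x.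
    by rewrite /= linearB [X in - X]addrC addrA subrK opprB.
  apply: stable_eq_trans E1 _ => //.
  by apply: factors_eq (factors_compl u (factors_compr v ed)) => x; rewrite /= linearB.
have [|e0|e1] := idem (hcomp v (hcomp e u)).
- have E1 := factors_compl v (factors_compl e (factors_compr (hcomp e u) uv)).
  have E2 := factors_compl v (factors_compr u ee).
  apply: factors_eq (factorsD fA E1 E2) => x.
  by rewrite /= !linearB addrA subrK.
- left; have := uev (hzero A A); case=> [|F [a [b [fF fE]]]].
    by apply: factors_eq e0 => x; rewrite hE subr0.
  by exists F, a, b; split=> // x; rewrite -fE !hE linear0 subr0.
- right; apply: stable_eq_trans (uev (hid A) e1) _ => //.
Qed.

Lemma stable_local_omega M K P (i : {linear K -> P}) (p : {linear P -> M}) :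
  short_exact i p -> pfg P -> CM M -> stable_local M -> stable_local K.
Proof.
move=> sp qP cM [id0 idem]; have [cK ei] := CM_syzygy sp qP cM; have fK := CM_fg cK.
have free f f' := @omega_free _ _ _ _ _ _ _ _ _ _ _ sp sp qP qP ei fK f f'.
split=> [id0'|e' ee'].
  by apply: id0; apply/(free _ _ (omega_id i p)).
have [e eo] := omega_onto sp sp qP ei e'.
have [|e0|e1] := idem e.
- exact: (free _ _ (omegaB (omega_comp eo eo) eo)).2 ee'.
- by left; apply/(free _ _ eo).
- by right; apply/(free _ _ (omegaB eo (omega_id i p))).
Qed.

Lemma omega_stable_iso M N K L P Q (i : {linear K -> P}) (p : {linear P -> M})
    (j : {linear L -> Q}) (q : {linear Q -> N}) :
  short_exact i p -> short_exact j q -> pfg P -> pfg Q -> CM M -> CM N ->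
  stable_iso K L -> stable_iso M N.
Proof.
move=> sp sq qP qQ cM cN [f' [g' [gf' fg']]].
have [cK ei] := CM_syzygy sp qP cM; have [cL ej] := CM_syzygy sq qQ cN.
have [f ff'] := omega_onto sp sq qQ ei f'; have [g gg'] := omega_onto sq sp qP ej g'.
exists f, g; split.
  apply: (omega_free sp sp qP qP ei (CM_fg cK) (omegaB (omega_comp ff' gg') (omega_id i p))).2.
  exact: gf'.
apply: (omega_free sq sq qQ qQ ej (CM_fg cL) (omegaB (omega_comp gg' ff') (omega_id j q))).2.
exact: fg'.
Qed.

End StableLocal.

(** * Almost split maps and multiplicities *)

Section Radical.
Variables (k : closedFieldType) (R : comAlgType k).
Implicit Types A B M N P X Y : lmodType R.

Lemma hom_kscale X Y c (f : hom X Y) x :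
  lin_of_hom (kscale c f) x = (c%:A : R) *: lin_of_hom f x.
Proof. by []. Qed.

Section Form.
Variables (A : lmodType R) (tau : {linear A -> A} -> k).
Hypotheses (fA : finitely_generated A) (tauP : trace_form tau).

Lemma tau_lin c (a b d : {linear A -> A}) :
  (forall x, d x = kscale c (a x) + b x) -> tau d = c * tau a + tau b.
Proof. by case: tauP => + _ _ _; apply. Qed.

Lemma tau_free (a : {linear A -> A}) : factors_free a -> tau a = 0.
Proof. by case: tauP => _ + _ _; apply. Qed.

Lemma tau_stable (a b : {linear A -> A}) : stable_eq a b -> tau a = tau b.
Proof.
move=> ab; have : tau (hsub a b) = 0 by apply: tau_free.
rewrite (@tau_lin (-1) b a) => [|x]; last by rewrite hE kscaleN1 addrC.
by rewrite mulN1r addrC => /subr0_eq.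
Qed.

Lemma tau_ext (a b : {linear A -> A}) : a =1 b -> tau a = tau b.
Proof.
by move=> ab; apply: tau_stable; apply: factors_eq (factors0 A fA) => x; rewrite ab subrr.
Qed.

(** These are the maps that are not stably split monomorphisms, and the codimension is the
    multiplicity of A in X. Phrased through [tau], the condition is plainly closed under sums. *)
Definition radical X : set (hom A X) :=
  [set f | forall h : {linear X -> A}, tau (hcomp h (lin_of_hom f)) = 0].

Lemma radical0 X (f : {linear A -> X}) : factors_free f -> radical (hom_of f).
Proof. by move=> f0 h; apply: tau_free; apply: factors_compl. Qed.

Lemma is_sub_radical X : is_sub (@radical X).
Proof.
split=> [|f g rf rg|c f rf] h.
- by apply: tau_free; apply: factors_eq (factors0 A fA) => x; rewrite hE hom0 linear0.
- rewrite (@tau_lin 1 (hcomp h (lin_of_hom f)) (hcomp h (lin_of_hom g))).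
    by rewrite rf rg mulr0 addr0.
  by move=> x; rewrite kscale1 !hE homD linearD.
- rewrite -(rf (hscale c h)); apply: tau_ext => x.
  by rewrite !hE homZ linearZ.
Qed.

Lemma free_hom_radical X : free_hom A X `<=` @radical X.
Proof. by move=> f f0; rewrite -[f]hom_ofK; apply: radical0. Qed.

Lemma radical_comp X Y (f : {linear A -> X}) (u : {linear X -> Y}) :
  radical (hom_of f) -> radical (hom_of (hcomp u f)).
Proof. by move=> rf h; rewrite -(rf (hcomp h u)); apply: tau_ext. Qed.

Lemma radical_ext X (f g : {linear A -> X}) : f =1 g -> radical (hom_of f) -> radical (hom_of g).
Proof. by move=> fg; have -> : hom_of f = hom_of g by apply: hom_eqP. Qed.

Lemma radical_stable X (f g : {linear A -> X}) : stable_eq f g ->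
  radical (hom_of g) -> radical (hom_of f).
Proof.
move=> fg rg h; rewrite -(rg h); apply: tau_stable.
by apply: factors_eq (factors_compl h fg) => x; rewrite linearB.
Qed.

Lemma radical_pair X Y (f : {linear A -> X}) (g : {linear A -> Y}) :
  radical (hom_of f) -> radical (hom_of g) -> radical (hom_of (hpair f g)).
Proof.
move=> rf rg h; rewrite (@tau_lin 1 (hcomp (hcomp h (hinl X Y)) (lin_of_hom (hom_of f)))
    (hcomp (hcomp h (hinr X Y)) (lin_of_hom (hom_of g)))).
  by rewrite rf rg mulr0 addr0.
move=> x; rewrite kscale1 !hE !lin_of_homK -linearD.
by congr (h (_, _)); rewrite /= ?addr0 ?add0r.
Qed.

Lemma radical_id X (f : {linear A -> X}) (h : {linear X -> A}) :
  stable_eq (hcomp h f) (hid A) -> ~ radical (hom_of f).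
Proof.
move=> hf /(_ h); rewrite (tau_stable (b := hid A)) //.
by case: tauP => _ _ /eqP.
Qed.

Lemma qdim_radical_stable X Y n : finitely_generated X -> finitely_generated Y ->
  stable_iso X Y -> qdim (@radical X) n -> qdim (@radical Y) n.
Proof.
move=> fX fY [u [v [vu uv]]].
apply: (@qdim_transfer _ _ _ _ _ _
  (fun f f' => stable_eq (lin_of_hom f') (hcomp u (lin_of_hom f)))).
- exact: is_sub_radical.
- exact: is_sub_radical.
- by move=> f; exists (hom_of (hcomp u (lin_of_hom f))); apply: stable_eq_refl.
- move=> f'; exists (hom_of (hcomp v (lin_of_hom f'))); apply: stable_eq_sym => //.
  exact: (factors_compr (lin_of_hom f') uv).
- move=> c f g f' g' ff' gg'.
  apply: factors_eq (factors_lin (c%:A : R) fY ff' gg') => x.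
  by rewrite !hcompE !homD !hom_kscale linearP scalerBr opprD addrACA.
- move=> f f' ff'; split=> rf.
    rewrite -[f']hom_ofK; apply: radical_stable ff' _; apply: radical_comp.
    by rewrite hom_ofK.
  rewrite -[f]hom_ofK; apply: (@radical_stable _ _ (hcomp v (lin_of_hom f'))).
    apply: stable_eq_sym => //; apply: stable_eq_trans (factors_compr (lin_of_hom f) vu) => //.
    by apply: factors_eq (factors_compl v ff') => x; rewrite linearB.
  by apply: radical_comp; rewrite hom_ofK.
Qed.

Lemma qdim_radical_prod X Y n p : qdim (@radical X) n -> qdim (@radical Y) p ->
  qdim (@radical (X * Y)%type) (n + p).
Proof.
move=> qX qY; apply: (qdim_transfer (rel := fun (fg : (hom A X * hom A Y)%type) f =>
  f = hom_of (hpair (lin_of_hom fg.1) (lin_of_hom fg.2)))) (qdim_prod qX qY).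
- have sX := @is_sub_radical X; have sY := @is_sub_radical Y.
  split=> /=; first by split; [apply: (sub0 sX) | apply: (sub0 sY)].
    by move=> f g [? ?] [? ?]; split; [apply: (subD sX) | apply: (subD sY)].
  by move=> c f [? ?]; split; [exact: (subZ sX) | exact: (subZ sY)].
- exact: is_sub_radical.
- by move=> fg; exists (hom_of (hpair (lin_of_hom fg.1) (lin_of_hom fg.2))).
- move=> f; exists (hom_of (hcomp (hfst X Y) (lin_of_hom f)), hom_of (hcomp (hsnd X Y) (lin_of_hom f))).
  by apply: hom_eqP => x; exact: surjective_pairing.
- by move=> c f g _ _ -> ->; apply: hom_eqP.
- move=> [f g] _ -> /=; split=> [[rf rg]|rfg]; first by apply: radical_pair; rewrite hom_ofK.
  split; rewrite -[X in radical X]hom_ofK.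
    by apply: radical_ext (radical_comp (hfst X Y) rfg) => x; rewrite !hE.
  by apply: radical_ext (radical_comp (hsnd X Y) rfg) => x; rewrite !hE.
Qed.

Lemma qdim0P X : qdim (@radical X) 0 <-> forall f : {linear A -> X}, radical (hom_of f).
Proof.
split=> [[e [_ _ eP]] f|all]; first by apply/eP; apply: thinmx0.
exists (fun=> 0); split.
- by move=> c x y; rewrite scaler0 addr0.
- by move=> y; exists 0; rewrite (thinmx0 y).
- by move=> f; split=> // _; rewrite -[f]hom_ofK.
Qed.

End Form.

End Radical.

Section Main.
Variables (k : closedFieldType) (char_k : [pchar k] =i pred0).
Variables (R : comAlgType k) (m : set R).
Hypotheses (nR : noetherian_ring R) (lR : local_ring_at m) (cR : adically_complete m).
Hypotheses (res : residue_field_is_base m) (fR : finite_representation_type R).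
Implicit Types A B C D K L M N P Q U V X Y : lmodType R.

Lemma free_hom_finite X Y : CM X -> CM Y -> exists n, qdim (free_hom X Y) n.
Proof. exact: (stable_hom_finite nR lR res fR). Qed.

Lemma radical_finite A tau X : CM A -> @trace_form k R A tau -> CM X ->
  exists n, qdim (radical tau (X := X)) n.
Proof.
move=> cA tauP cX; have fA := CM_fg cA; have [n nP] := free_hom_finite cA cX.
apply: (qdim_sub _ _ _ nP); first by apply: is_sub_free_hom; apply: CM_fg.
  exact: is_sub_radical.
exact: free_hom_radical.
Qed.

(** The projection onto an indecomposable summand is stably 0 or 1, so either the complement or that
    summand already carries the stable isomorphism class. *)
Lemma finitely_many_stable_local : exists n (L : 'I_n -> lmodType R),
  forall X, CM X -> stable_local X ->
  exists i A, [/\ CM A, stable_iso X A & mod_iso A (L i)].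
Proof.
have [n [L LP]] := fR; exists n, L.
apply: (CM_ind nR lR) => [X Y cX cY XY IH sX|X X0 [id0 _]|A X cA iA cX IH sAX].
- have fX := CM_fg cX; have fY := CM_fg cY.
  have XYs := mod_iso_stable fX fY XY.
  have [i [A [cA YA AL]]] := IH (stable_local_iso fX fY XYs sX); exists i, A; split=> //.
  exact: (stable_iso_trans fX (CM_fg cA) XYs YA).
- case: id0; apply: (factors_pfg (a := hzero X _) (b := hzero _ X)) (row_pfg R 0) _ => x.
  by rewrite (X0 x) linear0.
- have fA := CM_fg cA; have fX := CM_fg cX; have fAX := fg_prod fA fX.
  have [id0 idem] := sAX.
  pose e := hcomp (hinl A X) (hfst A X).
  have [|e0|e1] := idem e; first by apply: factors_eq (factors0 _ fAX) => x; rewrite subrr.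
    have AX : stable_iso (A * X)%type X.
      exists (hsnd A X), (hinr A X); split; last first.
        by apply: factors_eq (factors0 X fX) => x; rewrite /= subrr.
      apply: factors_eq (factorsN fAX e0) => -[x y].
      by congr (_, _); rewrite /= ?sub0r ?subrr ?oppr0.
    have [i [A' [cA' XA' AL]]] := IH (stable_local_iso fAX fX AX sAX).
    exists i, A'; split=> //; exact: (stable_iso_trans fAX (CM_fg cA') AX XA').
  have [i AL] := LP A (CM_cohen_macaulay cA) iA.
  exists i, A; split=> //; exists (hfst A X), (hinl A X); split=> //.
  by apply: factors_eq (factors0 A fA) => x; rewrite /= subrr.
Qed.

(* Two syzygies of A are stably isomorphic by finiteness; since the syzygy functor is
   fully faithful on the stable category, A itself is stably a syzygy. *)
Lemma stable_local_syzygy A : CM A -> stable_local A ->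
  exists K P C (i : {linear K -> P}) (p : {linear P -> C}),
    [/\ short_exact i p, pfg P, CM C, stable_iso A K & stable_local K].
Proof.
move=> cA sA.
pose step (K : {K : lmodType R | CM K}) := sval (cid (syzygy_step_exists (svalP K))).
pose next (K : {K : lmodType R | CM K}) : {K : lmodType R | CM K} :=
  exist _ _ (step_CM (step K)).
pose K j := iter j next (exist _ A cA).
have cK j : CM (sval (K j)) by apply: svalP.
have sE j : short_exact (step_inj (step (K j)) : {linear sval (K j.+1) -> _})
  (step_proj (step (K j))) by apply: step_exact.
have sK j : stable_local (sval (K j)).
  elim: j => [|j IHj]; first exact: sA.
  exact: (stable_local_omega (sE j) (row_pfg R _) (cK j) IHj).
have [n [L LP]] := finitely_many_stable_local.
have [c cP] := choice (fun j => LP _ (cK j) (sK j)).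
have [a [b [ab cab]]] : exists a b, (a < b)%N /\ c a = c b.
  apply: contrapT => no.
  have inj : injective (fun i : 'I_n.+1 => c i).
    move=> i j cij; apply: val_inj => /=; case: (ltngtP i j) => // ij; case: no.
      by exists i, j.
    by exists j, i.
  by have := leq_card _ inj; rewrite !card_ord ltnn.
have Kab : stable_iso (sval (K a)) (sval (K b)).
  have [A1 [cA1 KA1 AL1]] := cP a; have [A2 [cA2 KA2 AL2]] := cP b.
  have A12 : mod_iso A1 A2 by apply: mod_iso_trans AL1 (mod_iso_sym _); rewrite cab.
  apply: stable_iso_trans (stable_iso_sym KA2) => //; try exact: CM_fg.
  apply: stable_iso_trans KA1 _; try exact: CM_fg.
  by apply: mod_iso_stable => //; apply: CM_fg.
(* Stable isomorphisms descend from syzygies to the modules, so the d common syzygies can be removed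
   one by one. *)
have shift e d : stable_iso (sval (K d)) (sval (K (e + d)%N)) -> stable_iso A (sval (K e)).
  elim: d => [|d IHd]; first by rewrite addn0.
  rewrite addnS => Ked; apply: IHd.
  exact: (omega_stable_iso (sE _) (sE _) (row_pfg R _) (row_pfg R _) (cK _) (cK _) Ked).
have Kd : stable_iso A (sval (K (b - a)%N)) by apply: (shift _ a); rewrite subnK // ltnW.
have [d dE] : exists d, (b - a)%N = d.+1 by exists (b - a).-1; rewrite prednK // subn_gt0.
rewrite dE in Kd.
exists (sval (K d.+1)), 'rV[R]_(step_rank (step (K d))), (sval (K d)).
exists (step_inj (step (K d))), (step_proj (step (K d))).
by split=> //; exact: row_pfg.
Qed.

Section AlmostSplit.
Variables (A : lmodType R) (tau : {linear A -> A} -> k).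
Hypotheses (cA : CM A) (tauP : trace_form tau).
Let fA := CM_fg cA.

Definition almost_split B (g : {linear A -> B}) X : Prop :=
  forall f : {linear A -> X}, radical tau (hom_of f) ->
    exists u : {linear B -> X}, stable_eq f (hcomp u g).

Lemma almost_split_one X : CM X -> exists B (g : {linear A -> B}),
  [/\ CM B, radical tau (hom_of g) & almost_split g X].
Proof.
move=> cX; have fX := CM_fg cX.
have [s sP] := hom_noeth nR fA fX (is_sub_radical fA tauP X).
have srad : {in s, forall f, radical tau f} by move=> f fs; apply/sP/span_mem.
have [B [g [cB rg gP]]] : exists B (g : {linear A -> B}),
    [/\ CM B, radical tau (hom_of g) &
      forall f, span s f -> exists u : {linear B -> X}, f = hom_of (hcomp u g)].
  elim: {sP} s srad => [|f1 s IHs] srad.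
    exists 'rV[R]_0, (hzero _ _); split; first exact/CM_pfg/row_pfg.
      by apply: radical0 => //; apply: factors_to; apply: row_pfg.
    by move=> f /= ->; exists (hzero _ _); apply: hom_eqP => x; rewrite hom0.
  have [f fs|B [g [cB rg gP]]] := IHs; first by apply: srad; rewrite inE fs orbT.
  exists (X * B)%type, (hpair (lin_of_hom f1) g); split; first exact: CM_prod.
    by apply: radical_pair => //; rewrite hom_ofK; apply: srad; rewrite mem_head.
  move=> f [c /gP[u fu]]; exists (hcopair (hscale c (hid X)) u).
  rewrite -(subrK (c *: f1) f) fu; apply: hom_eqP => x.
  by rewrite homD homZ !lin_of_homK !hE /= addrC.
exists B, g; split=> // f /sP/gP[u fu]; exists u.
apply: factors_eq (factors0 A fX) => x.
by rewrite -(lin_of_homK f) fu lin_of_homK subrr.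
Qed.

Lemma almost_split_iso B (g : {linear A -> B}) X Y : CM X -> CM Y ->
  mod_iso X Y -> almost_split g X -> almost_split g Y.
Proof.
move=> cX cY /mod_isoP[u [v [uK vK]]] gX f rf.
have [w wP] := gX (hcomp v f) (radical_comp fA tauP v rf); exists (hcomp u w).
by apply: factors_eq (factors_compl u wP) => x; rewrite linearB !hE vK.
Qed.

Lemma almost_split_exists : exists B (g : {linear A -> B}),
  [/\ CM B, radical tau (hom_of g) & forall X, CM X -> almost_split g X].
Proof.
have [n [L LP]] := fR.
have [B [g [cB rg gL]]] : exists B (g : {linear A -> B}), [/\ CM B, radical tau (hom_of g) &
    forall i : 'I_n, CM (L i) -> almost_split g (L i)].
  have : exists B (g : {linear A -> B}), [/\ CM B, radical tau (hom_of g) &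
      forall i, i \in enum 'I_n -> CM (L i) -> almost_split g (L i)].
    elim: (enum 'I_n) => [|i s [B [g [cB rg gs]]]].
      exists 'rV[R]_0, (hzero _ _); split=> //; first exact/CM_pfg/row_pfg.
      by apply: radical0 => //; apply: factors_to; apply: row_pfg.
    have extend B' (g' : {linear A -> B'}) : CM B' -> radical tau (hom_of g') ->
        (CM (L i) -> almost_split g' (L i)) ->
        exists B (g : {linear A -> B}), [/\ CM B, radical tau (hom_of g) &
          forall j, j \in i :: s -> CM (L j) -> almost_split g (L j)].
      move=> cB' rg' gi; exists (B' * B)%type, (hpair g' g); split.
      - exact: CM_prod.
      - exact: radical_pair.
      - move=> j; rewrite inE => /orP[/eqP->|js] cL f rf.
          have [u uP] := gi cL f rf; exists (hcomp u (hfst _ _)).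
          by apply: factors_eq uP => x; rewrite !hE.
        have [u uP] := gs j js cL f rf; exists (hcomp u (hsnd _ _)).
        by apply: factors_eq uP => x; rewrite !hE.
    (* The list [L] may contain modules that are not Cohen-Macaulay; for those nothing has to be
       added to B. *)
    have [cL|ncL] := pselect (CM (L i)).
      by have [B' [g' [cB' rg' gi]]] := almost_split_one cL; apply: (extend B' g').
    by apply: (extend B g) => // /ncL.
  by move=> [B [g [cB rg gL]]]; exists B, g; split=> // i; apply: gL; rewrite mem_enum.
exists B, g; split=> //; apply: (CM_ind nR lR).
- by move=> X Y cX cY XY; apply: almost_split_iso => //; apply: mod_iso_sym.
- move=> X X0 f _; exists (hzero _ _).
  apply: (factors_pfg (a := hzero A _) (b := hzero _ X)) (row_pfg R 0) _ => x.
  by rewrite [LHS]X0 hE.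
- move=> A' X cA' iA' cX gX f rf.
  have [i AL] := LP A' (CM_cohen_macaulay cA') iA'.
  have cL := CM_iso AL cA'.
  have gA' := almost_split_iso cL cA' (mod_iso_sym AL) (gL i cL).
  have [u uP] := gA' _ (radical_comp fA tauP (hfst A' X) rf).
  have [v vP] := gX _ (radical_comp fA tauP (hsnd A' X) rf).
  exists (hpair u v).
  have fAX := fg_prod (CM_fg cA') (CM_fg cX).
  apply: factors_eq (factorsD fAX (factors_compl (hinl A' X) uP) (factors_compl (hinr A' X) vP)) => x.
  rewrite /=; case: (f x) => y z.
  by congr (_, _); rewrite /= ?addr0 ?add0r.
Qed.

End AlmostSplit.

End Main.

(** * Counting multiplicities and cancellation *)

Section Counting.
Variables (k : closedFieldType) (char_k : [pchar k] =i pred0).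
Variables (R : comAlgType k) (m : set R).
Hypotheses (nR : noetherian_ring R) (lR : local_ring_at m) (cR : adically_complete m).
Hypotheses (res : residue_field_is_base m) (fR : finite_representation_type R).
Implicit Types A B C D K L M N P Q U V X Y : lmodType R.

Section Multiplicity.
Variables (A P C : lmodType R) (i : {linear A -> P}) (p : {linear P -> C}).
Variable tau : {linear A -> A} -> k.
Hypotheses (sp : short_exact i p) (qP : pfg P) (cC : CM C) (tauP : trace_form tau).

(* With D the pushout of [i] along a left almost split [g : A -> B], the sequence
   Hom(C, M) -> Hom(D, M) -> Hom(B, M) -> Hom(A, M) is stably exact; its cokernel is
   Hom(A, M) modulo the radical, and the image of its first map is Hom(A, L) modulo the
   radical, for L a syzygy of M. *)
Lemma multiplicity_count : exists B D, [/\ CM B, CM D &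
  forall M L Q (j : {linear L -> Q}) (q : {linear Q -> M}),
    CM M -> short_exact j q -> pfg Q ->
    forall a b hA hB hD, qdim (radical tau (X := L)) a -> qdim (radical tau (X := M)) b ->
    qdim (free_hom A M) hA -> qdim (free_hom B M) hB -> qdim (free_hom D M) hD ->
    (a + b + hB = hD + hA)%N].
Proof.
have [cA ei] := CM_syzygy sp qP cC; have fA := CM_fg cA.
have [B [g [cB rg gP]]] := almost_split_exists nR lR fR cA tauP.
have [D [u [v [ugi gen rel ump]]]] := pushout_exists i g.
have [q' [suq qv]] := pushout_short_exact sp ugi gen rel ump.
have [_ q'o uq] := suq.
have cD : CM D := CM_ext suq cB cC.
have qu0 z : q' (u z) = 0 by apply/uq; exists z.
exists B, D; split=> // M L Q j q cM sq qQ a b hA hB hD aP bP AP BP DP.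
have fM := CM_fg cM; have [cL ej] := CM_syzygy sq qQ cM; have fL := CM_fg cL.
have [jj qo jq] := sq; have [ii po ip] := sp.
have [hC CP] := free_hom_finite nR lR res fR cC cM.
have [|||y|y|a' [b' [aP' bP' <-]]] := qdim_exact4 (linear_klinear (precomp M q'))
  (linear_klinear (precomp M u)) (linear_klinear (precomp M g)) CP DP BP AP.
- by move=> x; apply: factors_compr.
- by move=> x; apply: factors_compr.
- by move=> x; apply: factors_compr.
- split=> [yu|[x yx]]; last first.
    apply: factors_eq (factors_compr u yx) => z.
    by rewrite homB !precompE qu0 linear0 subr0.
  have [F [s [t [fF st]]]] := yu.
  have [n [e eo]] := fg_row fM.
  (* Lift [y u] to a free cover and extend the lift to [d : D -> R^n]. Then [y - e d] vanishes on B,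
     so it comes from C. *)
  have [h hP] := factors_lift yu eo.
  have [w wP] := ext1_pfg (hcomp h g) ei (row_pfg R n).
  have [|d [du dv]] := ump _ h w; first by move=> x; rewrite wP hE.
  have [|x xP] := descend (f := hsub (lin_of_hom y) (hcomp e d)) q'o.
    move=> z /uq[y' <-]; rewrite !hE du -hP precompE; exact: subrr.
  exists (hom_of x); apply: (factors_pfg (a := d) (b := e)) (row_pfg R n) _ => z.
  by rewrite homB precompE lin_of_homK xP !hE opprB addrC subrK.
- split=> [yg|[x yx]]; last first.
    have xg0 : factors_free (fun z => lin_of_hom x (u (g z))).
      apply: (factors_pfg (a := i) (b := hcomp (lin_of_hom x) v)) qP _ => z.
      by rewrite ugi hE.
    apply: factors_eq (factorsD fM (factors_compr g yx) xg0) => z.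
    by rewrite homB !precompE subrK.
  (* A stably zero [y g] extends over P, and the pushout property glues this extension with [y] to a
     map on D. *)
  have [w wP] := ext1_factors ei fM yg.
  have [|d [du dv]] := ump _ (lin_of_hom y) w; first by move=> x; rewrite wP precompE.
  exists (hom_of d); apply: factors_eq (factors0 B fM) => z.
  by rewrite homB precompE lin_of_homK du subrr.
have -> : b = b'.
  apply: (qdim_unique bP); have -> // : radical tau (X := M) =
      [set y | exists x, free_hom A M (y - precomp M g x)].
  apply/seteqP; split=> y.
    rewrite -{1}[y]hom_ofK => /(gP M cM)[x yx]; exists (hom_of x).
    by apply: factors_eq yx => z; rewrite homB precompE lin_of_homK hE.
  move=> [x yx]; rewrite -[y]hom_ofK.
  apply: (radical_stable tauP (g := hcomp (lin_of_hom x) g)).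
    by apply: factors_eq yx => z; rewrite homB precompE hE.
  exact: (radical_comp fA tauP).
congr (_ + _ + _)%N; apply: (qdim_unique aP).
apply: (qdim_transfer (rel := fun w w' => omega i p j q (lin_of_hom w) (lin_of_hom w'))) aP'.
- by apply: (is_sub_ker (precomp M q')); apply: is_sub_free_hom.
- exact: is_sub_radical.
- by move=> w; have [w' ww'] := omega_total sp sq qP (lin_of_hom w); exists (hom_of w').
- by move=> w'; have [w ww'] := omega_onto sp sq qQ ei (lin_of_hom w'); exists (hom_of w).
- move=> c x x' y y' xx' yy'; exact: (omega_lin (c%:A : R) xx' yy').
(* A lift [t : D -> Q] of [w q'] yields [s : B -> L] with w' equal to [s g] up to a map through P,
   so w' is radical. Conversely, a radical w' is stably [s g], and gluing [j s] on B with a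
   correction of [h] on P gives such a lift. *)
move=> w w' [h hw hw'] /=; split=> [wq|rw'].
  have [t tP] := factors_lift wq qo.
  have [|s sP] := corestrict (f := hcomp t u) jj.
    by move=> z; apply/jq; rewrite hE -tP precompE qu0 linear0.
  have [|r rP] := corestrict (f := hsub (hcomp t v) h) jj.
    by move=> z; apply/jq; rewrite !hE linearB -tP precompE qv hw subrr.
  rewrite -[w']hom_ofK; apply: (radical_stable tauP (g := hcomp s g)).
    apply: (factors_pfg (a := i) (b := hscale (-1) r)) qP _ => z; apply: jj.
    rewrite linearB hw' !hE sP hE ugi scaleN1r linearN rP !hE opprB.
    by [].
  exact: (radical_comp fA tauP).
have [s ws] : exists s : {linear B -> L}, stable_eq (lin_of_hom w') (hcomp s g).
  by apply: (gP L cL); rewrite hom_ofK.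
have [r rP] := ext1_factors (f := hsub (lin_of_hom w') (hcomp s g)) ei fL ws.
have [|d [du dv]] := ump _ (hcomp j s) (hsub h (hcomp j r)).
  by move=> x; rewrite !hE rP !hE linearB hw' opprB addrC subrK.
apply: (factors_pfg (a := d) (b := q)) qQ _ => z.
have [y [x ->]] := gen z; rewrite precompE !linearD du dv qv !hE linearB.
have -> : q (j (s y)) = 0 by apply/jq; exists (s y).
have -> : q (j (r x)) = 0 by apply/jq; exists (r x).
by rewrite qu0 linear0 !add0r subr0 hw.
Qed.

End Multiplicity.

Definition test_object A (tau : {linear A -> A} -> k) : Prop :=
  CM A /\ trace_form tau /\ exists P C (i : {linear A -> P}) (p : {linear P -> C}),
    [/\ short_exact i p, pfg P & CM C].

Definition same_multiplicities U V : Prop :=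
  forall A (tau : {linear A -> A} -> k), test_object tau ->
  forall n p, qdim (radical tau (X := U)) n -> qdim (radical tau (X := V)) p -> n = p.

(** A is only stably a syzygy, so it is replaced by a stably isomorphic module that is one. *)
Lemma test_object_exists A : CM A -> indecomposable A -> ~ pfg A ->
  exists A' (tau : {linear A' -> A'} -> k), [/\ test_object tau, CM A' & stable_iso A A'].
Proof.
move=> cA iA nA; have fA := CM_fg cA.
have sA := indecomposable_stable_local nR lR cR fA iA nA.
have [K [P [C [i [p [sp qP cC AK sK]]]]]] := stable_local_syzygy nR lR fR cA sA.
have [cK _] := CM_syzygy sp qP cC.
have [n nP] := free_hom_finite nR lR res fR cK cK.
have [tau tauP] := trace_form_exists char_k (CM_fg cK) sK nP.
by exists K, tau; split=> //; split=> //; split=> //; exists P, C, i, p.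
Qed.

Lemma not_all_radical A A' X (tau : {linear A' -> A'} -> k) : finitely_generated A' ->
  trace_form tau -> stable_iso A A' ->
  ~ (forall f : {linear A' -> (A * X)%type}, radical tau (hom_of f)).
Proof.
move=> fA' tauP [u [v [vu uv]]] all.
apply: (radical_id tauP (f := hcomp (hinl A X) v) (h := hcomp u (hfst A X))) (all _).
exact: uv.
Qed.

Lemma no_multiplicity_free V : CM V ->
  (forall A (tau : {linear A -> A} -> k), test_object tau ->
   forall f : {linear A -> V}, radical tau (hom_of f)) ->
  factors_free (id : V -> V).
Proof.
move: V; apply: (CM_ind nR lR) => [X Y cX cY /mod_isoP[f [g [fK gK]]] IH all|X X0 _|A X cA iA cX IH all].
- have id0 : factors_free (id : Y -> Y).
    apply: IH => A tau tA h; have [cA [tauP _]] := tA.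
    apply: (radical_ext (f := hcomp f (hcomp g h))) => [x|]; first by rewrite !hE gK.
    by apply: (radical_comp (CM_fg cA) tauP); apply: all.
  by apply: factors_eq (factors_compl g (factors_compr f id0)) => x; rewrite fK.
- apply: (factors_pfg (a := hzero X _) (b := hzero _ X)) (row_pfg R 0) _ => x.
  by rewrite [LHS]X0 hE.
- have [qA|nA] := pselect (pfg A); last first.
    have [A' [tau [tA cA' AA']]] := test_object_exists cA iA nA.
    by have [_ [tauP _]] := tA; case: (not_all_radical (CM_fg cA') tauP AA' (all _ _ tA)).
  have id0 : factors_free (id : X -> X).
    apply: IH => A' tau tA h; have [cA' [tauP _]] := tA.
    apply: (radical_ext (f := hcomp (hsnd A X) (hcomp (hinr A X) h))) => [x|]; first by rewrite !hE.
    by apply: (radical_comp (CM_fg cA') tauP); apply: all.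
  have fAX := fg_prod (CM_fg cA) (CM_fg cX).
  apply: factors_eq (factorsD fAX (factors_compl (hinr A X) (factors_compr (hsnd A X) id0))
    (factors_pfg (a := hfst A X) (b := hinl A X) qA (fun x => erefl))) => -[x y].
  by congr (_, _); rewrite /= ?addr0 ?add0r.
Qed.

(** A non-radical f has a left inverse up to a map through R^n. Adding R^n to V turns it into an
    honest left inverse, whose kernel is V'. *)
Lemma split_off A V (tau : {linear A -> A} -> k) : CM A -> CM V -> trace_form tau ->
  ~ (forall f : {linear A -> V}, radical tau (hom_of f)) ->
  exists n V', mod_iso (A * V')%type (V * 'rV[R]_n)%type.
Proof.
move=> cA cV [_ _ _ tau_inv] nall.
have [f [h th]] : exists (f : {linear A -> V}) (h : {linear V -> A}), tau (hcomp h f) != 0.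
  apply: contrapT => no; apply: nall => f h; apply: contrapT => /eqP th; apply: no.
  by exists (lin_of_hom (hom_of f)), h.
have [b bP] := tau_inv _ th; have [n [e eo]] := fg_row (CM_fg cA).
have [a aP] := factors_lift bP eo.
pose s := hpair f a; pose r := hcopair (hcomp b h) (hscale (-1) e).
have rs x : r (s x) = x.
  rewrite !hE scaleN1r /= -aP !hE opprB addrC subrK; exact: erefl.
have ro : onto r by move=> x; exists (s x).
have [V' [j [ij _ jr]]] := ker_exists ro.
have rj x : r (j x) = 0 by apply/jr; exists x.
exists n, V'; apply: (@mod_iso_bij _ _ _ (hcopair s j)) => [[x y]|w].
  rewrite hcopairE -[X in X = _]/(s x + j y) => sj; have x0 : x = 0.
    by have := congr1 r sj; rewrite linearD rs rj addr0 linear0.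
  move: sj; rewrite x0 linear0 add0r => /eqP; rewrite -(linear0 j) => /eqP/ij->.
  by [].
have /jr[y yP] : r (w - s (r w)) = 0 by rewrite linearB rs subrr.
by exists (r w, y); rewrite hcopairE /= yP addrC subrK.
Qed.

(** Induction on a decomposition of U. Free summands vanish stably. A non-free indecomposable
    summand has nonzero multiplicity in U, hence in V, so it also splits off V, and additivity of
    multiplicities allows cancellation. *)
Lemma same_multiplicities_stable_iso U V : CM U -> CM V ->
  same_multiplicities U V -> stable_iso U V.
Proof.
move=> cU; move: U cU V; apply: (CM_ind nR lR) => [X Y cX cY XY IH V cV XV|X X0 V cV XV|A X cA iA cX IH V cV AXV].
- have fX := CM_fg cX; have fY := CM_fg cY.
  have XYs := mod_iso_stable fX fY XY.
  apply: (stable_iso_trans fX (CM_fg cV) XYs); apply: IH => // A tau tA n p Yn Vp.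
  have [cA [tauP _]] := tA.
  apply: (XV A tau tA) Vp.
  exact: (qdim_radical_stable (CM_fg cA) tauP fY fX (stable_iso_sym XYs) Yn).
- have V0 : factors_free (id : V -> V).
    apply: no_multiplicity_free => // A tau tA; have [cA [tauP _]] := tA.
    have [p Vp] := radical_finite nR lR res fR cA tauP cV.
    have X00 : qdim (radical tau (X := X)) 0.
      apply/qdim0P => f; apply: (radical0 tauP).
      apply: (factors_pfg (a := hzero A _) (b := hzero _ X)) (row_pfg R 0) _ => x.
      by rewrite [LHS]X0 hE.
    by apply/qdim0P; rewrite (XV A tau tA _ _ X00 Vp).
  exists (hzero X V), (hzero V X); split.
    apply: (factors_pfg (a := hzero X _) (b := hzero _ X)) (row_pfg R 0) _ => x.
    by rewrite [LHS]X0 hE.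
  by apply: factors_eq (factorsN (CM_fg cV) V0) => x; rewrite /= sub0r.
- have fA := CM_fg cA; have fX := CM_fg cX; have fV := CM_fg cV.
  have fAX := fg_prod fA fX.
  have [qA|nA] := pselect (pfg A).
    have AX : stable_iso (A * X)%type X.
      apply: (stable_iso_trans fAX fX) (stable_iso_pfg fX qA).
      by apply: mod_iso_stable (mod_iso_prodC _ _) => //; apply: fg_prod.
    apply: (stable_iso_trans fAX fV AX); apply: IH => // A' tau tA n p Xn Vp.
    have [cA' [tauP _]] := tA; apply: (AXV A' tau tA) Vp.
    exact: (qdim_radical_stable (CM_fg cA') tauP fX fAX (stable_iso_sym AX) Xn).
  have [A' [tau [tA cA' AA']]] := test_object_exists cA iA nA.
  have [_ [tauP _]] := tA; have fA' := CM_fg cA'.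
  have nV : ~ (forall f : {linear A' -> V}, radical tau (hom_of f)).
    move=> /qdim0P V0; apply: (not_all_radical (X := X) fA' tauP AA'); apply/qdim0P.
    have [n nP] := radical_finite nR lR res fR cA' tauP (CM_prod cA cX).
    by rewrite -(AXV A' tau tA _ _ nP V0).
  have [r [V' VV']] := split_off cA' cV tauP nV.
  have qr := row_pfg R r; have cVr := CM_prod cV (CM_pfg qr).
  have cV' : CM V'.
    by apply: (CM_summand cVr); apply: mod_iso_trans (mod_iso_prodC _ _) VV'.
  have fV' := CM_fg cV'; have fAV' := fg_prod fA' fV'.
  have VVs : stable_iso (A' * V')%type V.
    apply: (stable_iso_trans fAV' fV) (stable_iso_pfg fV qr).
    by apply: mod_iso_stable => //; apply: CM_fg.
  have XV' : stable_iso X V'.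
    apply: IH => // B sg tB n p Xn V'p; have [cB [sgP _]] := tB; have fB := CM_fg cB.
    have [a aP] := radical_finite nR lR res fR cB sgP cA.
    have aP' := qdim_radical_stable fB sgP fA fA' AA' aP.
    have := qdim_radical_stable fB sgP fAV' fV VVs (qdim_radical_prod fB sgP aP' V'p).
    by move/(AXV B sg tB _ _ (qdim_radical_prod fB sgP aP Xn))/addnI.
  apply: (stable_iso_trans fAX fV) VVs.
  exact: stable_iso_prod.
Qed.

Lemma stable_hom_dimP X M n : finitely_generated M ->
  stable_hom_dim X M n <-> qdim (free_hom X M) n.
Proof.
move=> fM; have combE p (b : 'I_p -> hom X M) (c : 'I_p -> k) x :
    lin_of_hom (kcomb b c) x = \sum_i (c i)%:A *: lin_of_hom (b i) x.
  by rewrite (big_morph (fun h : hom X M => lin_of_hom h x) (fun f g => homD f g x) (hom0 M x)).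
apply: iff_trans (iff_sym (qdim_basis n (is_sub_free_hom X fM))); split=> -[b bP].
  exists (fun i => hom_of (b i)) => f; have [c [cP cU]] := bP (lin_of_hom f).
  exists c; split=> [|d dP]; first by apply: factors_eq cP => x; rewrite homB combE.
  by apply: cU; apply: factors_eq dP => x; rewrite homB combE.
exists (fun i => lin_of_hom (b i)) => f; have [c [cP cU]] := bP (hom_of f).
exists c; split=> [|d dP]; first by apply: factors_eq cP => x; rewrite homB combE.
by apply: cU; apply: factors_eq dP => x; rewrite homB combE.
Qed.

End Counting.

Theorem theorem2p9 (k : closedFieldType) (char_k : [pchar k] =i pred0)
  (R : comAlgType k) (m : set R)
  (R_noetherian : noetherian_ring R)
  (R_local : local_ring_at m)
  (R_complete : adically_complete m)
  (R_residue : residue_field_is_base m)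
  (R_gorenstein : gorenstein R)
  (R_finite_type : finite_representation_type R)
  (M N : lmodType R) (M_CM : cohen_macaulay M) (N_CM : cohen_macaulay N)
  (dim_eq : forall X : lmodType R, cohen_macaulay X ->
     forall n : nat, stable_hom_dim X M n <-> stable_hom_dim X N n)
  (F : free_resolution M) (G : free_resolution N) :
  stable_iso (M * syzygy F)%type (N * syzygy G)%type.
Proof.
have cM := cohen_macaulay_CM M_CM; have cN := cohen_macaulay_CM N_CM.
have sF := syzygy_short_exact F; have qF := res_pfg F 0.
have sG := syzygy_short_exact G; have qG := res_pfg G 0.
have [cSM _] := CM_syzygy sF qF cM; have [cSN _] := CM_syzygy sG qG cN.
have homfin X Y := @free_hom_finite k R m R_noetherian R_local R_residue R_finite_type X Y.
have radfin A tau X := @radical_finite k R m R_noetherian R_local R_residue R_finite_type A tau X.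
have hMN X h : CM X -> qdim (free_hom X M) h -> qdim (free_hom X N) h.
  move=> cX /(stable_hom_dimP X h (CM_fg cM))/(dim_eq X (CM_cohen_macaulay cX)).
  by move/(stable_hom_dimP X h (CM_fg cN)).
apply: (same_multiplicities_stable_iso char_k R_noetherian R_local R_complete R_residue
  R_finite_type); [exact: CM_prod | exact: CM_prod |].
move=> A tau [cA [tauP [P [C [i [p [sp qP cC]]]]]]] n1 n2 Mn Nn.
have [B [D [cB cD count]]] := multiplicity_count R_noetherian R_local R_residue
  R_finite_type sp qP cC tauP.
have [hA AP] := homfin _ _ cA cM; have [hB BP] := homfin _ _ cB cM.
have [hD DP] := homfin _ _ cD cM.
have [a aP] := radfin _ _ _ cA tauP cSM; have [b bP] := radfin _ _ _ cA tauP cM.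
have [c cP] := radfin _ _ _ cA tauP cSN; have [d dP] := radfin _ _ _ cA tauP cN.
have fA := CM_fg cA.
rewrite (qdim_unique Mn (qdim_radical_prod fA tauP bP aP)).
rewrite (qdim_unique Nn (qdim_radical_prod fA tauP dP cP)).
(* After adding [hB] both sums equal [hD + hA], where by [hMN] these three dimensions are the same
   for M and N. *)
apply: (@addIn hB); rewrite addnC [(d + c)%N]addnC; rewrite [(b + a)%N]addnC addnC.
rewrite (count _ _ _ _ _ cM sF qF _ _ _ _ _ aP bP AP BP DP).
by rewrite (count _ _ _ _ _ cN sG qG _ _ _ _ _ cP dP (hMN _ _ cA AP) (hMN _ _ cB BP) (hMN _ _ cD DP)).
Qed.
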